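(* Let $m\ge2$. (i) A geodesic hypersphere in $\mathbb{CP}^m(4)$ of any radius $r\in(0,\pi/2)$, $r\neq\cot^{-1}\sqrt{1/(2m+1)}$, is of 2-type in $H(m+1)$. A geodesic hypersphere in $\mathbb{CH}^m(-4)$ of arbitrary radius $r>0$ is of 2-type in $H^1(m+1)$ via $\tilde x$, and the same holds true for a tube of an arbitrary radius $r>0$ about a totally geodesic complex hyperbolic hyperplane $\mathbb{CH}^{m-1}(-4)\subset\mathbb{CH}^m(-4)$. These statements are also valid for any open portion of the respective submanifolds. (ii) The only complete mass-symmetric hypersurfaces of class $A_1$ are geodesic hyperspheres of radius $r=\cot^{-1}\sqrt{1/m}$ in $\mathbb{CP}^m(4)$.
   Context: Let $c=\pm1$. On $\mathbb{C}^{m+1}$ let $\Psi_c(z,w)=c\,\bar z_0w_0+\sum_{j=1}^m\bar z_jw_j$, with (pseudo-)Riemannian metric $\operatorname{Re}\Psi_c$. $\mathbb{CQ}^m(4c)$ is the quotient of $\{z:\Psi_c(z,z)=c\}$ by $S^1$ with the submersion metric: it is $\mathbb{CP}^m(4)$ for $c=1$ and $\mathbb{CH}^m(-4)$ for $c=-1$, of constant holomorphic sectional curvature $4c$. $H^{(1)}(m+1)$ (written $H(m+1)$ for $c=1$, $H^1(m+1)$ for $c=-1$) is the space of $\Psi_c$-Hermitian complex $(m+1)\times(m+1)$ matrices ($\Psi_c(Az,w)=\Psi_c(z,Aw)$) with metric $\langle A,B\rangle=\frac c2\operatorname{tr}(AB)$. $\Phi:\mathbb{CQ}^m(4c)\to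 H^{(1)}(m+1)$ is the isometric embedding sending a complex line to the $\Psi_c$-orthogonal projector onto it, $\Phi([z])v=c\,\Psi_c(z,v)z$ for $\Psi_c(z,z)=c$; its image lies in the hyperquadric $\langle P-\frac{I}{m+1},P-\frac{I}{m+1}\rangle=\frac{cm}{2(m+1)}$ centered at $I/(m+1)$. Hypersurfaces of class $A_1$ are (open portions of): in $\mathbb{CP}^m(4)$, geodesic hyperspheres of radius $r\in(0,\frac\pi2)$; in $\mathbb{CH}^m(-4)$, geodesic hyperspheres of radius $r>0$ (subclass $A_1'$) and tubes of radius $r>0$ about a totally geodesic $\mathbb{CH}^{m-1}(-4)$ (subclass $A_1''$). For a real hypersurface given by an isometric immersion $x:M\to\mathbb{CQ}^m(4c)$ put $\tilde x=\Phi\circ x$. The Laplacian of $M$, $\Delta=-\operatorname{tr}\operatorname{Hess}$, acts on matrix-valued functions componentwise. $M$ is of $k$-type if $\tilde x=\tilde x_0+\tilde x_{t_1}+\dots+\tilde x_{t_k}$ with $\tilde x_0$ constant, each $\tilde x_{t_i}$ a nonconstant $H^{(1)}(m+1)$-valued function with $\Delta\tilde x_{t_i}=\lambda_{t_i}\tilde x_{t_i}$, and $\lambda_{t_i}\in\mathbb{R}$ mutually distinct. It is mass-symmetric if $\tilde x_0=I/(m+1)$ (if one of the $\lambda_{t_i}$ is zero, so-called null $k$-type, $\tilde x_0$ is not unique and $M$ is by definition mass-symmetric).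
   Formalization: In (ii), tubes about a totally geodesic CH^{m-1}(-4) of the one radius with coth r = √(2m-1) are excluded: they are complete, of class A_1'' and null 2-type, hence mass-symmetric by the stated definition, so (ii) fails for them. *)

(* Defs.v *)
From HB Require Import structures.
From mathcomp Require Import all_boot all_order all_algebra.
From mathcomp Require Import all_classical all_reals all_analysis.
From mathcomp Require Import complex.

Set Implicit Arguments.
Unset Strict Implicit.
Unset Printing Implicit Defensive.

Import Order.TTheory GRing.Theory Num.Theory.
Import numFieldNormedType.Exports.

Local Open Scope classical_set_scope.
Local Open Scope ring_scope.
Local Open Scope quotient_scope.

Section Psi.
Variables (R : realType) (m : nat) (c : R).

Definition Psi (z w : 'cV[R[i]]_m.+1) : R[i] :=
  (c%:C)%C * (z ord0 0)^* * w ord0 0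
  + \sum_(j < m) (z (lift ord0 j) 0)^* * w (lift ord0 j) 0.

(* The hyperquadric {z | Psi z z = c} (a sphere for c = 1, an anti-de Sitter
   space for c = -1). *)
Definition hyperquadric : Type := {z : 'cV[R[i]]_m.+1 | Psi z z == (c%:C)%C}.
HB.instance Definition _ := SubChoice.on hyperquadric.

Definition circle_rel : rel hyperquadric := fun z w =>
  `[< exists2 u : R[i], `|u| = 1 & val w = u *: val z >].

Fact circle_rel_refl : reflexive circle_rel.
Proof. by move=> z; apply/asboolP; exists 1; rewrite ?normr1 ?scale1r. Qed.

Fact circle_rel_sym : symmetric circle_rel.
Proof.
suff h z w : circle_rel z w -> circle_rel w z by move=> z w; apply/idP/idP; exact: h.
move=> /asboolP[u u1 zw]; apply/asboolP; exists u^-1.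
  by rewrite normrV ?u1 ?invr1// unitfE -normr_eq0 u1 oner_eq0.
by rewrite zw scalerA mulVf ?scale1r// -normr_eq0 u1 oner_eq0.
Qed.

Fact circle_rel_trans : transitive circle_rel.
Proof.
move=> y x z /asboolP[u u1 xy] /asboolP[v v1 yz]; apply/asboolP.
by exists (v * u); rewrite ?normrM ?u1 ?v1 ?mulr1// yz xy scalerA.
Qed.

Canonical circle_equiv :=
  EquivRel circle_rel circle_rel_refl circle_rel_sym circle_rel_trans.

(* CQ^m(4c); every metric notion on it is expressed below through lifts to the
   hyperquadric. *)
Definition CQ : Type := {eq_quot circle_rel}.
HB.instance Definition _ := Quotient.on CQ.
HB.instance Definition _ := Choice.on CQ.

Definition proj (z : hyperquadric) : CQ := \pi_CQ z.

(* Since the fibre through z is the circle S^1 z, the horizontal part of a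
   tangent vector v is v - c Psi(z, v) z; the submersion metric of CQ is
   Re Psi on horizontal parts. *)
Definition horizontal (z v : 'cV[R[i]]_m.+1) : 'cV[R[i]]_m.+1 :=
  v - ((c%:C)%C * Psi z v) *: z.

Definition submersion_metric (z v w : 'cV[R[i]]_m.+1) : R :=
  complex.Re (Psi (horizontal z v) (horizontal z w)).

Definition Phi (p : CQ) : 'M[R[i]]_m.+1 :=
  let z := val (repr p) in
  \matrix_(i, j) ((c%:C)%C * Psi z (delta_mx j 0) * z i 0).

Definition psi_hermitian (A : 'M[R[i]]_m.+1) : Prop :=
  forall z w : 'cV[R[i]]_m.+1, Psi (A *m z) w = Psi z (A *m w).

(* Derivative in the direction v of a map into C^(m+1), componentwise. *)
Definition cderive (V : normedModType R) (f : V -> 'cV[R[i]]_m.+1) (v x : V) :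
    'cV[R[i]]_m.+1 :=
  \col_i Complex ('D_v (fun y => complex.Re (f y i 0)) x)
                 ('D_v (fun y => complex.Im (f y i 0)) x).

End Psi.

Arguments CQ : clear implicits.
Arguments hyperquadric : clear implicits.

Section Distance.
Variables (R : realType) (m : nat) (c : R).
Local Notation CQ := (CQ R m c).

Definition C1_function (f : R -> R) : Prop :=
  (forall t, derivable f t 1) /\ continuous (derive1 f).

(* Curves of CQ are given by lifts.  Their velocity may vanish, so corners can
   be smoothed by reparametrization: the distance below is the one obtained
   from piecewise C^1 curves. *)
Definition C1_curve (g : R -> hyperquadric R m c) : Prop :=
  forall i, C1_function (fun t => complex.Re (val (g t) i 0)) /\
            C1_function (fun t => complex.Im (val (g t) i 0)).

Definition curve_length (g : R -> hyperquadric R m c) : \bar R :=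
  (\int[lebesgue_measure]_(t in `[0%R, 1%R])
     (let v := cderive (fun s => val (g s)) 1 t in
      Num.sqrt (submersion_metric c (val (g t)) v v))%:E)%E.

Definition joins_in (M : set CQ) (p q : CQ) (g : R -> hyperquadric R m c) :=
  [/\ C1_curve g, proj (g 0) = p, proj (g 1) = q
    & forall t, 0 <= t <= 1 -> M (proj (g t))].

(* Riemannian distance of M with the metric induced from CQ; it is +oo when p
   and q are not joined by a curve inside M. *)
Definition riemannian_dist (M : set CQ) (p q : CQ) : \bar R :=
  ereal_inf [set curve_length g | g in joins_in M p q].

Definition riemannian_complete (M : set CQ) : Prop :=
  forall u : nat -> CQ, (forall k, M (u k)) ->
    (forall e : R, 0 < e -> exists N : nat, forall k l : nat,
       (N <= k)%N -> (N <= l)%N -> (riemannian_dist M (u k) (u l) < e%:E)%E) ->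
  exists2 p, M p &
    forall e : R, 0 < e -> exists N : nat, forall k : nat,
      (N <= k)%N -> (riemannian_dist M (u k) p < e%:E)%E.

Definition geodesic_hypersphere (p : CQ) (r : R) : set CQ :=
  [set q | riemannian_dist setT p q = r%:E].

Definition tube (S : set CQ) (r : R) : set CQ :=
  [set q | ereal_inf [set riemannian_dist setT p q | p in S] = r%:E].

(* For c = -1 and Psi(w, w) > 0, the restriction of Psi to the orthogonal
   complement of w has signature (1, m - 1), and this is a totally geodesic
   CH^(m-1)(-4). *)
Definition complex_hyperplane (w : 'cV[R[i]]_m.+1) : set CQ :=
  [set proj z | z in [set z : hyperquadric R m c | Psi c w (val z) = 0]].

Definition is_CH_hyperplane (S : set CQ) : Prop :=
  exists2 w : 'cV[R[i]]_m.+1,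
    0 < complex.Re (Psi c w w) & S = complex_hyperplane w.

(* M is a nonempty open subset of Q, for the topology of Q as a subspace of the
   quotient CQ; M need not be connected. *)
Definition open_portion (M Q : set CQ) : Prop :=
  [/\ M !=set0, M `<=` Q &
   forall z : hyperquadric R m c, M (proj z) ->
     exists2 e : R, 0 < e &
     forall w : hyperquadric R m c,
       (forall i, `|val w i 0 - val z i 0| < (e%:C)%C) ->
       Q (proj w) -> M (proj w)].

Definition class_A1' (M : set CQ) : Prop :=
  c = -1 /\ exists p r, 0 < r /\ open_portion M (geodesic_hypersphere p r).

Definition class_A1'' (M : set CQ) : Prop :=
  c = -1 /\ exists S r,
    [/\ is_CH_hyperplane S, 0 < r & open_portion M (tube S r)].

Definition class_A1 (M : set CQ) : Prop :=
  [\/ c = 1 /\ exists p r,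
        0 < r < pi / 2 /\ open_portion M (geodesic_hypersphere p r),
      class_A1' M | class_A1'' M].

End Distance.

Section LocalGeometry.
Variables (R : realType) (n : nat).
Local Notation V := 'rV[R]_n.

Definition pd (i : 'I_n) (f : V -> R) : V -> R := 'D_(delta_mx 0 i) f.

Fixpoint Ck (k : nat) (U : set V) (f : V -> R) : Prop :=
  (forall x, U x -> {for x, continuous f}) /\
  (if k is k'.+1 then
     forall i, (forall x, U x -> derivable f x (delta_mx 0 i)) /\
               Ck k' U (pd i f)
   else True).

Definition smooth (U : set V) (f : V -> R) : Prop := forall k, Ck k U f.

Definition christoffel (g : V -> 'M[R]_n) (k i j : 'I_n) (x : V) : R :=
  2^-1 * \sum_l invmx (g x) k l *
    (pd i (fun y => g y j l) x + pd j (fun y => g y i l) x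
     - pd l (fun y => g y i j) x).

Definition hessian (g : V -> 'M[R]_n) (f : V -> R) (i j : 'I_n) (x : V) : R :=
  pd i (pd j f) x - \sum_k christoffel g k i j x * pd k f x.

(* The sign makes the Laplacian a nonnegative operator. *)
Definition laplacian (g : V -> 'M[R]_n) (f : V -> R) (x : V) : R :=
  - \sum_i \sum_j invmx (g x) i j * hessian g f i j x.

End LocalGeometry.

Section FiniteType.
Variables (R : realType) (m : nat) (c : R).
Local Notation CQ := (CQ R m c).
Local Notation V := ('rV[R]_(2 * m - 1)).

Definition induced_metric (phi : V -> hyperquadric R m c) (x : V) :
    'M[R]_(2 * m - 1) :=
  \matrix_(i, j) submersion_metric c (val (phi x))
                   (cderive (fun y => val (phi y)) (delta_mx 0 i) x)
                   (cderive (fun y => val (phi y)) (delta_mx 0 j) x).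

(* phi is a lift of an immersion of U into the hypersurface M; the dimensions
   being equal, the immersion is locally a diffeomorphism onto an open part of
   M. *)
Definition local_parametrization (M : set CQ) (U : set V)
    (phi : V -> hyperquadric R m c) : Prop :=
  [/\ open U,
      forall i, smooth U (fun y => complex.Re (val (phi y) i 0)) /\
                smooth U (fun y => complex.Im (val (phi y) i 0)),
      forall x, U x -> M (proj (phi x)) &
      forall x, U x -> induced_metric phi x \in unitmx].

(* f is smooth on M and Delta f = lambda f. *)
Definition eigenfunction (M : set CQ) (lambda : R) (f : CQ -> R) : Prop :=
  forall U phi, local_parametrization M U phi ->
    smooth U (fun y => f (proj (phi y))) /\
    forall x, U x ->
      laplacian (induced_metric phi) (fun y => f (proj (phi y))) x
      = lambda * f (proj (phi x)).

Definition eigenmatrix (M : set CQ) (lambda : R) (F : CQ -> 'M[R[i]]_m.+1) :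
    Prop :=
  forall i j, eigenfunction M lambda (fun p => complex.Re (F p i j)) /\
              eigenfunction M lambda (fun p => complex.Im (F p i j)).

Definition spectral_decomposition (M : set CQ) (k : nat) (x0 : 'M[R[i]]_m.+1)
    (lambda : 'I_k -> R) (x_ : 'I_k -> CQ -> 'M[R[i]]_m.+1) : Prop :=
  [/\ injective lambda,
      forall i, [/\ forall p, M p -> psi_hermitian c (x_ i p),
                    ~ (exists A, forall p, M p -> x_ i p = A) &
                    eigenmatrix M (lambda i) (x_ i)] &
      forall p, M p -> Phi p = x0 + \sum_i x_ i p].

Definition finite_type (M : set CQ) (k : nat) : Prop :=
  exists x0 lambda x_, @spectral_decomposition M k x0 lambda x_.

(* The second alternative is the null case, in which the constant term is not
   unique. *)
Definition mass_symmetric (M : set CQ) : Prop :=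
  exists k x0 lambda x_, @spectral_decomposition M k x0 lambda x_ /\
    (x0 = (m.+1%:R^-1)%:M \/ exists i, lambda i = 0).

End FiniteType.

Definition acot (R : realType) (x : R) : R := pi / 2 - atan x.

Definition coth (R : realType) (x : R) : R :=
  (expR x + expR (- x)) / (expR x - expR (- x)).

(* Main.v *)
Require Import Defs.
From mathcomp Require Import all_boot all_order all_algebra.
From mathcomp Require Import all_classical all_reals all_analysis.
From mathcomp Require Import complex.
From mathcomp Require Import ring lra.
Import Order.TTheory GRing.Theory Num.Theory.
Import numFieldNormedType.Exports.
Local Open Scope classical_set_scope.
Local Open Scope ring_scope.
Set Implicit Arguments.
Unset Strict Implicit.
Unset Printing Implicit Defensive.

(** Spheres and tubes are level sets of one linear function. Let [A] be the [Psi]-orthogonal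
    projector onto the line of a vector a with Psi(a,a) = eps, where eps is 1 or -1. Then tr(A
    Phi[z]) = eps c |Psi(a,z)|^2, and |Psi(z,w)| is the cosine (c = 1) or hyperbolic cosine (c = -1)
    of the distance from [z] to [w] ([riemannian_distP]). Hence the geodesic hypersphere of radius r
    about [a] is the level tr(A Phi) = k with k = cos^2 r or k = cosh^2 r ([geodesic_hypersphereE]).
    The tube of radius r about the complex hyperplane orthogonal to a is the level k = - sinh^2 r
    ([tubeE]).

    On such a level set write X for Phi and L for the trace of its Hessian, so that Delta X = - L.
    Three facts determine L: differentiating X^2 = X twice expresses L - LX - XL through first
    derivatives; the Hessian of an isometric immersion is normal; tr(A L) = 0. Solving these
    equations gives L as a combination of X, AX + XA, I and A whose coefficients depend only on c, k
    and m ([lap_Phi]). Relative to the line of a and its orthogonal complement, the corner A X A = k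
    A is constant, while the off-diagonal blocks ([cross_part]) and the trace-free part of the
    remaining block ([orth_part]) are eigenmatrices, with eigenvalues c((2m-2)k+1)/(k(1-k)) and
    4mc/(1-k). Neither is constant, so the level set is of 2-type once the eigenvalues differ. They
    agree only for k = 1/(2m+2) ([eigenvalue_eq]). This is the excluded radius in CP^m, and is
    impossible in CH^m, where k > 1 or k < 0.

    For mass-symmetry, a polynomial in the Laplacian compares two spectral decompositions. If the
    cross eigenvalue is nonzero, every decomposition has constant term k A + ((1-k)/m)(I - A)
    ([decomposition_center]), which is I/(m+1) only for k = 1/(m+1): cot^2 r = 1/m in CP^m, and
    never in CH^m. The cross eigenvalue vanishes only on the tubes with coth^2 r = 2m-1, which the
    statement sets apart. A complete open portion is the whole level set, because it cannot stop
    along curves joining the points of the level set ([complete_quadric]), and the spheres of CP^m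
    are complete ([sphere_complete]).

    Eigenfunctions are tested on all local parametrizations, so nonconstancy and uniqueness require
    that parametrizations exist; stereographic projection supplies them ([chart_exists]). *)

Local Notation proj := Defs.proj.

(** * Closure properties of smooth functions on open sets *)

Section SmoothFunctions.
Variables (R : realType) (n : nat).
Local Notation V := 'rV[R]_n.
Implicit Types (U : set V) (f g : V -> R).

Lemma open_near_eq U f g x : open U -> (forall y, U y -> f y = g y) -> U x ->
  \near x, f x = g x.
Proof.
move=> oU fg Ux; have : nbhs x U by apply: open_nbhs_nbhs.
by apply: filterS => y; exact: fg.
Qed.

Lemma eq_continuous_open U f g : open U -> (forall y, U y -> f y = g y) ->
  (forall x, U x -> {for x, continuous f}) ->
  forall x, U x -> {for x, continuous g}.
Proof.
move=> oU fg cf x Ux; have nfg := open_near_eq oU fg Ux.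
suff : g @ x --> f x by rewrite (nbhs_singleton nfg).
apply: (cvg_trans _ (cf x Ux)); exact: (near_eq_cvg nfg).
Qed.

(** Partial derivatives depend only on germs, so agreement on an open set is inherited by every
    iterated partial derivative. *)
Lemma eq_Ck k U f g : open U -> (forall y, U y -> f y = g y) ->
  Ck k U f -> Ck k U g.
Proof.
move=> oU; elim: k f g => [|k IH] f g fg [cf df]; split=> //.
- exact: eq_continuous_open oU fg cf.
- exact: eq_continuous_open oU fg cf.
- move=> i; have [dfi Cfi] := df i; split.
    move=> x Ux; have nfg := open_near_eq oU fg Ux.
    by apply: (near_eq_derivable nfg); exact: dfi.
  apply: IH Cfi => y Uy; apply: near_eq_derive.
  exact: open_near_eq oU fg Uy.
Qed.

Lemma CkW k U f : Ck k.+1 U f -> Ck k U f.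
Proof.
elim: k f => [|k IH] f [cf df]; split=> // i.
by have [dfi Cfi] := df i; split=> //; exact: IH.
Qed.

Lemma Ck_cst k U (a : R) : Ck k U (fun=> a).
Proof.
elim: k a => [|k IH] a; split=> //; try by move=> x _; apply: cst_continuous.
move=> i; split; first by move=> x _; exact: (derivable_cst a x _).
suff -> : pd i (fun=> a : R) = (fun=> 0 : R) by exact: IH.
by apply/funext => x; exact: derive_cst.
Qed.

Lemma CkD k U f g : open U -> Ck k U f -> Ck k U g ->
  Ck k U (fun y => f y + g y).
Proof.
move=> oU; elim: k f g => [|k IH] f g [cf df] [cg dg]; split=> //;
  try by move=> x Ux; apply: continuousD; [exact: cf|exact: cg].
move=> i; have [dfi Cfi] := df i; have [dgi Cgi] := dg i; split=> [x Ux|].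
  by apply: derivableD; [exact: dfi|exact: dgi].
apply: (@eq_Ck k U (fun y => pd i f y + pd i g y)) => //; last exact: IH.
by move=> y Uy; rewrite /pd -deriveD//; [exact: dfi|exact: dgi].
Qed.

Lemma CkM k U f g : open U -> Ck k U f -> Ck k U g ->
  Ck k U (fun y => f y * g y).
Proof.
move=> oU; elim: k f g => [|k IH] f g [cf df] [cg dg]; split=> //;
  try by move=> x Ux; apply: continuousM; [exact: cf|exact: cg].
move=> i; have [dfi Cfi] := df i; have [dgi Cgi] := dg i; split=> [x Ux|].
  by apply: derivableM; [exact: dfi|exact: dgi].
apply: (@eq_Ck k U (fun y => f y * pd i g y + g y * pd i f y)) => //.
  by move=> y Uy; rewrite /pd -deriveM//; [exact: dfi|exact: dgi].
by apply: CkD => //; apply: IH => //; apply: CkW; split.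
Qed.

(** The partial derivatives of 1/f are - f^-2 times those of f, and 1/f is already C^k by
    induction. *)
Lemma CkV k U f : open U -> (forall x, U x -> f x != 0) -> Ck k U f ->
  Ck k U (fun y => (f y)^-1).
Proof.
move=> oU f0; elim: k => [|k IH] [cf df]; split=> //;
  try by move=> x Ux; apply: (continuousV (f0 x Ux)); exact: cf.
move=> i; have [dfi Cfi] := df i; split=> [x Ux|].
  by apply: derivableV; [exact: f0|exact: dfi].
have CV : Ck k U (fun y => (f y)^-1) by apply: IH; apply: CkW; split.
apply: (@eq_Ck k U (fun y => (-1) * ((f y)^-1 * (f y)^-1) * pd i f y)) => //.
  move=> y Uy; rewrite /pd deriveV; [|exact: f0|exact: dfi].
  by rewrite -exprVn expr2 mulN1r.
by repeat (apply: CkM => //); exact: Ck_cst.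
Qed.

Lemma smooth_cst U a : smooth U (fun=> a).
Proof. by move=> k; exact: Ck_cst. Qed.

Lemma smoothD U f g : open U -> smooth U f -> smooth U g ->
  smooth U (fun y => f y + g y).
Proof. by move=> oU sf sg k; exact: CkD. Qed.

Lemma smoothM U f g : open U -> smooth U f -> smooth U g ->
  smooth U (fun y => f y * g y).
Proof. by move=> oU sf sg k; exact: CkM. Qed.

Lemma smoothN U f : open U -> smooth U f -> smooth U (fun y => - f y).
Proof.
move=> oU sf; rewrite (_ : (fun y => _) = (fun y => (-1) * f y)).
  by apply: smoothM => //; exact: smooth_cst.
by apply/funext => y; rewrite mulN1r.
Qed.

Lemma smoothV U f : open U -> (forall x, U x -> f x != 0) -> smooth U f ->
  smooth U (fun y => (f y)^-1).
Proof. by move=> oU f0 sf k; exact: CkV. Qed.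

Lemma smooth_sum U (I : Type) (r : seq I) (F : I -> V -> R) : open U ->
  (forall i, smooth U (F i)) -> smooth U (fun y => \sum_(i <- r) F i y).
Proof.
move=> oU sF; elim: r => [|i r IH].
  rewrite (_ : (fun y => _) = fun=> 0); first exact: smooth_cst.
  by apply/funext => y; rewrite big_nil.
rewrite (_ : (fun y => _) = fun y => F i y + \sum_(j <- r) F j y); first exact: smoothD.
by apply/funext => y; rewrite big_cons.
Qed.

Lemma smooth_prod U (I : Type) (r : seq I) (F : I -> V -> R) : open U ->
  (forall i, smooth U (F i)) -> smooth U (fun y => \prod_(i <- r) F i y).
Proof.
move=> oU sF; elim: r => [|i r IH].
  rewrite (_ : (fun y => _) = fun=> 1); first exact: smooth_cst.
  by apply/funext => y; rewrite big_nil.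
rewrite (_ : (fun y => _) = fun y => F i y * \prod_(j <- r) F j y); first exact: smoothM.
by apply/funext => y; rewrite big_cons.
Qed.

Lemma smooth_derivable U f i x : smooth U f -> U x ->
  derivable f x (delta_mx 0 i).
Proof. by move=> sf Ux; have [_ /(_ i)[+ _]] := sf 1%N; exact. Qed.

Lemma smooth_continuous U f x : smooth U f -> U x -> {for x, continuous f}.
Proof. by move=> sf Ux; have [+ _] := sf 1%N; exact. Qed.

Lemma smooth_pd U f i : smooth U f -> smooth U (pd i f).
Proof. by move=> sf k; have [_ /(_ i)[]] := sf k.+1. Qed.

Lemma eq_smooth U f g : open U -> (forall y, U y -> f y = g y) ->
  smooth U f -> smooth U g.
Proof. by move=> oU fg sf k; exact: eq_Ck (sf k). Qed.

Lemma subset_smooth U U' f : U' `<=` U -> smooth U f -> smooth U' f.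
Proof.
move=> sU sf k; elim: k f {sf}(sf k) => [|k IH] f [cf df]; split=> //;
  try by move=> x /sU; exact: cf.
by move=> i; have [dfi Cfi] := df i; split; [move=> x /sU; exact: dfi|exact: IH].
Qed.

Lemma eq_pd U f g i x : open U -> (forall y, U y -> f y = g y) -> U x ->
  pd i f x = pd i g x.
Proof. by move=> oU fg Ux; apply: near_eq_derive; exact: open_near_eq oU fg Ux. Qed.

Lemma derivable_coord i j (x : V) : derivable (fun y : V => y 0 i) x (delta_mx 0 j).
Proof. exact: diff_derivable (differentiable_coord _ _ _). Qed.

Lemma pd_coord i j (x : V) : pd j (fun y : V => y 0 i) x = (i == j)%:R.
Proof.
have := derive_mx (@derivable_id _ _ x (delta_mx 0 j : V)).
by rewrite derive_id => /matrixP/(_ 0 i); rewrite !mxE eqxx/= /pd => ->.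
Qed.

Lemma smooth_coord U i : smooth U (fun y : V => y 0 i).
Proof.
have cf : forall x : V, U x -> {for x, continuous (fun y : V => y 0 i)}.
  by move=> x _; exact: coord_continuous.
case=> [|k]; split=> //.
move=> j; split; first by move=> x _; exact: derivable_coord.
suff -> : pd j (fun y : V => y 0 i) = (fun=> (i == j)%:R) by exact: Ck_cst.
by apply/funext => x; rewrite pd_coord.
Qed.

End SmoothFunctions.

(** * Symmetry of second derivatives *)

Section Schwarz.
Variables (R : realType) (V : normedModType R).
Implicit Types (f : V -> R) (x u v : V).

Lemma is_derive_line f x u (s : R) : derivable f (x + s *: u) u ->
  is_derive s 1 (fun t => f (x + t *: u)) ('D_u f (x + s *: u)).
Proof.
move=> df.
have E : (fun h : R => h^-1 *: (((fun t => f (x + t *: u)) \o shift s) (h *: 1)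
     - f (x + s *: u))) =
   (fun h => h^-1 *: ((f \o shift (x + s *: u)) (h *: u) - f (x + s *: u))).
  apply/funext => h /=; congr (_ *: (f _ - _)).
  by rewrite [h *: 1]mulr1 scalerDl addrCA.
apply: DeriveDef; first by rewrite /derivable E.
by rewrite /derive E.
Qed.

Lemma mean_value_line f x u (h : R) : 0 < h ->
  (forall s, 0 <= s <= h -> derivable f (x + s *: u) u) ->
  exists2 s, 0 <= s <= h & f (x + h *: u) - f x = h * 'D_u f (x + s *: u).
Proof.
move=> h0 df.
have dg s : 0 <= s <= h -> is_derive s 1 (fun t => f (x + t *: u)) ('D_u f (x + s *: u)).
  by move=> sh; apply: is_derive_line; exact: df.
have dgo s : s \in `]0, h[ ->
    is_derive s 1 (fun t => f (x + t *: u)) ('D_u f (x + s *: u)).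
  by rewrite in_itv/= => /andP[? ?]; apply: dg; rewrite !ltW.
have [|s sh E] := MVT h0 dgo.
  apply: derivable_within_continuous => s; rewrite in_itv/= => sh.
  by have [] := dg s sh.
exists s; first by move: sh; rewrite in_itv/= => /andP[? ?]; rewrite !ltW.
by move: E; rewrite scale0r addr0 subr0 mulrC.
Qed.

(** The mean value theorem is applied in direction u to the difference y -> f(y + hv) - f(y), then
    in direction v to the u-derivative of f. *)
Lemma second_difference f x u v (h : R) : 0 < h ->
  (forall s t, 0 <= s <= h -> 0 <= t <= h -> derivable f (x + s *: u + t *: v) u) ->
  (forall s t, 0 <= s <= h -> 0 <= t <= h ->
    derivable ('D_u f) (x + s *: u + t *: v) v) ->
  exists s t, [/\ 0 <= s <= h, 0 <= t <= h &
    f (x + h *: u + h *: v) - f (x + h *: u) - f (x + h *: v) + f x =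
    h ^+ 2 * 'D_v ('D_u f) (x + s *: u + t *: v)].
Proof.
move=> h0 df ddf; have hh : 0 <= h <= h by rewrite lexx ltW.
have h00 : 0 <= (0 : R) <= h by rewrite lexx ltW.
pose g y := f (y + h *: v) - f y.
have dg s : 0 <= s <= h -> is_derive (x + s *: u) u g
   ('D_u f (x + s *: u + h *: v) - 'D_u f (x + s *: u)).
  move=> sh; apply: is_deriveB; last first.
    by apply: derivableP; have := df s 0 sh h00; rewrite scale0r addr0.
  have d1 := df s h sh hh.
  have E : (fun k : R => k^-1 *: (((fun y => f (y + h *: v)) \o shift (x + s *: u)) (k *: u)
      - f (x + s *: u + h *: v))) =
    (fun k => k^-1 *: ((f \o shift (x + s *: u + h *: v)) (k *: u) - f (x + s *: u + h *: v))).
    by apply/funext => k /=; congr (_ *: (f _ - _)); rewrite -!addrA.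
  by apply: DeriveDef; [rewrite /derivable E|rewrite /derive E].
have [s sh gs] := @mean_value_line g x u h h0 (fun s sh => @ex_derive _ _ _ _ _ _ _ (dg s sh)).
have [t th gt] := @mean_value_line ('D_u f) (x + s *: u) v h h0 (fun t th => ddf s t sh th).
exists s, t; split=> //.
rewrite expr2 -mulrA -gt -(@derive_val _ _ _ _ _ _ _ (dg s sh)) -gs /g.
by rewrite opprD opprK addrA.
Qed.

(** Both mixed derivatives, at points near x, equal the same second difference divided by h^2; by
    continuity their values at x differ by less than any positive e. *)
Lemma deriveC f x u v :
  (\forall y \near x, [/\ derivable f y u, derivable f y v,
     derivable ('D_u f) y v & derivable ('D_v f) y u]) ->
  {for x, continuous ('D_v ('D_u f))} -> {for x, continuous ('D_u ('D_v f))} ->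
  'D_v ('D_u f) x = 'D_u ('D_v f) x.
Proof.
move=> df c1 c2; apply/eqP; rewrite -subr_eq0 -normr_le0; apply/ler_addgt0Pr => e e0.
have e20 : 0 < e / 2 by rewrite divr_gt0.
have nearc (g : V -> R) : {for x, continuous g} ->
    \forall y \near x, `|g x - g y| < e / 2.
  by move/cvgrPdist_lt; exact.
have near1 := nearc _ c1; have near2 := nearc _ c2.
have [r /= r0 br] := (nbhs_ballP _ _).1 (filterI df (filterI near1 near2)).
(* For this h the parallelogram at x with sides h u and h v stays in the ball of radius r. *)
pose h := r / (2 * (1 + `|u| + `|v|)).
have k0 : 0 < 1 + `|u| + `|v| by rewrite -addrA ltr_pwDl// addr_ge0.
have h0 : 0 < h by rewrite divr_gt0// mulr_gt0.
have inb s t : 0 <= s <= h -> 0 <= t <= h -> ball x r (x + s *: u + t *: v).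
  move=> /andP[s0 sh] /andP[t0 th]; rewrite -ball_normE/=.
  rewrite opprD addrA opprD addrA subrr add0r.
  rewrite -opprD normrN (le_lt_trans (ler_normD _ _))// !normrZ !ger0_norm//.
  have l1 : s * `|u| <= h * `|u| by rewrite ler_wpM2r.
  have l2 : t * `|v| <= h * `|v| by rewrite ler_wpM2r.
  have -> : r = h + h + (h + h) * `|u| + (h + h) * `|v|.
    by rewrite /h; field; rewrite gt_eqF.
  have := mulr_ge0 (ltW h0) (normr_ge0 u); have := mulr_ge0 (ltW h0) (normr_ge0 v).
  by rewrite !mulrDl; lra.
have [s1 [t1 [s1h t1h E1]]] := @second_difference f x u v h h0
  (fun s t sh th => let: conj (And4 a _ _ _) _ := br _ (inb s t sh th) in a)
  (fun s t sh th => let: conj (And4 _ _ a _) _ := br _ (inb s t sh th) in a).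
have inb' s t : 0 <= s <= h -> 0 <= t <= h -> ball x r (x + s *: v + t *: u).
  by move=> sh th; rewrite addrAC; exact: inb.
have [s2 [t2 [s2h t2h E2]]] := @second_difference f x v u h h0
  (fun s t sh th => let: conj (And4 _ a _ _) _ := br _ (inb' s t sh th) in a)
  (fun s t sh th => let: conj (And4 _ _ _ a) _ := br _ (inb' s t sh th) in a).
have [_ [/= n1 _]] := br _ (inb s1 t1 s1h t1h).
have [_ [/= _ n2]] := br _ (inb' s2 t2 s2h t2h).
pose A : V -> R := 'D_v ('D_u f); pose B : V -> R := 'D_u ('D_v f).
have {}E1 : _ = h ^+ 2 * A (x + s1 *: u + t1 *: v) := E1.
have {}E2 : _ = h ^+ 2 * B (x + s2 *: v + t2 *: u) := E2.
have {}n1 : `|A x - A (x + s1 *: u + t1 *: v)| < e / 2 := n1.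
have {}n2 : `|B x - B (x + s2 *: v + t2 *: u)| < e / 2 := n2.
change (`|A x - B x| <= 0 + e); clearbody A B.
have E : A (x + s1 *: u + t1 *: v) = B (x + s2 *: v + t2 *: u).
  have h20 : h ^+ 2 != 0 by rewrite expf_neq0// gt_eqF.
  by apply: (mulfI h20); rewrite -E1 -E2 (addrAC x); ring.
rewrite add0r -(subrKA (A (x + s1 *: u + t1 *: v))) (le_trans (ler_normD _ _))//.
by rewrite [in X in _ + X]E [X in _ + X]distrC (splitr e) lerD// ltW.
Qed.

End Schwarz.

(** * Derivatives of complex-valued functions *)

Section ComplexDerivative.
Variables (R : realType) (V : normedModType R).
Local Notation C := R[i].
Local Notation Re := complex.Re.
Local Notation Im := complex.Im.
Implicit Types (f g : V -> C).

Definition is_cderive (x v : V) f (df : C) :=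
  is_derive x v (fun y => Re (f y)) (Re df) /\
  is_derive x v (fun y => Im (f y)) (Im df).

Lemma is_cderive_cst x v (a : C) : is_cderive x v (fun=> a) 0.
Proof. by split; exact: is_derive_cst. Qed.

Lemma is_cderiveD x v f g df dg : is_cderive x v f df -> is_cderive x v g dg ->
  is_cderive x v (fun y => f y + g y) (df + dg).
Proof.
move=> [f1 f2] [g1 g2]; split.
  rewrite (_ : (fun y => _) = (fun y => Re (f y)) + (fun y => Re (g y))).
    by rewrite raddfD; exact: is_deriveD.
  by apply/funext => y; rewrite !fctE raddfD.
rewrite (_ : (fun y => _) = (fun y => Im (f y)) + (fun y => Im (g y))).
  by rewrite raddfD; exact: is_deriveD.
by apply/funext => y; rewrite !fctE raddfD.
Qed.

Lemma is_cderiveM x v f g df dg : is_cderive x v f df -> is_cderive x v g dg ->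
  is_cderive x v (fun y => f y * g y) (df * g x + f x * dg).
Proof.
move=> [f1 f2] [g1 g2]; split.
  rewrite (_ : (fun y => _) = (fun y => Re (f y)) * (fun y => Re (g y))
     - (fun y => Im (f y)) * (fun y => Im (g y))).
    apply: is_derive_eq; case: (f x) (g x) df dg {f1 f2 g1 g2} => a b [c d] [e h] [k l] /=.
    by rewrite /GRing.scale/=; ring.
  by apply/funext => y; rewrite !fctE; case: (f y) (g y) => a b [c d].
rewrite (_ : (fun y => _) = (fun y => Re (f y)) * (fun y => Im (g y))
   + (fun y => Im (f y)) * (fun y => Re (g y))).
  apply: is_derive_eq; case: (f x) (g x) df dg {f1 f2 g1 g2} => a b [c d] [e h] [k l] /=.
  by rewrite /GRing.scale/=; ring.
by apply/funext => y; rewrite !fctE; case: (f y) (g y) => a b [c d].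
Qed.

Lemma is_cderive_conj x v f df : is_cderive x v f df ->
  is_cderive x v (fun y => (f y)^*) df^*.
Proof.
move=> [f1 f2]; split.
  rewrite (_ : (fun y => _) = (fun y => Re (f y))); last first.
    by apply/funext => y; case: (f y).
  by case: df f1 {f2}.
rewrite (_ : (fun y => _) = - (fun y => Im (f y))); last first.
  by apply/funext => y; rewrite !fctE; case: (f y).
have -> : Im df^* = - Im df by case: df {f1 f2}.
exact: is_deriveN.
Qed.

Lemma is_cderive_sum x v (I : Type) (r : seq I) (f : I -> V -> C) (df : I -> C) :
  (forall i, is_cderive x v (f i) (df i)) ->
  is_cderive x v (fun y => \sum_(i <- r) f i y) (\sum_(i <- r) df i).
Proof.
move=> fdf; elim: r => [|i r IH].
  rewrite big_nil (_ : (fun y => _) = fun=> 0); first exact: is_cderive_cst.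
  by apply/funext => y; rewrite big_nil.
rewrite big_cons (_ : (fun y => _) = fun y => f i y + \sum_(j <- r) f j y).
  exact: is_cderiveD.
by apply/funext => y; rewrite big_cons.
Qed.

End ComplexDerivative.

Section SmoothSchwarz.
Variables (R : realType) (n : nat).

Lemma pdC (U : set 'rV[R]_n) f i j x : open U -> smooth U f -> U x ->
  pd i (pd j f) x = pd j (pd i f) x.
Proof.
move=> oU sf Ux; apply: deriveC.
- have : nbhs x U by exact: open_nbhs_nbhs.
  by apply: filterS => y Uy; split; apply: (smooth_derivable _ Uy) => //; exact: smooth_pd.
- by apply: (smooth_continuous _ Ux); do 2 apply: smooth_pd.
- by apply: (smooth_continuous _ Ux); do 2 apply: smooth_pd.
Qed.

End SmoothSchwarz.

(** * The Hermitian form, its adjoints and its rank-one matrices *)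

Section Form.
Variables (R : realType) (m : nat) (c : R).
Local Notation C := R[i].
Local Notation Re := complex.Re.
Local Notation Im := complex.Im.
Local Notation CV := 'cV[C]_m.+1.
Local Notation MC := 'M[C]_m.+1.
Local Notation P := (@Psi R m c).
Local Notation cc := (c%:C)%C.
Implicit Types (z w v : CV) (A B : MC) (u : C) (r : R).

Lemma conj_real r : ((r%:C)%C : C)^* = (r%:C)%C.
Proof. by apply/eqP; rewrite eq_complex /= oppr0 !eqxx. Qed.

Lemma ReM_real r u : Re ((r%:C)%C * u) = r * Re u.
Proof. by case: u => x y /=; rewrite mul0r subr0. Qed.

Lemma ImM_real r u : Im ((r%:C)%C * u) = r * Im u.
Proof. by case: u => x y /=; rewrite mul0r addr0. Qed.

Lemma ReD u (v : C) : Re (u + v) = Re u + Re v.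
Proof. by case: u v => a b []. Qed.

Lemma ReN u : Re (- u) = - Re u. Proof. by case: u. Qed.

Lemma ReB u (v : C) : Re (u - v) = Re u - Re v.
Proof. by rewrite ReD ReN. Qed.

Lemma Re_sum (I : Type) (r : seq I) (p : pred I) (F : I -> C) :
  Re (\sum_(i <- r | p i) F i) = \sum_(i <- r | p i) Re (F i).
Proof. by rewrite (big_morph (@complex.Re R) ReD (erefl _)). Qed.

Lemma ReJ u : Re u^* = Re u. Proof. by case: u. Qed.

Lemma ImJ u : Im u^* = - Im u. Proof. by case: u. Qed.

Lemma complex_eq (u v : C) : Re u = Re v -> Im u = Im v -> u = v.
Proof. by move=> eRe eIm; apply/eqP; rewrite eq_complex eRe eIm !eqxx. Qed.

Lemma addC_conj u : u + u^* = ((2 * Re u)%:C)%C.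
Proof. by case: u => x y; apply: complex_eq => /=; ring. Qed.

Lemma real_of_conj u : u^* = u -> u = ((Re u)%:C)%C.
Proof.
move=> uu; apply: complex_eq => //=.
have := congr1 (@complex.Im R) uu; rewrite ImJ => h; lra.
Qed.

Lemma normC_sqr u : u * u^* = ((Re u ^+ 2 + Im u ^+ 2)%:C)%C.
Proof. by case: u => x y; apply: complex_eq; rewrite /=; ring. Qed.

(** Diagonal of the Gram matrix of [Psi]; for c^2 = 1 this matrix is its own inverse. *)
Definition sgnP (j : 'I_m.+1) : C := if j == ord0 then cc else 1.

(** The row of the linear form [Psi z]. *)
Definition starP z : 'rV[C]_m.+1 := \row_j (sgnP j * (z j 0)^*).

Lemma sgnP_conj j : (sgnP j)^* = sgnP j.
Proof. by rewrite /sgnP; case: ifP => _; rewrite ?conj_real ?rmorph1. Qed.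

Lemma PsiE z w : P z w = \sum_j sgnP j * (z j 0)^* * w j 0.
Proof.
rewrite big_ord_recl /sgnP eqxx; congr (_ + _).
by apply: eq_bigr => j _; rewrite -[lift _ _ == _]/false mul1r.
Qed.

Lemma mul_starP z w : starP z *m w = (P z w)%:M.
Proof.
rewrite [LHS]mx11_scalar; congr (_%:M).
by rewrite !mxE PsiE; apply: eq_bigr => j _; rewrite !mxE.
Qed.

Lemma PsiDr z v w : P z (v + w) = P z v + P z w.
Proof. by rewrite !PsiE -big_split; apply: eq_bigr => j _; rewrite !mxE mulrDr. Qed.

Lemma PsiZr z u w : P z (u *: w) = u * P z w.
Proof. by rewrite !PsiE mulr_sumr; apply: eq_bigr => j _; rewrite !mxE mulrCA. Qed.

Lemma Psi_conj z w : P w z = (P z w)^*.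
Proof.
rewrite !PsiE rmorph_sum; apply: eq_bigr => j _.
by rewrite !rmorphM /= conjCK sgnP_conj; ring.
Qed.

Lemma PsiDl z v w : P (v + w) z = P v z + P w z.
Proof. by rewrite Psi_conj PsiDr rmorphD /= -!Psi_conj. Qed.

Lemma PsiZl z u w : P (u *: w) z = u^* * P w z.
Proof. by rewrite Psi_conj PsiZr rmorphM /= -!Psi_conj. Qed.

Lemma PsiNr z w : P z (- w) = - P z w.
Proof. by rewrite -scaleN1r PsiZr mulN1r. Qed.

Lemma PsiNl z w : P (- w) z = - P w z.
Proof. by rewrite Psi_conj PsiNr rmorphN /= -Psi_conj. Qed.

Lemma PsiBr z v w : P z (v - w) = P z v - P z w.
Proof. by rewrite PsiDr PsiNr. Qed.

Lemma PsiBl z v w : P (v - w) z = P v z - P w z.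
Proof. by rewrite PsiDl PsiNl. Qed.

Lemma Psi0r z : P z 0 = 0.
Proof. by rewrite -(scale0r 0) PsiZr mul0r. Qed.

Lemma Psi0l z : P 0 z = 0.
Proof. by rewrite Psi_conj Psi0r rmorph0. Qed.

Lemma Psi_sumr z (I : finType) (F : I -> CV) :
  P z (\sum_i F i) = \sum_i P z (F i).
Proof. by apply: (big_morph _ (PsiDr z) (Psi0r z)). Qed.

Lemma Psi_self z : P z z = ((Re (P z z))%:C)%C.
Proof. by apply: real_of_conj; rewrite -Psi_conj. Qed.

Lemma Re_PsiC z w : Re (P z w) = Re (P w z).
Proof. by rewrite Psi_conj ReJ. Qed.

(** The adjoint with respect to [Psi]: see [Psi_hadj]. *)
Definition hadj B : MC := \matrix_(i, j) (sgnP i * sgnP j * (B j i)^*).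

(* Locked, as unification would otherwise see a scaled matrix and compare
   complex scalars by conversion. *)
Fact outer_key : unit. Proof. by []. Qed.
Definition outer : CV -> CV -> MC :=
  locked_with outer_key (fun z w => cc *: (z *m starP w)).

Lemma outerE z w : outer z w = cc *: (z *m starP w).
Proof. by rewrite /outer unlock. Qed.

Lemma outer_mul z w v : outer z w *m v = (cc * P w v) *: z.
Proof.
by rewrite outerE -scalemxAl -mulmxA mul_starP mul_mx_scalar scalerA.
Qed.

Lemma outerDl z v w : outer (z + v) w = outer z w + outer v w.
Proof. by rewrite !outerE mulmxDl scalerDr. Qed.

Lemma starPD z v : starP (z + v) = starP z + starP v.
Proof. by apply/rowP => j; rewrite !mxE rmorphD /= mulrDr. Qed.

Lemma starPZ u v : starP (u *: v) = u^* *: starP v.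
Proof. by apply/rowP => j; rewrite !mxE rmorphM /= mulrCA. Qed.

Lemma outerDr z v w : outer z (v + w) = outer z v + outer z w.
Proof. by rewrite !outerE starPD mulmxDr scalerDr. Qed.

Lemma outerZl u v w : outer (u *: v) w = u *: outer v w.
Proof. by rewrite !outerE -scalemxAl !scalerA mulrC. Qed.

Lemma outerZr u v w : outer v (u *: w) = u^* *: outer v w.
Proof. by rewrite !outerE starPZ -scalemxAr !scalerA mulrC. Qed.

Lemma outerM z w z' w' : outer z w *m outer z' w' = (cc * P w z') *: outer z w'.
Proof.
rewrite [X in _ *m X]outerE -scalemxAr mulmxA outer_mul -scalemxAl scalerA outerE scalerA.
by congr (_ *: _); ring.
Qed.

Lemma mxtrace_outer B z w : \tr (B *m outer z w) = cc * P w (B *m z).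
Proof.
rewrite !outerE -scalemxAr mxtraceZ mulmxA mxtrace_mulC mul_starP.
by rewrite mxtrace_scalar.
Qed.

Lemma outer_mull B z w : outer (B *m z) w = B *m outer z w.
Proof. by rewrite !outerE -scalemxAr mulmxA. Qed.

Lemma hadjD A B : hadj (A + B) = hadj A + hadj B.
Proof. by apply/matrixP => i j; rewrite !mxE rmorphD /= mulrDr. Qed.

Lemma hadjZ u A : hadj (u *: A) = u^* *: hadj A.
Proof. by apply/matrixP => i j; rewrite !mxE rmorphM /= mulrCA. Qed.

Lemma hadjN A : hadj (- A) = - hadj A.
Proof. by rewrite -scaleN1r hadjZ rmorphN1 scaleN1r. Qed.

Lemma hadj_sum (I : finType) (F : I -> MC) : hadj (\sum_i F i) = \sum_i hadj (F i).
Proof.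
apply: (big_morph _ hadjD).
by apply/matrixP => i j; rewrite !mxE rmorph0 mulr0.
Qed.

Lemma outer_entry z w a b :
  outer z w a b = cc * (z a 0 * (sgnP b * (w b 0)^*)).
Proof. by rewrite outerE !mxE big_ord1 !mxE. Qed.

Hypothesis hc : c ^+ 2 = 1.

Lemma ccM : cc * cc = 1.
Proof. by rewrite -rmorphM -expr2 hc. Qed.

Lemma cc_neq0 : cc != 0.
Proof. by apply/eqP => c0; have := ccM; rewrite c0 mul0r => /eqP; rewrite eq_sym oner_eq0. Qed.

Lemma outerM0 z w z' w' : P w z' = 0 -> outer z w *m outer z' w' = 0.
Proof. by move=> wz; rewrite outerM wz mulr0 scale0r. Qed.

Lemma outerM1 z w z' w' : P w z' = cc -> outer z w *m outer z' w' = outer z w'.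
Proof. by move=> wz; rewrite outerM wz ccM scale1r. Qed.

(** Of the four products, two contract z with a horizontal vector and vanish; the other two contract
    z with z and v with w. *)
Lemma outer_tanM z v w : P z z = cc -> P z v = 0 -> P z w = 0 ->
  (outer v z + outer z v) *m (outer w z + outer z w) =
  outer v w + (cc * P v w) *: outer z z.
Proof.
move=> zz zv zw; have vz : P v z = 0 by rewrite Psi_conj zv rmorph0.
rewrite mulmxDl 2!mulmxDr (outerM0 v z zw) (outerM1 v w zz) (outerM0 z w vz) outerM.
by rewrite add0r addr0.
Qed.

Lemma sgnPM j : sgnP j * sgnP j = 1.
Proof. by rewrite /sgnP; case: ifP => _; rewrite ?ccM ?mulr1. Qed.

Lemma hadjM A B : hadj (A *m B) = hadj B *m hadj A.
Proof.
apply/matrixP => i j; rewrite !mxE rmorph_sum mulr_sumr; apply: eq_bigr => k _.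
rewrite !mxE rmorphM /= -[LHS]mulr1 -(sgnPM k); ring.
Qed.

Lemma hadj_outer z w : hadj (outer z w) = outer w z.
Proof.
apply/matrixP => i j; rewrite !outerE !mxE !big_ord_recl !big_ord0 !mxE.
rewrite ?rmorphD ?rmorphM /= ?rmorph0 ?addr0 ?rmorphM /= ?conjCK ?sgnP_conj ?conj_real ?addr0.
by rewrite -[RHS]mulr1 -(sgnPM i); ring.
Qed.

Lemma Psi_hadj B z w : P (hadj B *m z) w = P z (B *m w).
Proof.
rewrite !PsiE.
under eq_bigr do rewrite mxE rmorph_sum mulr_sumr mulr_suml.
under [RHS]eq_bigr do rewrite mxE mulr_sumr.
rewrite exchange_big; apply: eq_bigr => i _; apply: eq_bigr => j _ /=.
rewrite !mxE !rmorphM /= conjCK !sgnP_conj.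
by rewrite -[RHS]mul1r -(sgnPM j); ring.
Qed.

Lemma starP_mul B z : starP (B *m z) = starP z *m hadj B.
Proof.
apply/rowP => j; rewrite !mxE rmorph_sum mulr_sumr; apply: eq_bigr => i _.
by rewrite !mxE rmorphM /= -[LHS]mulr1 -(sgnPM i); ring.
Qed.

Lemma outer_mulr B z w : outer z (B *m w) = outer z w *m hadj B.
Proof. by rewrite !outerE starP_mul mulmxA -scalemxAl. Qed.

Lemma psi_hermitianE B : psi_hermitian c B <-> hadj B = B.
Proof.
split=> [hB|hB z w]; last by rewrite -{1}hB Psi_hadj.
apply/matrixP => i j; have := hB (delta_mx i 0) (delta_mx j 0).
rewrite !PsiE (bigD1 j)//= big1 ?addr0; last first.
  by move=> l lj; rewrite [delta_mx j 0 _ _]mxE (negbTE lj) mulr0.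
rewrite (bigD1 i)//= [X in _ = _ + X]big1 ?addr0; last first.
  by move=> l li; rewrite [delta_mx i 0 _ _]mxE (negbTE li) rmorph0 mulr0 mul0r.
rewrite -!colE !mxE !eqxx /= rmorph1 !mulr1 => E.
by rewrite -mulrA E rmorph1 mulr1 mulrA sgnPM mul1r.
Qed.

Lemma outer_ext A B : (forall v, A *m v = B *m v) -> A = B.
Proof.
move=> AB; apply/matrixP => i j.
by have /matrixP/(_ i 0) := AB (delta_mx j 0); rewrite -!colE !mxE.
Qed.

Lemma Psi_nondeg z : (forall w, P z w = 0) -> z = 0.
Proof.
move=> h; apply/matrixP => j i; rewrite ord1 [RHS]mxE.
have := h (delta_mx j 0); rewrite PsiE (bigD1 j)//= big1 ?addr0; last first.
  by move=> l lj; rewrite [delta_mx j 0 _ _]mxE (negbTE lj) mulr0.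
rewrite mxE !eqxx mulr1 => /(congr1 (fun u => sgnP j * u)).
by rewrite mulr0 mulrA sgnPM mul1r => /eqP; rewrite fmorph_eq0 => /eqP.
Qed.

End Form.


(** * Solving the matrix equations satisfied by the Laplacian *)

Lemma idempotent_corner (K : comNzRingType) n (X L T : 'M[K]_n) : X *m X = X ->
  L *m X + X *m L + 2 *: T = L -> X *m L *m X = - (2 *: (X *m T *m X)).
Proof.
(* Compressing the relation by X on both sides produces the corner of L twice on the left and once
   on the right. *)
move=> XX e; have : X *m (L *m X + X *m L + 2 *: T) *m X = X *m L *m X by rewrite e.
rewrite !(mulmxDr, mulmxDl) !mulmxA XX -(mulmxA (X *m L)) XX.
rewrite -scalemxAr -scalemxAl; move: (X *m L *m X) => M e'.
by apply/eqP; rewrite -addr_eq0; apply/eqP; apply: (addrI M); rewrite addrA e' addr0.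
Qed.

(* The matrix algebra behind [laplace_value], with the projectors opaque. *)
Section LaplaceCore.
Variables (K : fieldType) (d : nat) (A X L N S : 'M[K]_d).
Variables (e k tau be q s : K).
Hypothesis ee : e * e = 1.
Hypothesis two0 : 2 != 0 :> K.
Hypothesis k0 : k != 0.
Hypothesis k1 : 1 - k != 0.
Hypothesis XX : X *m X = X.
Hypothesis trX : \tr X = 1.
Hypothesis XN : X *m N = 0.
Hypothesis SE : S = (2 * e) *: (1%:M - X) - (e / (k * (1 - k))) *: N + (q * e) *: X.
Hypothesis LS : L *m X + X *m L + 2 *: S = L.

(** In the compression by X only the last term of S survives; the trace then reads off the
    scalar. *)
Lemma laplace_core_tau : X *m L *m X = tau *: X -> tau = - (2 * q * e).
Proof.
move=> XLX; have XS : X *m S = (q * e) *: X.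
  rewrite SE mulmxDr mulmxBr -!scalemxAr XN XX mulmxBr XX mulmx1 subrr.
  by rewrite !scaler0 subrr add0r.
have := idempotent_corner XX LS; rewrite XLX XS -scalemxAl XX.
by move/(congr1 mxtrace); rewrite raddfN /= !mxtraceZ trX !mulr1 mulrA.
Qed.

Hypothesis AA : A *m A = A.
Hypothesis AXA : A *m X *m A = k *: A.
Hypothesis trA : \tr A = 1.
Hypothesis NE : N = k *: A - k *: (A *m X + X *m A) + (k * k) *: X.
Hypothesis tauE : tau = - (2 * q * e).
Hypothesis LX : L *m X = tau *: X + be *: (A *m X - k *: X).
Hypothesis XL : X *m L = tau *: X + be *: (X *m A - k *: X).
Hypothesis trAL : \tr (A *m L) = 0.

(** Substituting [LX] and [XL] into L = LX + XL + 2S leaves a single unknown, the normal coefficient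
    [be], and tr(A L) = 0 is a linear equation for it. *)
Lemma laplace_core :
  L = - ((2 * (q + 1) * e) / (1 - k)) *: X
      + (e * (2 * k + (q + 1) * k - 1) / (k * (1 - k))) *: (A *m X + X *m A)
      + (4 * e) *: 1%:M - (2 * e / (1 - k)) *: A.
Proof.
pose t := (1 - k)^-1; have tk : t * (1 - k) = 1 by rewrite mulVf.
have trAX : \tr (A *m X) = k.
  by rewrite -{1}AA -mulmxA mxtrace_mulC AXA mxtraceZ trA mulr1.
have nnE : (e / (k * (1 - k))) *: N =
    (e * t) *: A - (e * t) *: (A *m X + X *m A) + (e * t * k) *: X.
  rewrite NE; have -> : e / (k * (1 - k)) = e * t / k by rewrite invfM mulrA mulrAC.
  rewrite scalerDr scalerBr !scalerA.
  by rewrite [_ * (k * k)]mulrA !(mulfVK k0).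
have LE : L = (2 * tau - 2 * (be * k) - 4 * e + 2 * q * e
     - 2 * e * k * t) *: X
   + (be + 2 * e * t) *: (A *m X + X *m A) + (4 * e) *: 1%:M
   - (2 * e * t) *: A.
  rewrite -[LHS]LS LX XL SE nnE; move: (A *m X) (X *m A) => M1 M2.
  by apply/matrixP => i j; rewrite !mxE; ring.
have := trAL; rewrite LE mulmxBr !mulmxDr -!scalemxAr mulmxDr mulmx1 AA !mulmxA AA AXA.
rewrite raddfB /= !mxtraceD !mxtraceZ mxtraceD mxtraceZ trA trAX tauE => eq0.
have tk0 : t * (1 - k) - 1 = 0 by rewrite tk subrr.
(* The trace equation is affine in [be] with slope 2k(1-k); denominators are removed through t(1-k)
   = 1. *)
have beE : k * (1 - k) * be = e * ((q + 1) * k - 1).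
  apply: (mulfI two0); apply/eqP; rewrite -subr_eq0 -eq0 -subr_eq0 -[0](mulr0 (2 * e * (1 - k))) -tk0.
  rewrite -subr_eq0; apply/eqP; ring.
have betE : be = e * ((q + 1) * k - 1) * (t / k).
  rewrite -beE (_ : _ * _ = be * (k / k) * (t * (1 - k))); last by ring.
  by rewrite divff// tk !mulr1.
rewrite invfM -/t; congr (_ *: _ + _ *: _ + _ - _).
  have -> : be * k = e * ((q + 1) * k - 1) * t by rewrite betE -mulrA (mulfVK k0).
  apply/eqP; rewrite -subr_eq0 -[0](mulr0 ((2 * q + 4) * e)) -tk0 -subr_eq0.
  by apply/eqP; ring.
rewrite betE -[2 * e * t](mulfK k0).
by ring.
Qed.

End LaplaceCore.

Lemma expand_normal_square (K : comNzRingType) d (A M N X : 'M[K]_d) (k : K) :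
  k *: A + - k *: M + (- k *: N + - k *: (- k *: X)) =
  k *: A + - k *: (M + N) + (k * k) *: X.
Proof. by apply/matrixP => i j; rewrite !mxE; ring. Qed.

(** * Real frames adapted to a hypersurface, and traces against its cometric *)

Section Frame.
Variables (R : realType) (m : nat) (c : R).
Local Notation C := R[i].
Local Notation Re := complex.Re.
Local Notation Im := complex.Im.
Local Notation CV := 'cV[C]_m.+1.
Local Notation MC := 'M[C]_m.+1.
Local Notation P := (@Psi R m c).
Local Notation cc := (c%:C)%C.
Implicit Types (z w v : CV).

(** Tangent spaces of a hypersurface have odd real dimension, so spanning is decided in real
    coordinates. *)
Definition rvec w : 'rV[R]_(m.+1 + m.+1) :=
  row_mx (\row_i Re (w i 0)) (\row_i Im (w i 0)).

Lemma rvec_inj : injective rvec.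
Proof.
move=> w v /eq_row_mx[/rowP hRe /rowP hIm]; apply/matrixP => i j; rewrite ord1.
by apply: complex_eq; [have := hRe i|have := hIm i]; rewrite !mxE.
Qed.

Lemma rvec_lin p (u : 'rV[R]_p) (e : 'I_p -> CV) :
  rvec (\sum_i ((u 0 i)%:C)%C *: e i) = u *m \matrix_i rvec (e i).
Proof.
rewrite mulmx_sum_row; under [RHS]eq_bigr do rewrite rowK.
elim/big_rec2: _ => [|i x y _ IH].
  by apply/rowP => j; rewrite !mxE; case: (fintype.split j) => k; rewrite !mxE.
apply/rowP => j; rewrite [RHS]mxE -IH !mxE; case: (fintype.split j) => k; rewrite !mxE.
  by case: (e i k 0) (x k 0) => a b [d f] /=; ring.
by case: (e i k 0) (x k 0) => a b [d f] /=; ring.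
Qed.

Lemma real_spanning p (e : 'I_p -> CV) : p = (m.+1 + m.+1)%N ->
  (forall u : 'rV[R]_p, \sum_i ((u 0 i)%:C)%C *: e i = 0 -> u = 0) ->
  forall w, exists u : 'rV[R]_p, w = \sum_i ((u 0 i)%:C)%C *: e i.
Proof.
move=> pE free w; pose F := \matrix_i rvec (e i).
have rvec0 : rvec 0 = 0.
  by apply/rowP => j; rewrite !mxE; case: (fintype.split j) => k; rewrite !mxE.
have Ffree : row_free F.
  apply: inj_row_free => u uF; apply: free; apply: rvec_inj.
  by rewrite rvec_lin uF rvec0.
have Ffull : row_full F by rewrite /row_full (eqP Ffree) pE.
have /submxP[u uE] := submx_full (rvec w) Ffull.
by exists u; apply: rvec_inj; rewrite rvec_lin.
Qed.

Variables (q : nat) (z n : CV) (E : 'I_q -> CV) (nu : R).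
Hypothesis hq : (q + 3 = m.+1 + m.+1)%N.
Hypothesis hc : c ^+ 2 = 1.
Hypothesis Pzz : P z z = cc.
Hypothesis PzE : forall i, P z (E i) = 0.
Hypothesis Pzn : P z n = 0.
Hypothesis PnE : forall i, Re (P n (E i)) = 0.
Hypothesis Pnn : Re (P n n) = nu.
Hypothesis nu0 : nu != 0.

Definition gram : 'M[R]_q := \matrix_(i, j) Re (P (E i) (E j)).

Lemma gramE i j : gram i j = Re (P (E i) (E j)).
Proof. by rewrite mxE. Qed.

Hypothesis gram_unit : gram \in unitmx.

(** Sum of the orthogonal projections to the complex line of z, the real line of n and the real span
    of the [E i], the last one through the inverse Gram matrix. *)
Definition frame_proj w : CV :=
  (cc * P z w) *: z + ((Re (P n w) / nu)%:C)%C *: n +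
  \sum_i \sum_j ((invmx gram i j * Re (P (E j) w))%:C)%C *: E i.

Lemma frame_projD v w : frame_proj (v + w) = frame_proj v + frame_proj w.
Proof.
rewrite /frame_proj !PsiDr mulrDr scalerDl.
rewrite ReD.
rewrite mulrDl rmorphD /= scalerDl -!addrA.
under eq_bigr => i _.
  under eq_bigr => j _.
    rewrite PsiDr ReD mulrDr rmorphD /= scalerDl; over.
  by rewrite big_split; over.
rewrite big_split /=; set S1 := \sum_i _; set S2 := \sum_i _.
by apply/matrixP => a b; rewrite !mxE; ring.
Qed.

Lemma frame_projZ r w : frame_proj ((r%:C)%C *: w) = (r%:C)%C *: frame_proj w.
Proof.
have h1 : (cc * P z ((r%:C)%C *: w)) *: z = (r%:C)%C *: ((cc * P z w) *: z).
  by rewrite PsiZr scalerA mulrCA.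
have h2 : ((Re (P n ((r%:C)%C *: w)) / nu)%:C)%C *: n =
    (r%:C)%C *: (((Re (P n w) / nu)%:C)%C *: n).
  by rewrite PsiZr ReM_real scalerA -rmorphM mulrA.
have h3 : \sum_i \sum_j ((invmx gram i j * Re (P (E j) ((r%:C)%C *: w)))%:C)%C *: E i =
    (r%:C)%C *: \sum_i \sum_j ((invmx gram i j * Re (P (E j) w))%:C)%C *: E i.
  rewrite scaler_sumr; apply: eq_bigr => i _; rewrite scaler_sumr.
  apply: eq_bigr => j _; rewrite PsiZr ReM_real scalerA -rmorphM.
  by rewrite mulrCA.
by rewrite /frame_proj h1 h2 h3 -!scalerDr.
Qed.

Lemma PEz i : P (E i) z = 0.
Proof. by rewrite Psi_conj PzE rmorph0. Qed.

Lemma frame_projE l : frame_proj (E l) = E l.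
Proof.
rewrite /frame_proj PzE mulr0 scale0r PnE mul0r scale0r !add0r.
transitivity (\sum_i (((invmx gram *m gram) i l)%:C)%C *: E i).
  apply: eq_bigr => i _; rewrite -scaler_suml; congr (_ *: _).
  by rewrite -rmorph_sum mxE; congr (_%:C%C); apply: eq_bigr => j _; rewrite mxE.
rewrite mulVmx// (bigD1 l)//= big1 ?addr0; first by rewrite mxE eqxx scale1r.
by move=> i il; rewrite mxE (negbTE il) scale0r.
Qed.

Lemma frame_projz u : frame_proj (u *: z) = u *: z.
Proof.
have Pnz : P n z = 0 by rewrite Psi_conj Pzn rmorph0.
rewrite /frame_proj !PsiZr Pzz Pnz mulr0 mul0r scale0r addr0 big1 ?addr0.
  by congr (_ *: _); rewrite mulrCA ccM// mulr1.
by move=> i _; rewrite big1// => j _; rewrite PsiZr PEz !mulr0 scale0r.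
Qed.

Lemma frame_projn : frame_proj n = n.
Proof.
rewrite /frame_proj Pzn mulr0 scale0r Pnn divff// scale1r add0r big1 ?addr0//.
by move=> i _; rewrite big1// => j _; rewrite Re_PsiC PnE mulr0 scale0r.
Qed.

(** The vectors z, iz, n and [E i] number q + 3 = 2m + 2. Pairing a real relation with z, n and the
    [E i] shows them independent, hence spanning, and [frame_proj] fixes each of them. *)
Lemma frame_projK w : frame_proj w = w.
Proof.
pose e (i : 'I_(q + 3)) : CV := match fintype.split i with
  | inl j => E j | inr l => [:: z; 'i%C *: z; n]`_l end.
have eL l : e (lshift 3 l) = E l.
  by rewrite /e -[lshift 3 l]/(unsplit (inl l)) unsplitK.
have eR (l : 'I_3) : e (rshift q l) = [:: z; 'i%C *: z; n]`_l.
  by rewrite /e -[rshift q l]/(unsplit (inr l)) unsplitK.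
have sumE (u : 'rV[R]_(q + 3)) : exists u1 : 'I_q -> R, exists u2 u3 : R,
   exists u4 : R, [/\ \sum_i ((u 0 i)%:C)%C *: e i =
   \sum_i ((u1 i)%:C)%C *: E i + (u2 +i* u3)%C *: z + (u4%:C)%C *: n &
   (forall i, u1 i = 0) -> u2 = 0 -> u3 = 0 -> u4 = 0 -> u = 0].
  exists (fun i => u 0 (lshift 3 i)), (u 0 (rshift q (inord 0))),
    (u 0 (rshift q (inord 1))), (u 0 (rshift q (inord 2))); split.
    rewrite big_split_ord /=; under eq_bigr do rewrite eL.
    under [X in _ + X = _]eq_bigr do rewrite eR.
    rewrite -[RHS]addrA; congr (_ + _).
    rewrite !big_ord_recl big_ord0 addr0 /= !scalerA addrA -scalerDl.
    have -> : lift ord0 (lift ord0 ord0) = inord 2 :> 'I_3.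
      by apply: val_inj; rewrite /= inordK.
    have -> : lift ord0 ord0 = inord 1 :> 'I_3 by apply: val_inj; rewrite /= inordK.
    have -> : ord0 = inord 0 :> 'I_3 by apply: val_inj; rewrite /= inordK.
    congr (_ *: _ + _); apply: complex_eq => /=; ring.
  move=> h1 h2 h3 h4; apply/rowP => i; rewrite mxE -(splitK i).
  case: (fintype.split i) => l /=; first exact: h1.
  by case: l => -[|[|[|//]]] lt3; [apply: (etrans _ h2)|apply: (etrans _ h3)|
    apply: (etrans _ h4)]; congr (u 0 _); apply: val_inj; rewrite /= inordK.
have frame_proj0 : frame_proj 0 = 0.
  by have := frame_projZ 0 0; rewrite rmorph0 !scale0r.
have proj_sum (u1 : 'I_q -> R) : frame_proj (\sum_i ((u1 i)%:C)%C *: E i) =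
    \sum_i ((u1 i)%:C)%C *: E i.
  rewrite (big_morph _ frame_projD frame_proj0); apply: eq_bigr => i _.
  by rewrite frame_projZ frame_projE.
have free (u : 'rV[R]_(q + 3)) : \sum_i ((u 0 i)%:C)%C *: e i = 0 -> u = 0.
  have [u1 [u2 [u3 [u4 [-> h]]]]] := sumE u.
  set S := \sum_i _ => S0.
  have PzS : P z S = 0.
    by rewrite Psi_sumr big1// => i _; rewrite PsiZr PzE mulr0.
  have Pnz : P n z = 0 by rewrite Psi_conj Pzn rmorph0.
  have : P z (S + (u2 +i* u3)%C *: z + (u4%:C)%C *: n) = 0 by rewrite S0 Psi0r.
  rewrite !PsiDr PzS !PsiZr Pzz Pzn mulr0 addr0 add0r => /eqP.
  rewrite mulf_eq0 (negbTE (cc_neq0 hc)) orbF => /eqP[u20 u30].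
  have : Re (P n (S + (u2 +i* u3)%C *: z + (u4%:C)%C *: n)) = 0.
    by rewrite S0 Psi0r.
  have RePnS : Re (P n S) = 0.
    rewrite Psi_sumr Re_sum.
    by rewrite big1// => i _; rewrite PsiZr ReM_real PnE mulr0.
  rewrite !PsiDr !PsiZr Pnz mulr0 addr0.
  rewrite ReD ReM_real.
  rewrite RePnS Pnn add0r => /eqP.
  rewrite mulf_eq0 (negbTE nu0) orbF => /eqP u40.
  apply: h => // i.
  suff : \row_i u1 i = 0 by move/rowP/(_ i); rewrite !mxE.
  (* With the coefficients of z, iz and n gone, pairing with the [E l] places the others in the
     kernel of the invertible Gram matrix. *)
  apply: (row_free_inj (A := gram)); first by rewrite row_free_unit.
  rewrite mul0mx; apply/rowP => l; rewrite !mxE.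
  have : Re (P (E l) (S + (u2 +i* u3)%C *: z + (u4%:C)%C *: n)) = 0.
    by rewrite S0 Psi0r.
  rewrite u20 u30 u40 rmorph0 !scale0r !addr0 => E0.
  rewrite -[RHS]E0 Psi_sumr Re_sum.
  by apply: eq_bigr => j _; rewrite PsiZr ReM_real !mxE Re_PsiC.
have [u ->] := real_spanning hq free w.
have [u1 [u2 [u3 [u4 [-> _]]]]] := sumE u.
by rewrite !frame_projD proj_sum frame_projz frame_projZ frame_projn.
Qed.

Definition cometric_sum (F : 'I_q -> 'I_q -> MC) : MC :=
  \sum_i \sum_j ((invmx gram i j)%:C)%C *: F i j.

(** The real expansions of w and of -iw are added with weights 1 and i. The complement of z is then
    counted twice, whereas n, whose multiple in is tangent, is removed only once. *)
Lemma cometric_outer :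
  cometric_sum (fun i j => outer c (E i) (E j)) =
  (2 * cc) *: (1%:M - outer c z z) - ((nu^-1)%:C)%C *: outer c n n.
Proof.
apply: outer_ext => w; have wE := frame_projK w.
(* Re Psi(E,-iw) is the imaginary part of Psi(E,w), so this second expansion supplies the missing
   halves of the complex coefficients. *)
have w'E := frame_projK (- 'i%C *: w).
rewrite mulmxBl -[in RHS](scalemxAl _ (1%:M - _)) -[in RHS](scalemxAl _ (outer c n n)).
rewrite mulmxBl mul1mx !outer_mul /cometric_sum.
rewrite mulmx_suml.
under eq_bigr do rewrite mulmx_suml.
have -> : \sum_i \sum_j (((invmx gram i j)%:C)%C *: outer c (E i) (E j) *m w) =
  cc *: (\sum_i \sum_j ((invmx gram i j * Re (P (E j) w))%:C)%C *: E i +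
   'i%C *: \sum_i \sum_j ((invmx gram i j * Re (P (E j) (- 'i%C *: w)))%:C)%C *: E i).
  rewrite scalerDr !scaler_sumr -big_split; apply: eq_bigr => i _ /=.
  rewrite !scaler_sumr -big_split; apply: eq_bigr => j _ /=.
  rewrite -scalemxAl outer_mul !scalerA -scalerDl; congr (_ *: _).
  rewrite PsiZr; case: (P (E j) w) => a b; apply: complex_eq => /=; ring.
move: wE w'E; rewrite /frame_proj.
set S1 := \sum_i _; set S2 := \sum_i _ => e1 e2.
have -> : S1 = w - ((cc * P z w) *: z + ((Re (P n w) / nu)%:C)%C *: n).
  by rewrite -[X in _ = X - _]e1 [RHS]addrAC subrr add0r.
have -> : S2 = - 'i%C *: w - ((cc * P z (- 'i%C *: w)) *: z +
    ((Re (P n (- 'i%C *: w)) / nu)%:C)%C *: n).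
  by rewrite -[X in _ = X - _]e2 [RHS]addrAC subrr add0r.
have hi : 'i%C * 'i%C = -1 :> C by rewrite -expr2 sqr_i.
apply/matrixP => a b; rewrite !mxE !PsiZr; case: (P n w) => x y.
rewrite [Re (x +i* y)%C]/= (_ : Re (- 'i%C * (x +i* y)%C) = y); last by rewrite /=; ring.
rewrite (_ : (x +i* y)%C = (x%:C)%C + 'i%C * (y%:C)%C); last by apply: complex_eq => /=; ring.
rewrite !rmorphM /=; move: ((nu^-1)%:C)%C (x%:C)%C (y%:C)%C => nv xx yy.
move: (z a b) (w a b) (n a b) (P z w) => za wa na pz.
move: (cc) ('i%C : C) hi => k I II.
apply/eqP; rewrite -subr_eq0; apply/eqP.
transitivity ((I * I + 1) * (k * (k * pz * za - wa))); first by ring.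
by rewrite II addNr mul0r.
Qed.

Lemma gram_sym : gram^T = gram.
Proof. by apply/matrixP => i j; rewrite !mxE Re_PsiC. Qed.

Lemma invgram_sym i j : invmx gram i j = invmx gram j i.
Proof. by rewrite -[in LHS]gram_sym -trmx_inv mxE. Qed.

(** The sum is real because the cometric is symmetric, and its real part is the trace of the inverse
    Gram matrix times the Gram matrix. *)
Lemma cometric_Psi :
  \sum_i \sum_j ((invmx gram i j)%:C)%C * P (E i) (E j) = q%:R.
Proof.
set S := LHS.
have SC : S^* = S.
  rewrite /S rmorph_sum exchange_big; apply: eq_bigr => i _.
  rewrite rmorph_sum; apply: eq_bigr => j _.
  by rewrite rmorphM /= conj_real -Psi_conj invgram_sym.
rewrite (real_of_conj SC) -(rmorph_nat (real_complex R)); congr (_%:C)%C.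
rewrite Re_sum -[RHS](mxtrace1 R q) -(mulVmx gram_unit); apply: eq_bigr => i _.
rewrite Re_sum mxE; apply: eq_bigr => j _.
by rewrite ReM_real mxE Re_PsiC.
Qed.

Lemma cometric_sumD F G : cometric_sum (fun i j => F i j + G i j) =
  cometric_sum F + cometric_sum G.
Proof.
rewrite -big_split; apply: eq_bigr => i _; rewrite -big_split.
by apply: eq_bigr => j _; rewrite scalerDr.
Qed.

Lemma cometric_sumMr F B : cometric_sum (fun i j => F i j *m B) = cometric_sum F *m B.
Proof.
rewrite mulmx_suml; apply: eq_bigr => i _; rewrite mulmx_suml.
by apply: eq_bigr => j _; rewrite scalemxAl.
Qed.

Lemma cometric_sumMl F B : cometric_sum (fun i j => B *m F i j) = B *m cometric_sum F.
Proof.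
rewrite mulmx_sumr; apply: eq_bigr => i _; rewrite mulmx_sumr.
by apply: eq_bigr => j _; rewrite scalemxAr.
Qed.

Lemma cometric_sumC F : cometric_sum (fun i j => F j i) = cometric_sum F.
Proof.
rewrite /cometric_sum exchange_big; apply: eq_bigr => i _; apply: eq_bigr => j _.
by rewrite invgram_sym.
Qed.

Lemma eq_cometric_sum F G : (forall i j, F i j = G i j) -> cometric_sum F = cometric_sum G.
Proof. by move=> FG; apply: eq_bigr => i _; apply: eq_bigr => j _; rewrite FG. Qed.

Lemma cometric_mxtrace F B : (forall i j, \tr (B *m F i j) = 0) ->
  \tr (B *m cometric_sum F) = 0.
Proof.
move=> F0; rewrite mulmx_sumr raddf_sum big1// => i _ /=.
by rewrite mulmx_sumr raddf_sum big1// => j _; rewrite -scalemxAr /= mxtraceZ F0 mulr0.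
Qed.

Lemma cometric_hadj F : (forall i j, hadj c (F i j) = F i j) ->
  hadj c (cometric_sum F) = cometric_sum F.
Proof.
move=> Fadj; rewrite /cometric_sum hadj_sum; apply: eq_bigr => i _.
by rewrite hadj_sum; apply: eq_bigr => j _; rewrite hadjZ conj_real Fadj.
Qed.

(* The velocity of the projector onto a moving line through [z]. *)
Definition tanP i := outer c (E i) z + outer c z (E i).

(** By [outer_tanM] the sum splits into those of [cometric_outer] and [cometric_Psi]. *)
Lemma cometric_tanP :
  cometric_sum (fun i j => tanP i *m tanP j) =
  (2 * cc) *: (1%:M - outer c z z) - ((nu^-1)%:C)%C *: outer c n n
  + (q%:R * cc) *: outer c z z.
Proof.
rewrite -cometric_outer -cometric_Psi /cometric_sum mulr_suml scaler_suml.
rewrite -big_split; apply: eq_bigr => i _ /=.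
rewrite mulr_suml scaler_suml -big_split; apply: eq_bigr => j _ /=.
rewrite /tanP outer_tanM// scalerDr; congr (_ + _).
by rewrite scalerA [cc * _]mulrC mulrA.
Qed.

Section LaplaceValue.
Variables (A L : MC) (k : R).
Local Notation kk := (k%:C)%C.
Local Notation X := (outer c z z).

Hypothesis k0 : k != 0.
Hypothesis k1 : 1 - k != 0.
Hypothesis AA : A *m A = A.
Hypothesis Aadj : hadj c A = A.
Hypothesis AXA : A *m X *m A = kk *: A.
Hypothesis trA : \tr A = 1.
Hypothesis nE : n = A *m z - kk *: z.
Hypothesis nuE : nu = c * k * (1 - k).
Hypothesis hL1 : L *m X + X *m L + 2 *: cometric_sum (fun i j => tanP i *m tanP j) = L.
Hypothesis hL2 : \tr (A *m L) = 0.
Hypothesis hL3 : forall i, Re (\tr (L *m tanP i)) = 0.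
Hypothesis Ladj : hadj c L = L.

(** Being orthogonal to the tangent directions, L sends z into the span of z and n. This gives LX,
    and by adjunction XL, in the form that [laplace_core] takes. *)
Lemma laplace_value :
  L = - ((2 * (q%:R + 1) * cc) / (1 - kk)) *: X
      + (cc * (2 * kk + (q%:R + 1) * kk - 1) / (kk * (1 - kk))) *: (A *m X + X *m A)
      + (4 * cc) *: 1%:M - (2 * cc / (1 - kk)) *: A.
Proof.
have ee := ccM hc; have two0 : 2 != 0 :> C by rewrite pnatr_eq0.
have k0C : kk != 0 by rewrite fmorph_eq0.
have k1C : 1 - kk != 0 by rewrite -(rmorph1 (real_complex R)) -rmorphB fmorph_eq0.
have XX : X *m X = X by rewrite outerM Pzz ee scale1r.
have trX : \tr X = 1 by rewrite -[X]mul1mx mxtrace_outer mul1mx Pzz ee.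
have XN : X *m outer c n n = 0 by rewrite outerM Pzn mulr0 scale0r.
have nn : outer c n n = kk *: A - kk *: (A *m X + X *m A) + (kk * kk) *: X.
  rewrite nE !outerDl !outerDr -!scaleNr !outerZl !outerZr !rmorphN /= !conj_real.
  rewrite !outer_mull !(outer_mulr hc) Aadj mulmxA AXA.
  exact: (expand_normal_square A (A *m X) (X *m A) X kk).
have nu1 : ((nu^-1)%:C)%C = cc / (kk * (1 - kk)).
  rewrite nuE fmorphV !rmorphM rmorphB rmorph1 /= -mulrA invfM; congr (_ * _).
  by apply: (mulfI (cc_neq0 hc)); rewrite ee divff// cc_neq0.
have SE := cometric_tanP; rewrite nu1 in SE.
(* As L is self-adjoint, its trace against the i-th tangent direction is 2c Re Psi(E_i, Lz). *)
have RePE i : Re (P (E i) (L *m z)) = 0.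
  have := hL3 i; rewrite /tanP mulmxDr mxtraceD !mxtrace_outer -mulrDr ReM_real => /eqP.
  have c0 : c != 0 by apply: contra (cc_neq0 hc) => /eqP->; rewrite rmorph0.
  rewrite mulf_eq0 (negbTE c0) /= -Psi_hadj// Ladj Psi_conj addrC addC_conj /=.
  by rewrite mulf_eq0 pnatr_eq0 /= => /eqP.
pose tau := cc * P z (L *m z); pose be := Re (P n (L *m z)) / nu.
have Lz : L *m z = tau *: z + ((be)%:C)%C *: n.
  rewrite -[LHS]frame_projK /frame_proj big1 ?addr0// => i _.
  by rewrite big1// => j _; rewrite RePE mulr0 scale0r.
have XLX : X *m L *m X = tau *: X by rewrite -mulmxA -outer_mull outerM.
clearbody tau be.
have tauE := laplace_core_tau XX trX XN SE hL1 XLX.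
have LX : L *m X = tau *: X + (be%:C)%C *: (A *m X - kk *: X).
  rewrite -outer_mull Lz outerDl !outerZl; congr (_ + _ *: _).
  by rewrite nE outerDl outer_mull -scaleNr outerZl scaleNr.
(* The adjoint of [LX], the scalar tau being real. *)
have XL : X *m L = tau *: X + (be%:C)%C *: (X *m A - kk *: X).
  have tauC : tau^* = tau.
    by rewrite tauE rmorphN !rmorphM /= conj_real !rmorph_nat.
  have XA : hadj c (A *m X) = X *m A by rewrite (hadjM hc) Aadj (hadj_outer hc).
  have <- : hadj c (L *m X) = X *m L by rewrite (hadjM hc) Ladj (hadj_outer hc).
  have Xadj : hadj c X = X by rewrite (hadj_outer hc).
  rewrite LX; move: (A *m X) (X *m A) (outer c z z) XA Xadj => M1 M2 M3 XA Xadj.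
  rewrite hadjD hadjZ (hadjZ _ (be%:C)%C) hadjD hadjN (hadjZ _ kk) XA Xadj !conj_real.
  by congr (_ *: _ + _).
exact: (laplace_core two0 k0C k1C SE hL1 AA AXA trA nn tauE LX XL hL2).
Qed.

End LaplaceValue.

End Frame.

(** * Calculus of matrix-valued functions *)

Section MatrixCalculus.
Variables (R : realType) (n : nat).
Local Notation C := R[i].
Local Notation Re := complex.Re.
Local Notation Im := complex.Im.
Local Notation V := 'rV[R]_n.
Variables (U : set V).
Hypothesis oU : open U.

Definition csmooth (f : V -> C) :=
  smooth U (fun y => Re (f y)) /\ smooth U (fun y => Im (f y)).

Definition cpd i (f : V -> C) (x : V) : C :=
  (pd i (fun y => Re (f y)) x +i* pd i (fun y => Im (f y)) x)%C.

Lemma csmooth_cst (a : C) : csmooth (fun=> a).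
Proof. by split; exact: smooth_cst. Qed.

Lemma csmoothD f g : csmooth f -> csmooth g -> csmooth (fun y => f y + g y).
Proof.
move=> [f1 f2] [g1 g2]; split.
  by apply: eq_smooth (smoothD oU f1 g1) => // y _; case: (f y) (g y) => a b [].
by apply: eq_smooth (smoothD oU f2 g2) => // y _; case: (f y) (g y) => a b [].
Qed.

Lemma csmoothM f g : csmooth f -> csmooth g -> csmooth (fun y => f y * g y).
Proof.
move=> [f1 f2] [g1 g2]; split.
  apply: eq_smooth (smoothD oU (smoothM oU f1 g1) (smoothN oU (smoothM oU f2 g2))) => // y _.
  by case: (f y) (g y) => a b [].
apply: eq_smooth (smoothD oU (smoothM oU f1 g2) (smoothM oU f2 g1)) => // y _.
by case: (f y) (g y) => a b [].
Qed.

Lemma csmooth_conj f : csmooth f -> csmooth (fun y => (f y)^*).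
Proof.
move=> [f1 f2]; split; first by apply: eq_smooth f1 => // y _; case: (f y).
by apply: eq_smooth (smoothN oU f2) => // y _; case: (f y).
Qed.

Lemma csmooth_sum (I : Type) (r : seq I) (f : I -> V -> C) :
  (forall i, csmooth (f i)) -> csmooth (fun y => \sum_(i <- r) f i y).
Proof.
move=> sf; elim: r => [|i r IH].
  rewrite (_ : (fun y => _) = fun=> 0); first exact: csmooth_cst.
  by apply/funext => y; rewrite big_nil.
rewrite (_ : (fun y => _) = fun y => f i y + \sum_(j <- r) f j y); first exact: csmoothD.
by apply/funext => y; rewrite big_cons.
Qed.

Lemma csmooth_real r : smooth U r -> csmooth (fun y => ((r y)%:C)%C).
Proof. by move=> sr; split=> //=; exact: smooth_cst. Qed.

Lemma csmooth_cpd i f : csmooth f -> csmooth (cpd i f).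
Proof. by move=> [f1 f2]; split; apply: smooth_pd. Qed.

Lemma csmooth_derive i f x : csmooth f -> U x ->
  is_cderive x (delta_mx 0 i) f (cpd i f x).
Proof.
move=> [f1 f2] Ux; split; apply: derivableP.
  exact: smooth_derivable f1 Ux.
exact: smooth_derivable f2 Ux.
Qed.

Lemma cpd_val i f x df : is_cderive x (delta_mx 0 i) f df -> cpd i f x = df.
Proof. by move=> [f1 f2]; apply: complex_eq => /=; rewrite /pd derive_val. Qed.

Definition msmooth p q (F : V -> 'M[C]_(p, q)) :=
  forall a b, csmooth (fun y => F y a b).

Definition mpd p q i (F : V -> 'M[C]_(p, q)) (x : V) : 'M[C]_(p, q) :=
  \matrix_(a, b) cpd i (fun y => F y a b) x.

Lemma eq_mpd p q i (F G : V -> 'M[C]_(p, q)) x : (forall y, U y -> F y = G y) ->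
  U x -> mpd i F x = mpd i G x.
Proof.
move=> FG Ux; apply/matrixP => a b; rewrite !mxE; apply: complex_eq => /=.
  by apply: (eq_pd i oU _ Ux) => y /FG->.
by apply: (eq_pd i oU _ Ux) => y /FG->.
Qed.

Lemma msmooth_mpd p q i (F : V -> 'M[C]_(p, q)) : msmooth F -> msmooth (mpd i F).
Proof.
move=> sF a b; rewrite (_ : (fun y => _) = cpd i (fun y => F y a b)).
  exact: csmooth_cpd.
by apply/funext => y; rewrite mxE.
Qed.

Lemma mpd_val p q i (F : V -> 'M[C]_(p, q)) x (dF : 'M[C]_(p, q)) :
  (forall a b, is_cderive x (delta_mx 0 i) (fun y => F y a b) (dF a b)) ->
  mpd i F x = dF.
Proof. by move=> h; apply/matrixP => a b; rewrite mxE; exact: cpd_val. Qed.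

Lemma msmooth_derive p q i (F : V -> 'M[C]_(p, q)) x a b : msmooth F -> U x ->
  is_cderive x (delta_mx 0 i) (fun y => F y a b) (mpd i F x a b).
Proof. by move=> sF Ux; rewrite mxE; exact: csmooth_derive. Qed.

Lemma msmooth_cst p q (A : 'M[C]_(p, q)) : msmooth (fun=> A).
Proof. by move=> a b; exact: csmooth_cst. Qed.

Lemma mpd_cst p q i (A : 'M[C]_(p, q)) x : mpd i (fun=> A) x = 0.
Proof. by apply: mpd_val => a b; rewrite mxE; exact: is_cderive_cst. Qed.

Lemma msmoothM p q r (F : V -> 'M[C]_(p, q)) (G : V -> 'M[C]_(q, r)) :
  msmooth F -> msmooth G -> msmooth (fun y => F y *m G y).
Proof.
move=> sF sG a b.
rewrite (_ : (fun y => _) = fun y => \sum_k F y a k * G y k b).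
  by apply: csmooth_sum => k; exact: csmoothM.
by apply/funext => y; rewrite mxE.
Qed.

Lemma mpdM p q r i (F : V -> 'M[C]_(p, q)) (G : V -> 'M[C]_(q, r)) x :
  msmooth F -> msmooth G -> U x ->
  mpd i (fun y => F y *m G y) x = mpd i F x *m G x + F x *m mpd i G x.
Proof.
move=> sF sG Ux; apply: mpd_val => a b.
rewrite (_ : (fun y => _) = fun y => \sum_k F y a k * G y k b); last first.
  by apply/funext => y; rewrite mxE.
rewrite !mxE -big_split /=; apply: is_cderive_sum => k.
by apply: is_cderiveM; exact: msmooth_derive.
Qed.

Lemma msmoothD p q (F G : V -> 'M[C]_(p, q)) :
  msmooth F -> msmooth G -> msmooth (fun y => F y + G y).
Proof.
move=> sF sG a b; rewrite (_ : (fun y => _) = fun y => F y a b + G y a b).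
  exact: csmoothD.
by apply/funext => y; rewrite mxE.
Qed.

Lemma mpdD p q i (F G : V -> 'M[C]_(p, q)) x :
  msmooth F -> msmooth G -> U x ->
  mpd i (fun y => F y + G y) x = mpd i F x + mpd i G x.
Proof.
move=> sF sG Ux; apply: mpd_val => a b; rewrite mxE.
rewrite (_ : (fun y => _) = fun y => F y a b + G y a b); last first.
  by apply/funext => y; rewrite mxE.
by apply: is_cderiveD; exact: msmooth_derive.
Qed.

Lemma csmooth_Psi m (c : R) (F G : V -> 'cV[C]_m.+1) : msmooth F -> msmooth G ->
  csmooth (fun y => Psi c (F y) (G y)).
Proof.
move=> sF sG; rewrite (_ : (fun y => _) =
    fun y => \sum_j sgnP c j * (F y j 0)^* * G y j 0); last first.
  by apply/funext => y; rewrite PsiE.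
apply: csmooth_sum => j; apply: csmoothM => //; apply: csmoothM.
  exact: csmooth_cst.
exact: csmooth_conj.
Qed.

Lemma msmoothZ p q (r : V -> C) (F : V -> 'M[C]_(p, q)) :
  csmooth r -> msmooth F -> msmooth (fun y => r y *: F y).
Proof.
move=> sr sF a b; rewrite (_ : (fun y => _) = fun y => r y * F y a b).
  exact: csmoothM.
by apply/funext => y; rewrite mxE.
Qed.

Lemma mxtrace_mpd_cst p i (B : 'M[C]_p) (F : V -> 'M[C]_p) d x : msmooth F ->
  (forall y, U y -> \tr (B *m F y) = d) -> U x -> \tr (B *m mpd i F x) = 0.
Proof.
move=> sF Fd Ux; have sBF := msmoothM (msmooth_cst B) sF.
have <- : cpd i (fun y => \tr (B *m F y)) x = \tr (B *m mpd i F x).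
  apply: cpd_val; apply: is_cderive_sum => k.
  rewrite (_ : B *m mpd i F x = mpd i (fun y => B *m F y) x).
    exact: msmooth_derive sBF Ux.
  by rewrite (mpdM i (msmooth_cst B) sF Ux) mpd_cst mul0mx add0r.
have -> : cpd i (fun y => \tr (B *m F y)) x = cpd i (fun=> d) x.
  apply: complex_eq => /=.
    by apply: (eq_pd i oU _ Ux) => y /Fd->.
  by apply: (eq_pd i oU _ Ux) => y /Fd->.
by apply: cpd_val; exact: is_cderive_cst.
Qed.

Lemma mpd_hadj m (c : R) i (F : V -> 'M[C]_m.+1) x : msmooth F -> U x ->
  mpd i (fun y => hadj c (F y)) x = hadj c (mpd i F x).
Proof.
move=> sF Ux; apply: mpd_val => a b; rewrite [X in is_cderive _ _ _ X]mxE.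
rewrite (_ : (fun y => _) = fun y => (sgnP c a * sgnP c b) * (F y b a)^*); last first.
  by apply/funext => y; rewrite mxE.
rewrite -[X in is_cderive _ _ _ X]add0r -[X in is_cderive _ _ _ (X + _)](mul0r ((F x b a)^*)).
apply: is_cderiveM; first exact: is_cderive_cst.
by apply: is_cderive_conj; exact: msmooth_derive.
Qed.

Lemma mpdC p q i j (F : V -> 'M[C]_(p, q)) x : msmooth F -> U x ->
  mpd i (mpd j F) x = mpd j (mpd i F) x.
Proof.
move=> sF Ux; apply/matrixP => a b; have [s1 s2] := sF a b.
have E k : (fun y => mpd k F y a b) = cpd k (fun y => F y a b).
  by apply/funext => y; rewrite mxE.
have M k (G : V -> 'M[C]_(p, q)) : mpd k G x a b = cpd k (fun y => G y a b) x.
  by rewrite mxE.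
apply: etrans (M i (mpd j F)) _; apply: esym; apply: etrans (M j (mpd i F)) _.
rewrite (E i) (E j); apply: complex_eq; first exact: pdC oU s1 Ux.
exact: pdC oU s2 Ux.
Qed.

(** Real and imaginary parts of entries are functionals of this kind ([Retr_Re], [Retr_Im]), so
    entrywise statements reduce to real-valued functions. *)
Definition Retr p (B F : 'M[C]_p) : R := Re (\tr (B *m F)).

Lemma RetrD p (B F G : 'M[C]_p) : Retr B (F + G) = Retr B F + Retr B G.
Proof. by rewrite /Retr mulmxDr mxtraceD ReD. Qed.

Lemma RetrN p (B F : 'M[C]_p) : Retr B (- F) = - Retr B F.
Proof. by rewrite /Retr mulmxN raddfN /= ReN. Qed.

Lemma RetrZ p (B F : 'M[C]_p) (r : R) : Retr B ((r%:C)%C *: F) = r * Retr B F.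
Proof. by rewrite /Retr -scalemxAr mxtraceZ ReM_real. Qed.

Lemma Retr_sum p (B : 'M[C]_p) (I : Type) (r : seq I) (F : I -> 'M[C]_p) :
  Retr B (\sum_(i <- r) F i) = \sum_(i <- r) Retr B (F i).
Proof. by rewrite (big_morph _ (RetrD B) (_ : Retr B 0 = 0))// /Retr mulmx0 raddf0. Qed.

Lemma csmooth_mxtrace p (F : V -> 'M[C]_p) : msmooth F -> csmooth (fun y => \tr (F y)).
Proof. by move=> sF; apply: csmooth_sum => k; exact: sF. Qed.

Lemma smooth_Retr p (B : 'M[C]_p) (F : V -> 'M[C]_p) : msmooth F ->
  smooth U (fun y => Retr B (F y)).
Proof.
by move=> sF; have [] := csmooth_mxtrace (msmoothM (msmooth_cst B) sF).
Qed.

Lemma is_derive_Retr p (B : 'M[C]_p) (F : V -> 'M[C]_p) i x : msmooth F -> U x ->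
  is_derive x (delta_mx 0 i) (fun y => Retr B (F y)) (Retr B (mpd i F x)).
Proof.
move=> sF Ux.
have -> : (fun y => Retr B (F y)) = fun y => Re (\sum_k (B *m F y) k k) by [].
have [+ _] : is_cderive x (delta_mx 0 i) (fun y => \sum_k (B *m F y) k k)
   (\sum_k (B *m mpd i F x) k k); last by [].
apply: is_cderive_sum => k.
have -> : B *m mpd i F x = mpd i (fun y => B *m F y) x.
  by rewrite mpdM ?mpd_cst ?mul0mx ?add0r//; exact: msmooth_cst.
by apply: msmooth_derive => //; apply: msmoothM => //; exact: msmooth_cst.
Qed.

Lemma pd_Retr p (B : 'M[C]_p) (F : V -> 'M[C]_p) i x : msmooth F -> U x ->
  pd i (fun y => Retr B (F y)) x = Retr B (mpd i F x).
Proof. by move=> sF Ux; rewrite /pd (@derive_val _ _ _ _ _ _ _ (is_derive_Retr B i sF Ux)). Qed.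

(* [Delta F = - mlap g F], entrywise *)
Definition mhess p (g : V -> 'M[R]_n) (F : V -> 'M[C]_p) i j x : 'M[C]_p :=
  mpd i (mpd j F) x - \sum_k ((christoffel g k i j x)%:C)%C *: mpd k F x.

Definition mlap p (g : V -> 'M[R]_n) (F : V -> 'M[C]_p) x : 'M[C]_p :=
  \sum_i \sum_j ((invmx (g x) i j)%:C)%C *: mhess g F i j x.

(** The functional has constant coefficients and commutes with differentiation; the constant d
    accommodates affine functions of Phi. *)
Lemma laplacian_Retr p (g : V -> 'M[R]_n) (B : 'M[C]_p) (F : V -> 'M[C]_p) d x :
  msmooth F -> U x ->
  laplacian g (fun y => Retr B (F y) + d) x = - Retr B (mlap g F x).
Proof.
move=> sF Ux; rewrite /laplacian /mlap Retr_sum; congr (- _); apply: eq_bigr => i _.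
rewrite Retr_sum; apply: eq_bigr => j _; rewrite RetrZ; congr (_ * _).
have pd1 k y : U y -> pd k (fun y => Retr B (F y) + d) y = Retr B (mpd k F y).
  move=> Uy; rewrite -[RHS]addr0.
  have h := is_deriveD (is_derive_Retr B k sF Uy) (is_derive_cst d y (delta_mx 0 k)).
  exact: (@derive_val _ _ _ _ _ _ _ h).
rewrite /hessian /mhess RetrD RetrN Retr_sum; congr (_ - _).
  rewrite (eq_pd i oU (pd1 j) Ux) pd_Retr//; exact: msmooth_mpd.
by apply: eq_bigr => k _; rewrite RetrZ pd1.
Qed.

End MatrixCalculus.


(** * Points as projectors, and the projector onto the axis *)

Section Projector.
Variables (R : realType) (m : nat) (c : R).
Local Notation C := R[i].
Local Notation Re := complex.Re.
Local Notation CV := 'cV[C]_m.+1.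
Local Notation MC := 'M[C]_m.+1.
Local Notation P := (@Psi R m c).
Local Notation cc := (c%:C)%C.
Local Notation CQ := (CQ R m c).
Local Notation hyperquadric := (hyperquadric R m c).
Implicit Types (z w : hyperquadric).

Lemma projP z w : proj z = proj w <->
  exists2 u : C, u * u^* = 1 & val w = u *: val z.
Proof.
rewrite /proj; split=> [/eqmodP/asboolP[u u1 ->]|[u u1 zw]].
  by exists u => //; rewrite -normCK u1 expr1n.
apply/eqmodP/asboolP; exists u => //.
by apply/eqP; rewrite -(@pexpr_eq1 _ _ 2)// normCK u1.
Qed.

Lemma val_Psi z : P (val z) (val z) = cc.
Proof. exact/eqP/(valP z). Qed.

Lemma induced_metric_entry (phi : 'rV[R]_(2 * m - 1) -> hyperquadric) y i j :
  induced_metric phi y i j = submersion_metric c (val (phi y))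
    (cderive (fun x => val (phi x)) (delta_mx 0 i) y)
    (cderive (fun x => val (phi x)) (delta_mx 0 j) y).
Proof. by rewrite mxE. Qed.

Lemma cderive_mpd n (F : 'rV[R]_n -> CV) i y :
  cderive F (delta_mx 0 i) y = mpd i F y.
Proof. by apply/matrixP => a b; rewrite mxE [RHS]mxE (ord1 b). Qed.

Lemma Phi_entry (p : CQ) i j : Phi p i j = cc * P (val (repr p)) (delta_mx j 0) * val (repr p) i 0.
Proof. by rewrite mxE. Qed.

(** [outer c z z] is unchanged when z is multiplied by a phase, so the representative chosen in
    [Phi] can be replaced by any lift. *)
Lemma Phi_proj z : Phi (proj z) = outer c (val z) (val z).
Proof.
have /projP[u u1 zE] : proj z = proj (repr (proj z)) by rewrite /proj reprK.
transitivity (outer c (val (repr (proj z))) (val (repr (proj z)))); last first.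
  by rewrite zE outerZl outerZr scalerA u1 scale1r.
apply/matrixP => i j; rewrite Phi_entry.
have : (outer c (val (repr (proj z))) (val (repr (proj z))) *m (delta_mx j 0 : CV)) i 0 =
   (cc * P (val (repr (proj z))) (delta_mx j 0)) * val (repr (proj z)) i 0.
  by rewrite outer_mul mxE.
by rewrite -colE mxE.
Qed.

Lemma proj_surj (p : CQ) : exists z, p = proj z.
Proof. by exists (repr p); rewrite /proj reprK. Qed.

(** The vertical part of a vector tangent to the hyperquadric is a purely imaginary multiple of x,
    and cancels between the two terms. *)
Lemma outer_horizontal (x v : CV) : P x v + P v x = 0 ->
  outer c v x + outer c x v =
  outer c (horizontal c x v) x + outer c x (horizontal c x v).
Proof.
move=> xv; have h : - (cc * P x v) + (- (cc * P x v))^* = 0.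
  by rewrite rmorphN rmorphM /= conj_real -Psi_conj -opprD -mulrDr xv mulr0 oppr0.
rewrite /horizontal -scaleNr outerDl outerDr outerZl outerZr addrACA -scalerDl.
by rewrite h scale0r addr0.
Qed.

Hypothesis hc : c ^+ 2 = 1.

(* [A] is the projector onto the line of [a] along its orthogonal space, when
   [P a a = eps] with [eps = 1] or [eps = -1]. *)
Fact axis_key : unit. Proof. by []. Qed.
Definition axis : R -> CV -> MC :=
  locked_with axis_key (fun eps a => ((eps * c)%:C)%C *: outer c a a).

Lemma axisE e b : axis e b = ((e * c)%:C)%C *: outer c b b.
Proof. by rewrite /axis unlock. Qed.

Variables (eps : R) (a : CV).
Hypothesis heps : eps ^+ 2 = 1.
Hypothesis Paa : P a a = (eps%:C)%C.
Local Notation ee := (eps%:C)%C.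

Lemma eeM : ee * ee = 1.
Proof. by rewrite -rmorphM -expr2 heps. Qed.

Lemma axis_mul v : axis eps a *m v = (ee * P a v) *: a.
Proof.
rewrite axisE -scalemxAl outer_mul scalerA rmorphM /=; congr (_ *: _).
by rewrite mulrA -(mulrA ee) ccM// mulr1.
Qed.

Lemma axisK : axis eps a *m axis eps a = axis eps a.
Proof.
apply: outer_ext => v; rewrite -mulmxA !axis_mul PsiZr Paa; congr (_ *: _).
by rewrite mulrCA eeM mulr1.
Qed.

Lemma axis_hadj : hadj c (axis eps a) = axis eps a.
Proof. by rewrite axisE hadjZ conj_real hadj_outer. Qed.

Lemma mxtrace_axis M : \tr (M *m axis eps a) = ee * P a (M *m a).
Proof.
rewrite axisE -scalemxAr mxtraceZ mxtrace_outer rmorphM /=.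
by rewrite mulrA -(mulrA ee) ccM// mulr1.
Qed.

Lemma axis_tr : \tr (axis eps a) = 1.
Proof. by rewrite -[axis _ _]mul1mx mxtrace_axis mul1mx Paa eeM. Qed.

(** The compression of any matrix to a line is a scalar, which the trace recovers. *)
Lemma axis_corner M : axis eps a *m M *m axis eps a = \tr (axis eps a *m M) *: axis eps a.
Proof.
have t : \tr (axis eps a *m M) = ee * P a (M *m a).
  by rewrite mxtrace_mulC mxtrace_axis.
apply: outer_ext => v; rewrite t -(scalemxAl _ (axis eps a) v) -2!mulmxA.
rewrite (axis_mul v) -(scalemxAr _ M a) (axis_mul (_ *: _)) PsiZr scalerA.
by congr (_ *: _); rewrite mulrCA mulrC.
Qed.

End Projector.


(** * The Laplacian of the projector on a level set *)

Section HypersurfaceLaplacian.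
Variables (R : realType) (m : nat) (c k : R) (A : 'M[R[i]]_m.+1).
Local Notation C := R[i].
Local Notation Re := complex.Re.
Local Notation CV := 'cV[C]_m.+1.
Local Notation MC := 'M[C]_m.+1.
Local Notation P := (@Psi R m c).
Local Notation cc := (c%:C)%C.
Local Notation kk := (k%:C)%C.
Local Notation CQ := (CQ R m c).
Local Notation V := 'rV[R]_(2 * m - 1).

Hypothesis hm : (0 < m)%N.
Hypothesis hc : c ^+ 2 = 1.
Hypothesis k0 : k != 0.
Hypothesis k1 : 1 - k != 0.
Hypothesis AA : A *m A = A.
Hypothesis Aadj : hadj c A = A.
Hypothesis trA : \tr A = 1.
Hypothesis Acorner : forall M, A *m M *m A = \tr (A *m M) *: A.

Variables (M : set CQ) (U : set V) (phi : V -> hyperquadric R m c).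
Hypothesis hM : forall p, M p -> \tr (A *m Phi p) = kk.
Hypothesis hphi : local_parametrization M U phi.

(* Variables rather than local definitions, to keep unification from unfolding
   them. *)
Variables (z : V -> CV) (X : V -> MC) (g : V -> 'M[R]_(2 * m - 1)).
Hypothesis z_def : z = fun y => val (phi y).
Hypothesis X_def : forall y, X y = Phi (proj (phi y)).
Hypothesis g_def : g = induced_metric phi.

Let oU : open U. Proof. by case: hphi. Qed.

Lemma lift_msmooth : msmooth U z.
Proof. by move=> i b; rewrite (ord1 b) z_def; case: hphi => _ + _ _; exact. Qed.

Lemma Phi_lift y : X y = outer c (z y) (z y).
Proof. by rewrite X_def z_def Phi_proj. Qed.

Lemma lift_norm y : P (z y) (z y) = cc.
Proof. by rewrite z_def val_Psi. Qed.

Lemma trAX y : U y -> \tr (A *m X y) = kk.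
Proof. by move=> Uy; rewrite X_def; apply: hM; case: hphi => _ _ + _; exact. Qed.

Lemma Phi_msmooth : msmooth U X.
Proof.
have sz := lift_msmooth; move=> a b.
rewrite (_ : (fun y => _) = fun y => cc * (z y a 0 * (sgnP c b * (z y b 0)^*))).
  by repeat (apply: csmoothM => //); try exact: csmooth_cst; exact: csmooth_conj.
by apply/funext => y; rewrite Phi_lift outer_entry.
Qed.

Lemma mpd_lift i y : U y ->
  mpd i X y = outer c (mpd i z y) (z y) + outer c (z y) (mpd i z y).
Proof.
move=> Uy; have sz := lift_msmooth.
apply: mpd_val => a b; rewrite [X in is_cderive _ _ _ X]mxE !outer_entry.
rewrite (_ : (fun y => _) = fun y => cc * (z y a 0 * (sgnP c b * (z y b 0)^*))).
  have da := msmooth_derive i a 0 sz Uy.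
  have db := is_cderive_conj (msmooth_derive i b 0 sz Uy).
  have h := is_cderiveM (is_cderive_cst y (delta_mx 0 i) cc)
    (is_cderiveM da (is_cderiveM (is_cderive_cst y (delta_mx 0 i) (sgnP c b)) db)).
  move: h; rewrite !mul0r !add0r mulrDr; exact.
by apply/funext => x; rewrite Phi_lift outer_entry.
Qed.

Variable E : V -> 'I_(2 * m - 1) -> CV.
Hypothesis E_def : forall y i, E y i = horizontal c (z y) (mpd i z y).

Lemma Psi_lift_horizontal y i : P (z y) (E y i) = 0.
Proof.
by rewrite E_def /horizontal PsiBr PsiZr lift_norm mulrAC ccM// mul1r subrr.
Qed.

Lemma tangent_lift y i : U y -> P (z y) (mpd i z y) + P (mpd i z y) (z y) = 0.
Proof.
move=> Uy; have /(mxtrace_mpd_cst oU i Phi_msmooth) : forall x, U x -> \tr (1%:M *m X x) = 1.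
  by move=> x _; rewrite Phi_lift mxtrace_outer mul1mx lift_norm ccM.
move=> /(_ y Uy); rewrite mpd_lift// mulmxDr mxtraceD !mxtrace_outer !mul1mx -mulrDr.
by move/eqP; rewrite mulf_eq0 (negbTE (cc_neq0 hc))/= => /eqP.
Qed.

Lemma mpd_tanP i y : U y -> mpd i X y = tanP c (z y) (E y) i.
Proof.
move=> Uy; apply: etrans (mpd_lift i Uy) _.
by rewrite /tanP E_def; exact: outer_horizontal (tangent_lift i Uy).
Qed.

Lemma induced_metricE y : g y = gram c (E y).
Proof.
apply/matrixP => i j; rewrite g_def; apply: etrans (induced_metric_entry phi y i j) _.
by rewrite !cderive_mpd gramE !E_def z_def.
Qed.

Lemma metric_sym y i j : g y i j = g y j i.
Proof.
by rewrite !induced_metricE !gramE Re_PsiC.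
Qed.

Lemma metric_unit y : U y -> gram c (E y) \in unitmx.
Proof. by move=> Uy; rewrite -induced_metricE g_def; case: hphi => _ _ _; exact. Qed.

(** Phi is isometric: by [outer_tanM] the trace of the product of two derivatives is c times a sum
    of two conjugate values of Psi. *)
Lemma metric_Retr y i j : U y -> g y i j = c / 2 * Retr (mpd i X y) (mpd j X y).
Proof.
move=> Uy; have e : mpd i X y *m mpd j X y =
    outer c (E y i) (E y j) + (cc * P (E y i) (E y j)) *: outer c (z y) (z y).
  rewrite (mpd_tanP i Uy) (mpd_tanP j Uy).
  by apply: outer_tanM; rewrite ?lift_norm ?Psi_lift_horizontal.
have tr0 (v w : CV) : \tr (outer c v w) = cc * P w v.
  by rewrite -[outer _ _ _]mul1mx mxtrace_outer mul1mx.
rewrite induced_metricE gramE /Retr e mxtraceD (mxtraceZ _ (outer _ _ _)) !tr0 lift_norm.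
rewrite ccM// mulr1 -mulrDr ReM_real (ReD (P (E y j) _)).
rewrite [X in _ * (_ * (X + _))]Re_PsiC; move: (Re _) => r.
by transitivity (c ^+ 2 * r); [rewrite hc mul1r|field].
Qed.

(** Inner product of a second with a first derivative of X; each first derivative of the metric is a
    sum of two of them ([pd_metric]). *)
Definition jet_pairing y i j l := Retr (mpd i (mpd j X) y) (mpd l X y).
Local Notation T := jet_pairing.

Lemma jet_pairingC y i j l : U y -> T y i j l = T y j i l.
Proof. by move=> Uy; rewrite /jet_pairing (mpdC oU i j Phi_msmooth Uy). Qed.

Lemma RetrC (M1 M2 : MC) : Retr M1 M2 = Retr M2 M1.
Proof. by rewrite /Retr mxtrace_mulC. Qed.

Lemma pd_metric y l i j : U y -> pd l (fun x => g x i j) y =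
  c / 2 * (T y l i j + T y l j i).
Proof.
move=> Uy; have sX := Phi_msmooth.
rewrite (eq_pd l oU (g := fun x => c / 2 * Retr 1%:M (mpd i X x *m mpd j X x)) _ Uy); last first.
  by move=> x Ux; rewrite (metric_Retr i j Ux) /Retr mul1mx.
have sXX : msmooth U (fun x => mpd i X x *m mpd j X x).
  exact: (msmoothM oU (msmooth_mpd i sX) (msmooth_mpd j sX)).
have h := is_deriveZ (c / 2) (is_derive_Retr oU 1%:M l sXX Uy).
rewrite /pd (@derive_val _ _ _ _ _ _ _ h) /Retr mul1mx (mpdM l (msmooth_mpd i sX) (msmooth_mpd j sX) Uy).
by rewrite mxtraceD ReD [T y l j i]RetrC.
Qed.

Let Xh i j y := mhess g X i j y.
Let L y := mlap g X y.

(** The three metric derivatives contribute six pairings; by symmetry in the first two indices four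
    cancel and two coincide. *)
Lemma christoffelE y t i j : U y -> christoffel g t i j y =
  c / 2 * \sum_l invmx (g y) t l * T y i j l.
Proof.
move=> Uy; rewrite /christoffel !mulr_sumr; apply: eq_bigr => l _.
rewrite !(pd_metric _ _ _ Uy) (jet_pairingC j i l Uy) (jet_pairingC l i j Uy).
rewrite (jet_pairingC l j i Uy).
move: (T y i j l) (T y i l j) (T y j l i) (invmx _ _ _) => t1 t2 t3 t4.
by field.
Qed.

(** The Gauss formula: the Christoffel terms are exactly the tangential part of the second
    derivative. *)
Lemma hess_normal y i j l : U y -> Retr (Xh i j y) (mpd l X y) = 0.
Proof.
move=> Uy; rewrite RetrC /Xh /mhess RetrD RetrN Retr_sum.
rewrite [Retr _ (mpd i _ _)]RetrC -/(T y i j l).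
under eq_bigr do rewrite RetrZ (christoffelE _ _ _ Uy) RetrC.
have gE (t : 'I_(2 * m - 1)) : Retr (mpd t X y) (mpd l X y) = 2 * c * g y t l.
  rewrite metric_Retr//; move: (Retr _ _) => r.
  by transitivity (c ^+ 2 * r); [rewrite hc mul1r|field].
under eq_bigr do rewrite gE.
rewrite [X in _ - X](_ : _ = \sum_p \sum_t (g y l t * invmx (g y) t p) *
   T y i j p); last first.
  rewrite exchange_big; apply: eq_bigr => t _ /=.
  rewrite mulr_sumr mulr_suml; apply: eq_bigr => p _.
  rewrite (metric_sym y t l).
  move: (T _ _ _ _) (invmx _ _ _) (g y l t) => r1 r2 r3.
  by transitivity (c ^+ 2 * (r3 * r2 * r1)); [field|rewrite hc mul1r].
under eq_bigr => p _.
  rewrite -mulr_suml (_ : \sum_t _ = (g y *m invmx (g y)) l p); last by rewrite mxE.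
  rewrite mulmxV ?mxE; last by rewrite induced_metricE; exact: metric_unit.
  over.
rewrite (bigD1 l)//= big1 ?addr0; first by rewrite eqxx mul1r subrr.
by move=> p pl; rewrite eq_sym (negbTE pl) mul0r.
Qed.

Lemma lap_normal y l : U y -> Re (\tr (L y *m mpd l X y)) = 0.
Proof.
move=> Uy; rewrite -[Re _]/(Retr (L y) (mpd l X y)) /Retr mxtrace_mulC.
rewrite -[Re _]/(Retr (mpd l X y) (L y)) /L /mlap Retr_sum big1// => i _.
rewrite Retr_sum big1// => j _; rewrite RetrZ /Retr mxtrace_mulC.
by rewrite -[Re _]/(Retr (Xh i j y) (mpd l X y)) hess_normal// mulr0.
Qed.

Lemma mpd_idem y j : U y -> mpd j X y *m X y + X y *m mpd j X y = mpd j X y.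
Proof.
move=> Uy; have sX := Phi_msmooth; rewrite -(mpdM j sX sX Uy).
by apply: (eq_mpd oU) => // x Ux; rewrite !Phi_lift outerM1 ?lift_norm.
Qed.

Lemma mpd2_idem y i j : U y ->
  mpd i (mpd j X) y *m X y + X y *m mpd i (mpd j X) y +
  (mpd j X y *m mpd i X y + mpd i X y *m mpd j X y) = mpd i (mpd j X) y.
Proof.
move=> Uy; have sX := Phi_msmooth; have sXj := msmooth_mpd j sX.
rewrite -[RHS](eq_mpd oU i (fun x Ux => mpd_idem j Ux) Uy).
rewrite (mpdD i (msmoothM oU sXj sX) (msmoothM oU sX sXj) Uy).
rewrite (mpdM i sXj sX Uy) (mpdM i sX sXj Uy).
by rewrite [in RHS]addrACA [in RHS]addrC addrACA [X in _ = X + _]addrC addrACA addrC.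
Qed.

(** The second derivative of X^2 = X, corrected by the Christoffel combination of its first
    derivatives. *)
Lemma hess_idem y i j : U y ->
  Xh i j y *m X y + X y *m Xh i j y + (mpd j X y *m mpd i X y + mpd i X y *m mpd j X y)
  = Xh i j y.
Proof.
move=> Uy; rewrite /Xh /mhess -[X in _ = X - _](mpd2_idem i j Uy).
rewrite -[in RHS](eq_bigr _ (fun t _ => congr1 (fun N => _ *: N) (mpd_idem t Uy))).
rewrite mulmxBl mulmxBr mulmx_suml mulmx_sumr.
under [X in _ - X + _ + _ = _]eq_bigr do rewrite -scalemxAl.
under [X in _ + (_ - X) + _ = _]eq_bigr do rewrite -scalemxAr.
under [X in _ = _ - X]eq_bigr do rewrite scalerDr.
rewrite big_split /= opprD.
by rewrite [X in X + _ = _]addrACA [LHS]addrAC.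
Qed.

Lemma lap_cometric y : L y = cometric_sum c (E y) (fun i j => Xh i j y).
Proof. by rewrite /L /mlap [g y]induced_metricE. Qed.

Lemma trA_mpd y i : U y -> \tr (A *m mpd i X y) = 0.
Proof. by move=> Uy; exact: (mxtrace_mpd_cst oU i Phi_msmooth trAX Uy). Qed.

Lemma trA_hess y i j : U y -> \tr (A *m Xh i j y) = 0.
Proof.
move=> Uy; rewrite /Xh /mhess mulmxBr [LHS]raddfB /=.
rewrite (mxtrace_mpd_cst oU i (msmooth_mpd j Phi_msmooth) (fun x => @trA_mpd x j) Uy).
rewrite sub0r mulmx_sumr [\tr _]raddf_sum big1 ?oppr0//.
by move=> t _; rewrite -scalemxAr /= mxtraceZ trA_mpd// mulr0.
Qed.

Lemma mpd_Phi_hadj y i : U y -> hadj c (mpd i X y) = mpd i X y.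
Proof.
move=> Uy; rewrite -(mpd_hadj c i Phi_msmooth Uy); apply: (eq_mpd oU i _ Uy) => x _.
by rewrite Phi_lift hadj_outer.
Qed.

Lemma hess_hadj y i j : U y -> hadj c (Xh i j y) = Xh i j y.
Proof.
move=> Uy; rewrite /Xh /mhess hadjD hadjN hadj_sum.
rewrite -(mpd_hadj c i (msmooth_mpd j Phi_msmooth) Uy).
rewrite (eq_mpd oU i (fun x => @mpd_Phi_hadj x j) Uy); congr (_ - _).
by apply: eq_bigr => t _; rewrite hadjZ conj_real mpd_Phi_hadj.
Qed.

Lemma Psi_axis_lift y : U y -> P (z y) (A *m z y) = cc * kk.
Proof.
move=> Uy; rewrite -(trAX Uy) Phi_lift mxtrace_outer mulrA ccM// mul1r.
by [].
Qed.

(** Here [laplace_value] applies with q = 2m - 1 and normal vector n = Az - kz, the derivative of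
    tr(AX) being proportional to the real pairing with n. *)
Lemma lap_Phi y : U y ->
  L y = - ((2 * (2 * m%:R) * cc) / (1 - kk)) *: X y
    + (cc * (2 * kk + (2 * m%:R) * kk - 1) / (kk * (1 - kk))) *: (A *m X y + X y *m A)
    + (4 * cc) *: 1%:M - (2 * cc / (1 - kk)) *: A.
Proof.
move=> Uy; pose n := A *m z y - kk *: z y; pose nu := c * k * (1 - k).
(* The 2m - 1 tangent directions, with z, iz and n, fill the real dimension 2m + 2. *)
have hq : ((2 * m - 1) + 3 = m.+1 + m.+1)%N   by rewrite -[3%N]/(1 + 2)%N addnA subnK ?muln_gt0// mul2n -addnn addn2 addnS addSn.
have zAz := Psi_axis_lift Uy.
have Pzn : P (z y) n = 0.
  by rewrite PsiBr PsiZr zAz lift_norm mulrC subrr.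
have Pnn : Re (P n n) = nu.
  rewrite [P n n]PsiBl PsiZl Pzn mulr0 subr0 -{1}Aadj Psi_hadj// mulmxBr mulmxA AA.
  rewrite -scalemxAr PsiBr PsiZr zAz.
  by rewrite -!rmorphM -rmorphB /= /nu; ring.
have Aself v w : P (A *m v) w = P v (A *m w) by rewrite -{1}Aadj Psi_hadj.
have PzE := Psi_lift_horizontal y.
(* Tangent vectors are orthogonal to n because tr(AX) is constant. *)
have PnE i : Re (P n (E y i)) = 0.
  rewrite [P n _]PsiBl PsiZl PzE mulr0 subr0 Aself.
  have := trA_mpd i Uy; rewrite mpd_tanP// /tanP mulmxDr mxtraceD !mxtrace_outer -mulrDr.
  move/eqP; rewrite mulf_eq0 (negbTE (cc_neq0 hc)) /= -[P (E y i) _]Aself.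
  rewrite [P (A *m _) _]Psi_conj addC_conj => /eqP/(congr1 (@complex.Re R)) /= /eqP.
  by rewrite mulf_eq0 pnatr_eq0 /= => /eqP.
have nu0 : nu != 0.
  by rewrite !mulf_neq0//; apply: contra_eq_neq hc => ->; rewrite expr0n eq_sym oner_eq0.
have AXA : A *m outer c (z y) (z y) *m A = kk *: A.
  by rewrite -Phi_lift Acorner trAX.
pose F i j := tanP c (z y) (E y) i *m tanP c (z y) (E y) j.
have hL1 : L y *m outer c (z y) (z y) + outer c (z y) (z y) *m L y +
    2 *: cometric_sum c (E y) F = L y.
  (* The cometric is symmetric, so twice the sum is the sum over both orders of the product, as they
     occur in [hess_idem]. *)
  have -> : 2 *: cometric_sum c (E y) F = cometric_sum c (E y) (fun i j => F j i + F i j).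
    by rewrite cometric_sumD cometric_sumC scaler_nat mulr2n.
  rewrite -Phi_lift lap_cometric -cometric_sumMr -cometric_sumMl -!cometric_sumD.
  apply: eq_cometric_sum => i j; rewrite /F -(mpd_tanP i Uy) -(mpd_tanP j Uy).
  exact: hess_idem.
have hL2 : \tr (A *m L y) = 0.
  by rewrite lap_cometric; apply: cometric_mxtrace => i j; exact: trA_hess.
have hL3 i : Re (\tr (L y *m tanP c (z y) (E y) i)) = 0.
  by rewrite -mpd_tanP// lap_normal.
have Ladj : hadj c (L y) = L y.
  by rewrite lap_cometric; apply: cometric_hadj => i j; exact: hess_hadj.
have := laplace_value hq hc (lift_norm y) PzE Pzn PnE Pnn nu0 (metric_unit Uy) k0 k1
  AA Aadj AXA trA (erefl n) (erefl nu) hL1 hL2 hL3 Ladj.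
have qE : (2 * m - 1)%:R + 1 = 2 * m%:R :> C.
  by rewrite natrB ?muln_gt0// natrM subrK.
by rewrite -Phi_lift qE.
Qed.

End HypersurfaceLaplacian.

(** * The two eigenmatrices *)

Section EigenCore.
Variables (K : fieldType) (d : nat) (A X L : 'M[K]_d) (e k n : K).
Hypothesis k0 : k != 0.
Hypothesis k1 : 1 - k != 0.
Hypothesis n0 : n != 0.
Hypothesis AA : A *m A = A.
Hypothesis AXA : A *m X *m A = k *: A.
Hypothesis LE : L = - ((2 * (2 * n) * e) / (1 - k)) *: X
    + (e * (2 * k + (2 * n) * k - 1) / (k * (1 - k))) *: (A *m X + X *m A)
    + (4 * e) *: 1%:M - (2 * e / (1 - k)) *: A.

(** Since A^2 = A and AXA = kA, anticommuting with A sends every term of L into the span of AX + XA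
    and A. *)
Lemma anticommutator_core : A *m L + L *m A =
  - (e * ((2 * n - 2) * k + 1) / (k * (1 - k))) *: (A *m X + X *m A - (2 * k) *: A).
Proof.
rewrite LE mulmxBr mulmxBl !mulmxDr !mulmxDl -!scalemxAr -!scalemxAl mulmx1 mul1mx.
rewrite !mulmxDr !mulmxDl !mulmxA AA AXA -[X *m A *m A]mulmxA AA.
move: (A *m X) (X *m A) => M1 M2; apply/matrixP => i j; rewrite !mxE.
move: (M1 i j) (M2 i j) (A i j) => a1 a2 a3.
by field; rewrite k0 k1.
Qed.

(** Removing the anticommutator leaves a multiple of the block of X on the complement of the axis,
    less its trace part. *)
Lemma complement_core : L - (A *m L + L *m A) =
  - (4 * n * e / (1 - k)) *: (X - (A *m X + X *m A) + k *: A
     - ((1 - k) / n) *: (1%:M - A)).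
Proof.
rewrite anticommutator_core LE.
move: (A *m X) (X *m A) => M1 M2; apply/matrixP => i j; rewrite !mxE.
move: (M1 i j) (M2 i j) (A i j) (X i j) ((i == j)%:R) => a1 a2 a3 a4 a5.
by field; rewrite k0 k1 n0.
Qed.

End EigenCore.

Section EigenMatrices.
Variables (R : realType) (m : nat) (c k : R) (A : 'M[R[i]]_m.+1).
Local Notation C := R[i].
Local Notation Re := complex.Re.
Local Notation MC := 'M[C]_m.+1.
Local Notation cc := (c%:C)%C.
Local Notation kk := (k%:C)%C.
Local Notation CQ := (CQ R m c).
Local Notation V := 'rV[R]_(2 * m - 1).

Hypothesis hm : (0 < m)%N.
Hypothesis hc : c ^+ 2 = 1.
Hypothesis k0 : k != 0.
Hypothesis k1 : 1 - k != 0.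
Hypothesis AA : A *m A = A.
Hypothesis Aadj : hadj c A = A.
Hypothesis trA : \tr A = 1.
Hypothesis Acorner : forall M, A *m M *m A = \tr (A *m M) *: A.

(** On the level set, where A Phi A = kA, these are the blocks of Phi exchanging the axis and its
    complement. *)
Definition cross_part (p : CQ) : MC := A *m Phi p + Phi p *m A - (2 * kk) *: A.

(** On the level set this is the block (I - A) Phi (I - A), less its trace 1 - k spread evenly over
    the m-dimensional complement. *)
Definition orth_part (p : CQ) : MC :=
  Phi p - (A *m Phi p + Phi p *m A) + kk *: A - ((1 - kk) / m%:R) *: (1%:M - A).

Definition center : MC := kk *: A + ((1 - kk) / m%:R) *: (1%:M - A).

Definition cross_eigenvalue : R := c * ((2 * m%:R - 2) * k + 1) / (k * (1 - k)).

Definition orth_eigenvalue : R := 4 * m%:R * c / (1 - k).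

Lemma Phi_decomposition p : Phi p = center + (cross_part p + orth_part p).
Proof.
rewrite /center /cross_part /orth_part; move: (A *m Phi p) (Phi p *m A) => M1 M2.
move: (1%:M - A) => B; apply/matrixP => i j; rewrite !mxE; ring.
Qed.

Lemma Phi_hadj (p : CQ) : hadj c (Phi p) = Phi p.
Proof. by have [z ->] := proj_surj p; rewrite Phi_proj hadj_outer. Qed.

Lemma hadj1 : hadj c 1%:M = 1%:M :> MC.
Proof.
apply/matrixP => i j; rewrite !mxE eq_sym; case: eqP => [->|_].
  by rewrite rmorph1 mulr1 sgnPM.
by rewrite rmorph0 mulr0.
Qed.

Lemma center_hadj : hadj c center = center.
Proof.
rewrite /center hadjD !hadjZ hadjD hadjN hadj1 Aadj conj_real; congr (_ + _ *: _).
by rewrite -(rmorph1 (real_complex R)) -(rmorph_nat (real_complex R)) -rmorphB -fmorphV -rmorphM conj_real.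
Qed.

Lemma cross_part_hadj p : hadj c (cross_part p) = cross_part p.
Proof.
rewrite /cross_part hadjD hadjN hadjZ hadjD !hadjM// Phi_hadj Aadj.
by rewrite rmorphM /= conj_real rmorph_nat [Phi p *m A + _]addrC.
Qed.

Lemma orth_part_hadj p : hadj c (orth_part p) = orth_part p.
Proof.
have -> : orth_part p = Phi p - center - cross_part p.
  by rewrite {1}Phi_decomposition [center + _]addrC addrK addrC addKr.
by rewrite !hadjD !hadjN Phi_hadj center_hadj cross_part_hadj.
Qed.

Variable M : set CQ.
Hypothesis hM : forall p, M p -> \tr (A *m Phi p) = kk.

Lemma Retr_Re (N : MC) i j : Re (N i j) = Retr (delta_mx j i) N.
Proof.
rewrite /Retr mxtrace_mulC /mxtrace; congr (Re _).
transitivity (\sum_t (if t == i then N i j else 0)).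
  by rewrite -big_mkcond big_pred1_eq.
apply: eq_bigr => t _; rewrite mxE (bigD1 j)//= big1; last first.
  by move=> l lj; rewrite mxE (negbTE lj) mulr0.
by rewrite mxE eqxx addr0 /=; case: eqP => [->|]; rewrite ?mulr1 ?mulr0.
Qed.

Lemma Retr_Im (N : MC) i j : complex.Im (N i j) = Retr ((- 'i%C) *: delta_mx j i) N.
Proof.
have -> : complex.Im (N i j) = Re ((- 'i%C *: N) i j).
  by rewrite mxE; case: (N i j) => a b /=; ring.
by rewrite Retr_Re /Retr -scalemxAr scalemxAl.
Qed.

(** The Laplacian commutes with a constant linear map of matrices, so the eigenvalue equation for an
    affine image of Phi reduces to an algebraic identity between X and L. *)
Lemma affine_eigenmatrix (la : R) (mu nu : C) (D : MC) :
  (forall (X L : MC), A *m X *m A = kk *: A ->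
    L = - ((2 * (2 * m%:R) * cc) / (1 - kk)) *: X
    + (cc * (2 * kk + (2 * m%:R) * kk - 1) / (kk * (1 - kk))) *: (A *m X + X *m A)
    + (4 * cc) *: 1%:M - (2 * cc / (1 - kk)) *: A ->
    mu *: L + nu *: (A *m L + L *m A) =
    - ((la%:C)%C *: (mu *: X + nu *: (A *m X + X *m A) + D))) ->
  eigenmatrix M la (fun p => mu *: Phi p + nu *: (A *m Phi p + Phi p *m A) + D).
Proof.
move=> eigen.
suff eB (B : MC) : eigenfunction M la (fun p =>
    Retr B (mu *: Phi p + nu *: (A *m Phi p + Phi p *m A) + D)).
  move=> i j; split.
    have -> : (fun p : CQ => Re ((mu *: Phi p + nu *: (A *m Phi p + Phi p *m A) + D) i j)) =
      (fun p : CQ => Retr (delta_mx j i) (mu *: Phi p + nu *: (A *m Phi p + Phi p *m A) + D)).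
      by apply/funext => p; rewrite Retr_Re.
    exact: eB.
  have -> : (fun p : CQ => complex.Im ((mu *: Phi p + nu *: (A *m Phi p + Phi p *m A) + D) i j)) =
      (fun p : CQ => Retr (- 'i%C *: delta_mx j i)
        (mu *: Phi p + nu *: (A *m Phi p + Phi p *m A) + D)).
    by apply/funext => p; rewrite Retr_Im.
  exact: eB.
move=> U phi hphi; pose X y := Phi (proj (phi y)).
(* The transpose, for the trace pairing, of N -> mu N + nu (AN + NA). *)
pose B' := mu *: B + nu *: (B *m A + A *m B).
have trB N : Retr B (mu *: N + nu *: (A *m N + N *m A)) = Retr B' N.
  rewrite /Retr /B' mulmxDr mulmxDl -!scalemxAr -!scalemxAl mulmxDr mulmxDl.
  congr (Re _); rewrite !mxtraceD !mxtraceZ; congr (_ + _ * _); rewrite !mxtraceD !mulmxA.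
  by congr (_ + _); rewrite mxtrace_mulC mulmxA.
have fE : (fun y => Retr B (mu *: X y + nu *: (A *m X y + X y *m A) + D)) =
    fun y => Retr B' (X y) + Retr B D.
  by apply/funext => y; rewrite RetrD trB.
have oU : open U by case: hphi.
have sX : msmooth U X by apply: (Phi_msmooth hphi (z := fun y => val (phi y))).
split; rewrite -/(X _) fE.
  by apply: (smoothD oU); [exact: smooth_Retr|exact: smooth_cst].
move=> x Ux; rewrite (laplacian_Retr oU _ B' _ sX Ux) -trB.
have hX := lap_Phi hm hc k0 k1 AA Aadj trA Acorner hM hphi (erefl _)
  (fun y => erefl (X y)) (erefl _) (fun _ _ => erefl _) Ux.
have AXA : A *m X x *m A = kk *: A.
  by rewrite Acorner hM//; case: hphi => _ _ + _; exact.
by rewrite (eigen _ _ AXA hX) RetrN opprK RetrZ.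
Qed.

Let kC : kk != 0. Proof. by rewrite fmorph_eq0. Qed.
Let k1C : 1 - kk != 0.
Proof. by rewrite -(rmorph1 (real_complex R)) -rmorphB fmorph_eq0. Qed.
Let mC : m%:R != 0 :> C. Proof. by rewrite pnatr_eq0 -lt0n. Qed.

Lemma cross_eigenvalueE : ((cross_eigenvalue)%:C)%C =
  cc * ((2 * m%:R - 2) * kk + 1) / (kk * (1 - kk)).
Proof.
rewrite /cross_eigenvalue !(rmorphM, fmorphV, rmorphB, rmorphD, rmorph1) /=.
by rewrite !rmorph_nat.
Qed.

Lemma orth_eigenvalueE : ((orth_eigenvalue)%:C)%C = 4 * m%:R * cc / (1 - kk).
Proof.
rewrite /orth_eigenvalue !(rmorphM, fmorphV, rmorphB, rmorph1) /=.
by rewrite !rmorph_nat.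
Qed.

Lemma cross_eigenmatrix : eigenmatrix M cross_eigenvalue cross_part.
Proof.
have -> : cross_part =
    fun p => 0 *: Phi p + 1 *: (A *m Phi p + Phi p *m A) + - ((2 * kk) *: A).
  by apply/funext => p; rewrite scale0r add0r scale1r.
apply: affine_eigenmatrix => X L AXA LE; rewrite !scale0r !add0r !scale1r.
by rewrite (anticommutator_core kC k1C AA AXA LE) cross_eigenvalueE scaleNr.
Qed.

Lemma orth_eigenmatrix : eigenmatrix M orth_eigenvalue orth_part.
Proof.
have -> : orth_part = fun p => 1 *: Phi p + (-1) *: (A *m Phi p + Phi p *m A) +
    (kk *: A - ((1 - kk) / m%:R) *: (1%:M - A)).
  by apply/funext => p; rewrite scale1r scaleN1r addrA.
apply: affine_eigenmatrix => X L AXA LE; rewrite !scale1r !scaleN1r.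
rewrite (complement_core kC k1C mC AA AXA LE) orth_eigenvalueE -[RHS]scaleNr.
by congr (_ *: _); rewrite -!addrA.
Qed.

End EigenMatrices.

(** * Positivity of the form on horizontal vectors *)

Section Positivity.
Variables (R : realType) (m : nat) (c : R).
Local Notation C := R[i].
Local Notation Re := complex.Re.
Local Notation Im := complex.Im.
Local Notation CV := 'cV[C]_m.+1.
Local Notation P := (@Psi R m c).
Local Notation cc := (c%:C)%C.
Implicit Types (z w v x y : CV) (u : C).

Definition sqnorm u : R := Re u ^+ 2 + Im u ^+ 2.

Lemma sqnormE u : u * u^* = ((sqnorm u)%:C)%C.
Proof. exact: normC_sqr. Qed.

Lemma sqnorm_ge0 u : 0 <= sqnorm u.
Proof. by rewrite addr_ge0// sqr_ge0. Qed.

Lemma sqnorm_eq0 u : (sqnorm u == 0) = (u == 0).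
Proof.
rewrite paddr_eq0 ?sqr_ge0// !sqrf_eq0; case: u => a b.
by rewrite eq_complex.
Qed.

Lemma sqnorm0 : sqnorm 0 = 0.
Proof. by apply/eqP; rewrite sqnorm_eq0. Qed.

Lemma sqnormN u : sqnorm (- u) = sqnorm u.
Proof. by case: u => a b; rewrite /sqnorm /= !sqrrN. Qed.

Lemma sqnormM u (v : C) : sqnorm (u * v) = sqnorm u * sqnorm v.
Proof. by case: u v => a b [d e]; rewrite /sqnorm /=; ring. Qed.

Lemma sqnorm_conj u : sqnorm u^* = sqnorm u.
Proof. by rewrite /sqnorm ReJ ImJ sqrrN. Qed.

Lemma sqnorm_real (r : R) : sqnorm (r%:C)%C = r ^+ 2.
Proof. by rewrite /sqnorm /= expr0n addr0. Qed.

Lemma normC_lt u (e : R) : 0 < e -> sqnorm u < e ^+ 2 -> `|u| < (e%:C)%C.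
Proof.
move=> e0 ue; rewrite normc_def ltcR -(ger0_norm (ltW e0)) -sqrtr_sqr.
by rewrite ltr_sqrt// exprn_gt0.
Qed.

Lemma Re_Psi_self v : Re (P v v) =
  c * sqnorm (v ord0 0) + \sum_(j < m) sqnorm (v (lift ord0 j) 0).
Proof.
rewrite PsiE big_ord_recl ReD Re_sum /sgnP eqxx -mulrA ReM_real; congr (_ + _).
  by rewrite [_^* * _]mulrC sqnormE.
apply: eq_bigr => j _; rewrite -[lift _ _ == _]/false mul1r mulrC sqnormE.
by [].
Qed.

Hypothesis hc : c = 1 \/ c = -1.

Lemma hcsqr : c ^+ 2 = 1.
Proof. by case: hc => ->; rewrite ?sqrrN expr1n. Qed.

Lemma PsiZZ (u : C) x : P (u *: x) (u *: x) = ((sqnorm u)%:C)%C * P x x.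
Proof. by rewrite PsiZl PsiZr -sqnormE mulrA [u^* * u]mulrC. Qed.

(** The form takes the value Psi(x,x) (Psi(x,x) Psi(y,y) - |Psi(x,y)|^2) on this vector. Asking
    positivity of that vector alone keeps the argument valid for the indefinite form. *)
Lemma cauchy_schwarz_pos x y : 0 < Re (P x x) ->
  0 <= Re (P (P x x *: y - P x y *: x) (P x x *: y - P x y *: x)) ->
  sqnorm (P x y) <= Re (P x x) * Re (P y y).
Proof.
move=> x0; rewrite PsiBl !PsiBr !PsiZl !PsiZr (Psi_conj c x y).
have xx := Psi_self c x; have yy := Psi_self c y.
move: (P x y) => u; rewrite xx yy !conj_real; move: (Re (P x x)) (Re (P y y)) x0 => a b a0.
have -> : Re ((a%:C)%C * ((a%:C)%C * (b%:C)%C) - (a%:C)%C * (u * u^*) -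
    (u^* * ((a%:C)%C * u) - u^* * (u * (a%:C)%C))) = a * (a * b - sqnorm u).
  by rewrite sqnormE; case: u => d e; rewrite /sqnorm /=; ring.
by rewrite pmulr_rge0// subr_ge0.
Qed.

Lemma Psi_head0_ge0 v : v ord0 0 = 0 -> 0 <= Re (P v v).
Proof.
by move=> v0; rewrite Re_Psi_self v0 sqnorm0 mulr0 add0r sumr_ge0// => j _;
  exact: sqnorm_ge0.
Qed.

Definition tail_part v : CV := \col_i (if i == ord0 then 0 else v i 0).

Lemma tail_part0 v : tail_part v ord0 0 = 0. Proof. by rewrite mxE. Qed.

Lemma tail_part_lift v j : tail_part v (lift ord0 j) 0 = v (lift ord0 j) 0.
Proof. by rewrite mxE. Qed.

Lemma Re_Psi_tail v : Re (P (tail_part v) (tail_part v)) =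
  \sum_(j < m) sqnorm (v (lift ord0 j) 0).
Proof.
rewrite Re_Psi_self tail_part0 sqnorm0 mulr0 add0r.
by apply: eq_bigr => j _; rewrite tail_part_lift.
Qed.

Lemma Psi_split v w : P v w = cc * (v ord0 0)^* * w ord0 0 + P (tail_part v) (tail_part w).
Proof.
rewrite !PsiE !big_ord_recl !tail_part0 mulr0 add0r /sgnP eqxx; congr (_ + _).
by apply: eq_bigr => j _; rewrite !tail_part_lift.
Qed.

Lemma Psi_head0_eq0 v : v ord0 0 = 0 -> Re (P v v) <= 0 -> v = 0.
Proof.
rewrite Re_Psi_self => v0; rewrite v0 sqnorm0 mulr0 add0r => s0.
have : \sum_(j < m) sqnorm (v (lift ord0 j) 0) == 0.
  by rewrite eq_le s0 sumr_ge0// => j _; exact: sqnorm_ge0.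
rewrite psumr_eq0 => [/allP h|l _]; last exact: sqnorm_ge0.
apply/matrixP => i j; rewrite (ord1 j) mxE; case: (unliftP ord0 i) => [l ->|->]//.
by have := h l; rewrite mem_index_enum sqnorm_eq0 => /(_ isT)/eqP.
Qed.

Lemma cauchy_schwarz_head0 x y : x ord0 0 = 0 -> y ord0 0 = 0 ->
  sqnorm (P x y) <= Re (P x x) * Re (P y y).
Proof.
move=> x0 y0; have [/(Psi_head0_eq0 x0) ->|xpos] := lerP (Re (P x x)) 0.
  by rewrite !Psi0l sqnorm0 mul0r.
apply: cauchy_schwarz_pos => //; apply: Psi_head0_ge0.
by rewrite !mxE x0 y0 !mulr0 subr0.
Qed.

(* The form is positive definite on the orthogonal space of a point of the
   hyperquadric; for [c = -1] this is the reversed Cauchy-Schwarz inequality. *)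
Lemma Psi_horizontal_le0 z v : P z z = cc -> P z v = 0 -> Re (P v v) <= 0 -> v = 0.
Proof.
move=> zz zv; rewrite (Psi_split v v) ReD Re_Psi_tail -mulrA ReM_real.
rewrite [_^* * _]mulrC sqnormE /=; set T := \sum_(j < m) _.
have b0 := sqnorm_ge0 (v ord0 0).
have T0 : 0 <= T by apply: sumr_ge0 => j _; exact: sqnorm_ge0.
suff h : c * sqnorm (v ord0 0) + T <= 0 -> sqnorm (v ord0 0) = 0 /\ T = 0.
  move=> /h[/eqP]; rewrite sqnorm_eq0 => /eqP v0 T00.
  apply: Psi_head0_eq0 => //.
  by rewrite Re_Psi_self v0 -/T T00 sqnorm0 mulr0 addr0.
case: hc => cE h; rewrite cE in h; first by split; lra.
(* Case c = -1: Cauchy-Schwarz on the tails, where Psi is positive; orthogonality turns their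
   product into the product of the heads. *)
have := cauchy_schwarz_head0 (tail_part0 z) (tail_part0 v).
have zz' : Re (P z z) = c by rewrite zz.
move: zz'; rewrite Re_Psi_self -Re_Psi_tail => zz'.
have /eqP : P (tail_part z) (tail_part v) = - (cc * (z ord0 0)^* * v ord0 0).
  by apply/eqP; rewrite -addr_eq0 addrC -Psi_split zv.
move/eqP => ->; rewrite sqnormN !sqnormM sqnorm_real sqnorm_conj hcsqr mul1r (Re_Psi_tail v) -/T.
have S0 : 0 <= Re (P (tail_part z) (tail_part z)) by apply: Psi_head0_ge0; rewrite tail_part0.
move: (sqnorm (z ord0 0)) (Re (P (tail_part z) _)) (sqnorm (v ord0 0)) S0 zz' b0 h.
rewrite cE => a S b S0 zz' b0 h abST.
have ST : S * T <= S * b by rewrite ler_wpM2l//; lra.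
(* Since a = S + 1 and T <= b, the inequality ab <= ST leaves no room for b > 0. *)
have b00 : b = 0.
  have Sb : S * b = a * b - b by rewrite (_ : S = a - 1); [ring|lra].
  by apply/eqP; rewrite eq_le b0 andbT; lra.
by split=> //; lra.
Qed.

Lemma Psi_horizontal_ge0 z v : P z z = cc -> P z v = 0 -> 0 <= Re (P v v).
Proof.
move=> zz zv; rewrite leNgt; apply/negP => v0; move: (v0).
by rewrite (Psi_horizontal_le0 zz zv (ltW v0)) Psi0l ltxx.
Qed.

Lemma Psi_horizontal_cs z x y : P z z = cc -> P z x = 0 -> P z y = 0 ->
  sqnorm (P x y) <= Re (P x x) * Re (P y y).
Proof.
move=> zz zx zy; have [/(Psi_horizontal_le0 zz zx) ->|xpos] := lerP (Re (P x x)) 0.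
  by rewrite !Psi0l sqnorm0 mul0r.
apply: cauchy_schwarz_pos => //; apply: (Psi_horizontal_ge0 zz).
by rewrite PsiBr !PsiZr zx zy !mulr0 subrr.
Qed.

End Positivity.

(** * Real-linear constraints and norm identities *)

Section RealFrames.
Variables (R : realType) (m : nat).
Local Notation C := R[i].
Local Notation Re := complex.Re.
Local Notation Im := complex.Im.
Local Notation CV := 'cV[C]_m.+1.
Local Notation N := (m.+1 + m.+1)%N.

Definition unrvec (r : 'rV[R]_N) : CV :=
  \col_i (r 0 (lshift m.+1 i) +i* r 0 (rshift m.+1 i))%C.

Lemma unrvecE (r : 'rV[R]_N) :
  unrvec r = \sum_t ((r 0 t)%:C)%C *: unrvec (delta_mx 0 t).
Proof.
apply/matrixP => i j; rewrite (ord1 j) mxE summxE big_split_ord /=.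
rewrite (bigD1 i)//= big1 ?addr0; last first.
  move=> t ti; rewrite !mxE /= eq_lshift eq_rlshift eq_sym (negbTE ti).
  by rewrite mulr0.
rewrite (bigD1 i)//= big1 ?addr0; last first.
  move=> t ti; rewrite !mxE /= eq_rshift eq_lrshift eq_sym (negbTE ti).
  by rewrite mulr0.
rewrite !mxE /= !eqxx eq_lrshift eq_rlshift.
by apply: complex_eq => /=; ring.
Qed.

Lemma unrvec_eq0 r : unrvec r = 0 -> r = 0.
Proof.
move=> r0; apply/rowP => t; rewrite mxE -(splitK t); case: (fintype.split t) => l /=.
  by have /matrixP/(_ l 0) := r0; rewrite !mxE => /(congr1 (@complex.Re R)).
by have /matrixP/(_ l 0) := r0; rewrite !mxE => /(congr1 (@complex.Im R)).
Qed.

(* [d] real-linear constraints leave a real subspace of codimension at most [d]. *)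
Lemma constrained_frame d q (l : 'I_d -> CV -> R) : (q + d = N)%N ->
  (forall t v w, l t (v + w) = l t v + l t w) ->
  (forall t r v, l t ((r%:C)%C *: v) = r * l t v) ->
  exists e : 'I_q -> CV, (forall i t, l t (e i) = 0) /\
    (forall u : 'I_q -> R, \sum_i ((u i)%:C)%C *: e i = 0 -> forall i, u i = 0).
Proof.
move=> qd lD lZ; pose K : 'M[R]_(N, d) := \matrix_(t, j) l j (unrvec (delta_mx 0 t)).
have l0 t : l t 0 = 0 by rewrite -(scale0r 0) -(rmorph0 (real_complex R)) lZ mul0r.
have lK (r : 'rV[R]_N) t : l t (unrvec r) = (r *m K) 0 t.
  rewrite unrvecE (big_morph _ (lD t) (l0 t)) mxE; apply: eq_bigr => j _.
  by rewrite lZ mxE.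
have rk : (q <= \rank (kermx K))%N.
  by rewrite mxrank_ker -[X in (X - _)%N]qd -(leq_add2r (\rank K)) subnK ?leq_add2l ?rank_leq_col//
    (leq_trans (rank_leq_col _)) ?leq_addl.
(* The first q rows of a basis of the kernel of the constraints, whose dimension is at least N - d =
   q. *)
pose B := (pid_mx q : 'M[R]_(q, \rank (kermx K))) *m row_base (kermx K).
have BK : B *m K = 0.
  rewrite -mulmxA (_ : row_base _ *m K = 0) ?mulmx0//.
  by apply/eqP; rewrite -sub_kermx eq_row_base.
exists (fun i => unrvec (row i B)); split.
  by move=> i t; rewrite lK -row_mul BK row0 mxE.
move=> u u0 i; have ur0 : unrvec 0 = 0.
  by apply/matrixP => a b; rewrite !mxE; apply: complex_eq.
have urD r s : unrvec (r + s) = unrvec r + unrvec s.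
  by apply/matrixP => a b; rewrite !mxE; apply: complex_eq.
have urZ x r : unrvec (x *: r) = (x%:C)%C *: unrvec r.
  by apply/matrixP => a b; rewrite !mxE; apply: complex_eq => /=; ring.
have : (\row_j u j) *m B = 0.
  apply: unrvec_eq0; rewrite -[RHS]u0 mulmx_sum_row (big_morph _ urD ur0).
  by apply: eq_bigr => j _; rewrite urZ mxE.
rewrite mulmxA -[RHS](mul0mx _ (row_base (kermx K))) => /(row_free_inj (row_base_free _)).
rewrite -[RHS](mul0mx _ (pid_mx q : 'M[R]_(q, \rank (kermx K)))).
have free : row_free (pid_mx q : 'M[R]_(q, \rank (kermx K))).
  by rewrite /row_free rank_pid_mx.
by move/(row_free_inj free)/rowP/(_ i); rewrite !mxE.
Qed.

End RealFrames.

Lemma Psi_horizontal (R : realType) m (c : R) (z v : 'cV[R[i]]_m.+1) :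
  c ^+ 2 = 1 -> Psi c z z = (c%:C)%C -> Psi c z (horizontal c z v) = 0.
Proof.
move=> hc zz; rewrite /horizontal PsiBr (PsiZr _ z _ z) zz mulrAC ccM// mul1r.
exact: subrr.
Qed.

Lemma Re_PsiD_orth (R : realType) m (c : R) (v w : 'cV[R[i]]_m.+1) : Psi c v w = 0 ->
  complex.Re (Psi c (v + w) (v + w)) = complex.Re (Psi c v v) + complex.Re (Psi c w w).
Proof.
move=> vw; rewrite PsiDl !PsiDr vw (Psi_conj c v w) vw rmorph0 addr0 add0r.
exact: ReD.
Qed.

(** The line from -u through v meets the quadric of norm n0 a second time at s(u + v) - u. As Re
    Psi(u,v) = 0, the norm there is s^2 (n0 + Psi(v,v)) - 2 s n0 + n0. *)
Lemma stereographic_norm (R : realType) m (c : R) (u v : 'cV[R[i]]_m.+1) (n0 s : R) :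
  Psi c u u = (n0%:C)%C -> complex.Re (Psi c u v) = 0 ->
  s * (n0 + complex.Re (Psi c v v)) = 2 * n0 ->
  complex.Re (Psi c ((s%:C)%C *: (u + v) - u) ((s%:C)%C *: (u + v) - u)) = n0.
Proof.
move=> uu uv sE; have vv := Psi_self c v; move: vv sE.
rewrite PsiBl !PsiBr !PsiZl !PsiZr conj_real !PsiDl !PsiDr uu (Psi_conj c u v).
move: (complex.Re (Psi c v v)) (Psi c u v) uv => n [t1 t2] /= -> -> sE.
have -> : complex.Re ((s%:C)%C * ((s%:C)%C * ((n0%:C)%C + (0 +i* t2)%C + ((0 +i* t2)%C^* + (n%:C)%C)))
    - (s%:C)%C * ((n0%:C)%C + (0 +i* t2)%C^*) - ((s%:C)%C * ((n0%:C)%C + (0 +i* t2)%C) - (n0%:C)%C))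
  = s * (s * (n0 + n)) - 2 * (s * n0) + n0 by rewrite /=; ring.
by rewrite sE; ring.
Qed.

(** * Stereographic charts of the level sets *)

Section Chart.
Variables (R : realType) (m : nat) (c k eps : R) (a : 'cV[R[i]]_m.+1).
Variable A : 'M[R[i]]_m.+1.
Local Notation C := R[i].
Local Notation Re := complex.Re.
Local Notation Im := complex.Im.
Local Notation CV := 'cV[C]_m.+1.
Local Notation P := (@Psi R m c).
Local Notation cc := (c%:C)%C.
Local Notation kk := (k%:C)%C.
Local Notation CQ := (CQ R m c).
Local Notation V := 'rV[R]_(2 * m - 1).
Implicit Types (x y : V) (v w : CV).

Hypothesis hm : (0 < m)%N.
Hypothesis hc : c = 1 \/ c = -1.
Hypothesis k0 : k != 0.
Hypothesis k1 : 1 - k != 0.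
Hypothesis AA : A *m A = A.
Hypothesis Aadj : hadj c A = A.
Hypothesis Aa : forall v, A *m v = ((eps%:C)%C * P a v) *: a.

Let hc2 : c ^+ 2 = 1. Proof. exact: hcsqr. Qed.

Lemma PsiA v w : P (A *m v) w = P v (A *m w).
Proof. by rewrite -{1}Aadj Psi_hadj. Qed.

Lemma mxtrace_axis_Phi (w : hyperquadric R m c) :
  \tr (A *m Phi (proj w)) = cc * P (val w) (A *m val w).
Proof. by rewrite Phi_proj mxtrace_outer. Qed.

Variable (z0 : hyperquadric R m c).
Local Notation z := (val z0).
Hypothesis hz : \tr (A *m Phi (proj z0)) = kk.

Definition base_part : CV := z - A *m z.
Local Notation u0 := base_part.
Local Notation N0 := (c * (1 - k)).

Lemma Psi_axis_base : P z (A *m z) = ((c * k)%:C)%C.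
Proof.
by rewrite rmorphM /= -hz mxtrace_axis_Phi mulrA ccM// mul1r.
Qed.

Lemma A_base : A *m u0 = 0.
Proof. by rewrite /base_part mulmxBr mulmxA AA subrr. Qed.

Lemma Psi_base w : A *m w = 0 -> P u0 w = P z w.
Proof. by move=> Aw; rewrite /base_part PsiBl PsiA Aw Psi0r subr0. Qed.

Lemma Psi_base_self : P u0 u0 = (N0%:C)%C.
Proof.
rewrite Psi_base ?A_base// /base_part PsiBr Psi_axis_base val_Psi -rmorphB.
by congr (_%:C)%C; ring.
Qed.

Lemma N0_neq0 : N0 != 0.
Proof.
by rewrite mulf_neq0//; apply: contra_eq_neq hc2 => ->; rewrite expr0n eq_sym oner_eq0.
Qed.

(** Complex orthogonality to a and real orthogonality to u0 are three real conditions in dimension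
    2m + 2. *)
Lemma tangent_frame : exists e : 'I_(2 * m - 1) -> CV,
  [/\ forall i, A *m e i = 0, forall i, Re (P u0 (e i)) = 0 &
   forall u : 'I_(2 * m - 1) -> R, \sum_i ((u i)%:C)%C *: e i = 0 -> forall i, u i = 0].
Proof.
pose l (t : 'I_3) (v : CV) : R := [:: Re (P a v); Im (P a v); Re (P u0 v)]`_t.
have hq : ((2 * m - 1) + 3 = m.+1 + m.+1)%N.
  by rewrite -[3%N]/(1 + 2)%N addnA subnK ?muln_gt0// mul2n -addnn addn2 addnS addSn.
have lD t v w : l t (v + w) = l t v + l t w.
  case: t => -[|[|[|//]]] /= ?; rewrite /l /= PsiDr.
  - by rewrite (ReD (P a v)).
  - by case: (P a v) (P a w) => ? ? [].
  - by rewrite (ReD (P u0 v)).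
have lZ t r v : l t ((r%:C)%C *: v) = r * l t v.
  case: t => -[|[|[|//]]] /= ?; rewrite /l /= PsiZr.
  - by rewrite ReM_real.
  - by rewrite ImM_real.
  - by rewrite ReM_real.
have [e [le free]] := constrained_frame hq lD lZ.
exists e; split=> // i; last by have := le i (inord 2); rewrite /l inordK.
rewrite Aa (_ : P a (e i) = 0) ?mulr0 ?scale0r//.
apply: complex_eq; first by have := le i (inord 0); rewrite /l inordK.
by have := le i (inord 1); rewrite /l inordK.
Qed.

Variable e : 'I_(2 * m - 1) -> CV.
Hypothesis Ae : forall i, A *m e i = 0.
Hypothesis u0e : forall i, Re (P u0 (e i)) = 0.
Hypothesis efree : forall u : 'I_(2 * m - 1) -> R,
  \sum_i ((u i)%:C)%C *: e i = 0 -> forall i, u i = 0.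

Definition frame_comb x : CV := \sum_i ((x 0 i)%:C)%C *: e i.
Local Notation vv := frame_comb.

Definition chart_denom x : R := N0 + Re (P (vv x) (vv x)).
Local Notation D := chart_denom.

(* Stereographic projection of the quadric [P w w = N0] in the orthogonal space
   of the axis, from the point [- u0]. *)
Definition chart_lift x : CV :=
  (A *m z - u0) + ((2 * N0 / D x)%:C)%C *: (u0 + vv x).
Local Notation f := chart_lift.

Lemma A_comb x : A *m vv x = 0.
Proof. by rewrite mulmx_sumr big1// => i _; rewrite -scalemxAr Ae scaler0. Qed.

Lemma Psi_base_comb x : Re (P u0 (vv x)) = 0.
Proof.
by rewrite Psi_sumr Re_sum big1// => i _; rewrite PsiZr ReM_real u0e mulr0.
Qed.

Lemma chart_liftK x : A *m f x = A *m z.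
Proof.
rewrite /chart_lift mulmxDr mulmxBr mulmxA AA A_base subr0 -scalemxAr mulmxDr.
by rewrite A_base A_comb addr0 scaler0 addr0.
Qed.

Lemma chart_lift_self x : D x != 0 -> P (f x) (f x) = cc.
Proof.
move=> Dx; rewrite [LHS]Psi_self; congr (_%:C)%C.
pose s := 2 * N0 / D x; pose w := (s%:C)%C *: (u0 + vv x) - u0.
have fE : f x = A *m z + w by rewrite /f /w addrAC addrA.
have Aw : A *m w = 0.
  by rewrite /w mulmxBr -scalemxAr mulmxDr A_base A_comb addr0 scaler0 subr0.
have Pzw : P (A *m z) w = 0 by rewrite PsiA Aw Psi0r.
have Pww : Re (P w w) = N0.
  by apply: stereographic_norm; rewrite ?Psi_base_self ?Psi_base_comb ?mulfVK.
have PAzAz : P (A *m z) (A *m z) = ((c * k)%:C)%C.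
  by rewrite PsiA mulmxA AA Psi_axis_base.
by rewrite fE Re_PsiD_orth// Pww PAzAz /=; ring.
Qed.

(** The default value z0 is taken where [f x] misses the hyperquadric, which can only happen where
    the denominator vanishes. *)
Definition chart x : hyperquadric R m c := insubd z0 (f x).

Lemma val_chart x : D x != 0 -> val (chart x) = f x.
Proof. by move=> Dx; rewrite val_insubd chart_lift_self// eqxx. Qed.

Lemma frame_comb0 : vv 0 = 0.
Proof. by rewrite /frame_comb big1// => i _; rewrite mxE rmorph0 scale0r. Qed.

Lemma chart_denom0 : D 0 = N0.
Proof. by rewrite /chart_denom frame_comb0 Psi0l addr0. Qed.

Lemma chart_lift0 : f 0 = z.
Proof.
rewrite /chart_lift chart_denom0 frame_comb0 addr0 mulfK ?N0_neq0//.
rewrite (_ : (2%:C)%C = 2) ?rmorph_nat// scaler_nat mulr2n addrA subrK.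
by rewrite /base_part addrC subrK.
Qed.

Lemma chart_axis x : D x != 0 -> \tr (A *m Phi (proj (chart x))) = kk.
Proof.
move=> Dx; rewrite mxtrace_axis_Phi val_chart// chart_liftK -PsiA chart_liftK.
by rewrite PsiA Psi_axis_base rmorphM mulrA ccM// mul1r.
Qed.

Lemma frame_comb_smooth : msmooth setT vv.
Proof.
move=> b d; rewrite (_ : (fun y => _) = fun y => \sum_i ((y 0 i)%:C)%C * e i b d).
  apply: (csmooth_sum openT) => i; apply: (csmoothM openT); last exact: csmooth_cst.
  by apply: csmooth_real; exact: smooth_coord.
by apply/funext => y; rewrite summxE; apply: eq_bigr => i _; rewrite mxE.
Qed.

Lemma chart_denom_smooth : smooth setT D.
Proof.
apply: smoothD; [exact: openT|exact: smooth_cst|].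
by have [] := csmooth_Psi openT c frame_comb_smooth frame_comb_smooth.
Qed.

Definition chart_domain : set V := [set x | D x != 0].
Local Notation W := chart_domain.

Lemma chart_domain_open : open W.
Proof.
rewrite openE => x Dx; rewrite /interior/=.
have cD : {for x, continuous D} by apply: (smooth_continuous chart_denom_smooth).
exact: (cvgr_neq0 _ cD Dx).
Qed.

Lemma chart_lift_smooth : msmooth W f.
Proof.
have oW := chart_domain_open.
have sv : msmooth W vv.
  by move=> b d; have [s1 s2] := frame_comb_smooth b d; split; apply: subset_smooth s1 || apply: subset_smooth s2.
apply: msmoothD => //; first exact: msmooth_cst.
apply: msmoothZ => //; last by apply: msmoothD => //; exact: msmooth_cst.
apply: csmooth_real; apply: smoothM => //; first exact: smooth_cst.
by apply: smoothV => //; apply: subset_smooth chart_denom_smooth.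
Qed.

Lemma is_cderive_real (x v : V) (r : V -> R) dr : is_derive x v r dr ->
  is_cderive x v (fun y => ((r y)%:C)%C) (dr%:C)%C.
Proof. by move=> dr'; split=> //=; exact: is_derive_cst. Qed.

Lemma is_cderive_comb i x b d :
  is_cderive x (delta_mx 0 i) (fun y => vv y b d) (e i b d).
Proof.
rewrite (_ : (fun y => _) = fun y => \sum_j ((y 0 j)%:C)%C * e j b d); last first.
  by apply/funext => y; rewrite summxE; apply: eq_bigr => j _; rewrite mxE.
rewrite (_ : e i b d = \sum_j ((((j == i)%:R : R)%:C)%C * e j b d +
    ((x 0 j)%:C)%C * 0)); last first.
  rewrite (bigD1 i)//= big1 ?eqxx ?mulr0 ?addr0 ?mul1r//.
  by move=> j ji; rewrite (negbTE ji) mulr0 addr0 mul0r.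
apply: is_cderive_sum => j; apply: is_cderiveM; last exact: is_cderive_cst.
apply: is_cderive_real; rewrite -(pd_coord j i x).
by apply: derivableP; exact: derivable_coord.
Qed.

Lemma is_derive_denom0 i : is_derive (0 : V) (delta_mx 0 i) D 0.
Proof.
have [+ _] : is_cderive (0 : V) (delta_mx 0 i) (fun y => (N0%:C)%C + P (vv y) (vv y)) 0.
  rewrite -[X in is_cderive _ _ _ X]addr0; apply: is_cderiveD; first exact: is_cderive_cst.
  rewrite (_ : (fun y => _) = fun y => \sum_j sgnP c j * (vv y j 0)^* * vv y j 0); last first.
    by apply/funext => y; rewrite PsiE.
  rewrite [X in is_cderive _ _ _ X](_ : 0 = \sum_(j < m.+1) ((0 * (vv 0 j 0)^* + sgnP c j * (e i j 0)^*) * vv 0 j 0 +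
      sgnP c j * (vv 0 j 0)^* * e i j 0)); last first.
    by rewrite big1// => j _; rewrite frame_comb0 mxE rmorph0 !mulr0 mul0r addr0.
  apply: is_cderive_sum => j; apply: is_cderiveM; last exact: is_cderive_comb.
  apply: is_cderiveM; first exact: is_cderive_cst.
  by apply: is_cderive_conj; exact: is_cderive_comb.
by congr (is_derive _ _ _ _); apply/funext => y; rewrite ReD.
Qed.

(** At the origin the scale factor is 2 and stationary, the denominator being a constant plus a
    quadratic form; only the frame vector varies. *)
Lemma mpd_chart_lift0 i : mpd i f 0 = 2 *: e i.
Proof.
have D00 : D 0 != 0 by rewrite chart_denom0 N0_neq0.
have dD := is_derive_denom0 i.
have ds : is_derive (0 : V) (delta_mx 0 i) (fun y => 2 * N0 / D y) 0.
  have dV : is_derive (0 : V) (delta_mx 0 i) (fun y => (D y)^-1) 0.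
    apply: DeriveDef; first exact: (derivableV D00).
    by rewrite deriveV// derive_val scaler0.
  have := is_deriveZ (2 * N0) dV; rewrite scaler0.
  by congr (is_derive _ _ _ _).
apply: mpd_val => b d; rewrite [X in is_cderive _ _ _ X]mxE.
rewrite (_ : (fun y => _) = fun y => (A *m z - u0) b d +
    ((2 * N0 / D y)%:C)%C * (u0 b d + vv y b d)); last first.
  by apply/funext => y; rewrite /chart_lift mxE; congr (_ + _); rewrite mxE; congr (_ * _); rewrite mxE.
have := is_cderiveD (is_cderive_cst (0 : V) (delta_mx 0 i) ((A *m z - u0) b d))
  (is_cderiveM (is_cderive_real ds)
    (is_cderiveD (is_cderive_cst (0 : V) (delta_mx 0 i) (u0 b d)) (is_cderive_comb i 0 b d))).
by rewrite mul0r !add0r chart_denom0 mulfK ?N0_neq0// rmorph_nat.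
Qed.

(** A vector in the kernel of the Gram matrix gives a horizontal vector of norm zero, which vanishes
    by positivity. Its preimage in the frame is then vertical, and must be zero because A kills the
    frame but not z. *)
Lemma chart_metric_unit0 : induced_metric chart 0 \in unitmx.
Proof.
have oW := chart_domain_open; have W0 : W 0 by rewrite /chart_domain /= chart_denom0 N0_neq0.
have dE i : mpd i (fun y => val (chart y)) 0 = 2 *: e i.
  rewrite -mpd_chart_lift0; apply: (eq_mpd oW) => // y Wy; exact: val_chart.
have v0 : val (chart 0) = z by rewrite val_chart ?chart_lift0// chart_denom0 N0_neq0.
pose E i := horizontal c z (2 *: e i).
have zE i : P z (E i) = 0.
  exact: (Psi_horizontal _ hc2 (val_Psi z0)).
have gE i j : induced_metric chart 0 i j = Re (P (E i) (E j)).
  by rewrite induced_metric_entry !cderive_mpd !dE v0.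
rewrite -row_free_unit; apply: inj_row_free => u uG.
pose w := \sum_i ((u 0 i)%:C)%C *: E i.
have zw : P z w = 0 by rewrite Psi_sumr big1// => i _; rewrite PsiZr zE mulr0.
have ww : Re (P w w) = 0.
  rewrite {2}/w Psi_sumr Re_sum big1// => j _; rewrite PsiZr ReM_real Re_PsiC /w.
  have /rowP/(_ j) := uG; rewrite !mxE Psi_sumr Re_sum => uGj.
  rewrite (_ : \sum_i _ = 0) ?mulr0// -[RHS]uGj; apply: eq_bigr => i _.
  by rewrite gE (Re_PsiC c (E i)) -ReM_real -PsiZr.
have w0 : w = 0 by apply: (Psi_horizontal_le0 hc (val_Psi z0) zw); rewrite ww.
pose v := \sum_i ((u 0 i)%:C)%C *: e i.
have wE : w = 2 *: v - (cc * P z (2 *: v)) *: z.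
  rewrite /w /E /horizontal; under eq_bigr do rewrite scalerBr.
  rewrite sumrB; congr (_ - _).
    by rewrite scaler_sumr; apply: eq_bigr => i _; rewrite !scalerA mulrC.
  rewrite PsiZr Psi_sumr !mulr_sumr scaler_suml; apply: eq_bigr => i _.
  by rewrite scalerA !PsiZr; congr (_ *: _); ring.
have Av : A *m v = 0.
  by rewrite mulmx_sumr big1// => i _; rewrite -scalemxAr Ae scaler0.
have Az0 : A *m z != 0.
  apply/eqP => Az0; have := Psi_axis_base; rewrite Az0 Psi0r => /esym/eqP.
  by rewrite fmorph_eq0 mulf_eq0 (negbTE k0) orbF => /eqP c0; move: hc2; rewrite c0 expr0n => /esym/eqP; rewrite oner_eq0.
(* Applying A leaves only the vertical term, as A kills v and Az is nonzero. *)
have coef0 : cc * P z (2 *: v) = 0.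
  have /eqP : A *m w = 0 by rewrite w0 mulmx0.
  rewrite wE mulmxBr -!scalemxAr Av scaler0 sub0r oppr_eq0 scaler_eq0 (negbTE Az0) orbF.
  by move/eqP.
have v00 : v = 0.
  move: w0; rewrite wE coef0 scale0r subr0 => /eqP; rewrite scaler_eq0 pnatr_eq0 /=.
  by move/eqP.
by apply/rowP => i; rewrite mxE (efree v00).
Qed.

Lemma chart_metric_smooth i j : smooth W (fun y => induced_metric chart y i j).
Proof.
have oW := chart_domain_open.
pose F y := val (chart y).
have sF : msmooth W F.
  move=> b d; have [s1 s2] := chart_lift_smooth b d; split.
    by apply: eq_smooth s1 => // y Wy; rewrite /F val_chart.
  by apply: eq_smooth s2 => // y Wy; rewrite /F val_chart.
have sE l : msmooth W (fun y => horizontal c (F y) (mpd l F y)).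
  have sd := msmooth_mpd l sF; rewrite /horizontal.
  rewrite (_ : (fun y => _) = fun y => mpd l F y + (- (cc * P (F y) (mpd l F y))) *: F y); last first.
    by apply/funext => y; rewrite scaleNr.
  apply: msmoothD => //; apply: msmoothZ => //.
  rewrite (_ : (fun y => _) = fun y => (- cc) * P (F y) (mpd l F y)); last first.
    by apply/funext => y; rewrite mulNr.
  by apply: csmoothM => //; [exact: csmooth_cst|exact: csmooth_Psi].
have [+ _] := csmooth_Psi oW c (sE i) (sE j).
apply: eq_smooth => // y Wy.
by rewrite induced_metric_entry !cderive_mpd.
Qed.

Variable M : set CQ.
Hypothesis hM : M (proj z0).
Hypothesis Mopen : exists2 r : R, 0 < r & forall w : hyperquadric R m c,
  (forall i, `|val w i 0 - z i 0| < (r%:C)%C) ->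
  \tr (A *m Phi (proj w)) = kk -> M (proj w).

(** The chart is restricted to the interior of a neighbourhood of 0 where the metric is
    nondegenerate and the lift stays close enough to z for the openness of M to apply. *)
Lemma chart_exists : exists U, local_parametrization M U chart /\ U 0 /\ chart 0 = z0.
Proof.
have oW := chart_domain_open; have W0 : W 0 by rewrite /chart_domain /= chart_denom0 N0_neq0.
have [r r0 Mr] := Mopen.
pose d y := \det (induced_metric chart y).
have sd : smooth W d.
  rewrite /d /determinant; apply: smooth_sum => // s; apply: smoothM => //.
    exact: smooth_cst.
  by apply: smooth_prod => // i; exact: chart_metric_smooth.
pose T y := \sum_i sqnorm (f y i 0 - z i 0).
have sT : smooth W T.
  apply: smooth_sum => // i; have [s1 s2] := csmoothD oW (chart_lift_smooth i 0) (csmooth_cst W (- z i 0)).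
  have := smoothD oW (smoothM oW s1 s1) (smoothM oW s2 s2).
  by apply: eq_smooth => // y _; rewrite /sqnorm !expr2.
pose S := [set y | [/\ D y != 0, d y != 0 & T y < r ^+ 2]].
have S0 : nbhs (0 : V) S.
  have n1 : \forall y \near (0 : V), D y != 0 by apply: open_nbhs_nbhs.
  have n2 : \forall y \near (0 : V), d y != 0.
    have cd : {for (0 : V), continuous d} by apply: (smooth_continuous sd).
    apply: (cvgr_neq0 _ cd); rewrite /d -unitfE -unitmxE; exact: chart_metric_unit0.
  have n3 : \forall y \near (0 : V), T y < r ^+ 2.
    have cT : {for (0 : V), continuous T} by apply: (smooth_continuous sT).
    apply: (cvgr_lt _ cT); rewrite /T big1 ?exprn_gt0// => i _.
    by rewrite chart_lift0 subrr sqnorm0.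
  by near=> y; split; near: y.
exists S^°; split; last first.
  split=> //; apply: val_inj; rewrite val_chart ?chart_lift0//.
split.
- exact: open_interior.
- move=> i; have SW : S^° `<=` W by move=> y /interior_subset[].
  have [s1 s2] := chart_lift_smooth i 0; split.
    apply: (@eq_smooth _ _ _ (fun y => Re (f y i 0))); first exact: open_interior.
      by move=> y /SW Wy; rewrite val_chart.
    exact: subset_smooth s1.
  apply: (@eq_smooth _ _ _ (fun y => Im (f y i 0))); first exact: open_interior.
    by move=> y /SW Wy; rewrite val_chart.
  exact: subset_smooth s2.
- move=> y /interior_subset[Dy _ Ty]; apply: Mr; last exact: chart_axis.
  move=> i; rewrite val_chart//; apply: normC_lt => //; apply: le_lt_trans Ty.
  rewrite /T (bigD1 i)//= lerDl; apply: sumr_ge0 => j _; exact: sqnorm_ge0.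
- by move=> y /interior_subset[_ dy _]; rewrite unitmxE unitfE.
Unshelve. all: by end_near. Qed.

End Chart.

(** * Linearity of the Laplacian and separation of eigenvalues *)

Section LaplacianLinearity.
Variables (R : realType) (n : nat).
Local Notation V := 'rV[R]_n.
Variables (U : set V) (g : V -> 'M[R]_n).
Hypothesis oU : open U.

Lemma eq_laplacian f h x : (forall y, U y -> f y = h y) -> U x ->
  laplacian g f x = laplacian g h x.
Proof.
move=> fh Ux; have hess i j : hessian g f i j x = hessian g h i j x.
  have e1 : pd i (pd j f) x = pd i (pd j h) x.
    by apply: (eq_pd i oU _ Ux) => y Uy; exact: eq_pd oU fh Uy.
  have e2 l : pd l f x = pd l h x by exact: eq_pd oU fh Ux.
  rewrite /hessian e1; under eq_bigr do rewrite e2.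
  exact: erefl.
rewrite /laplacian; under eq_bigr do under eq_bigr do rewrite hess.
exact: erefl.
Qed.

Lemma laplacian_cst d x : laplacian g (fun=> d) x = 0.
Proof.
have pd0 i e y : pd i (fun=> e : R) y = 0 :> R by exact: derive_cst.
rewrite /laplacian big1 ?oppr0// => i _; rewrite big1// => j _.
rewrite /hessian (_ : pd j (fun=> d : R) = fun=> 0); last by apply/funext => y; exact: pd0.
by rewrite pd0 big1 ?subr0 ?mulr0// => k _; rewrite pd0 mulr0.
Qed.

Lemma pdD f h i x : smooth U f -> smooth U h -> U x ->
  pd i (fun y => f y + h y) x = pd i f x + pd i h x.
Proof. by move=> sf sh Ux; rewrite /pd -deriveD//; apply: (smooth_derivable _ Ux). Qed.

Lemma pdZ f i d x : smooth U f -> U x -> pd i (fun y => d * f y) x = d * pd i f x.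
Proof. by move=> sf Ux; apply: (deriveZ d); apply: (smooth_derivable _ Ux). Qed.

Lemma laplacianD f h x : smooth U f -> smooth U h -> U x ->
  laplacian g (fun y => f y + h y) x = laplacian g f x + laplacian g h x.
Proof.
move=> sf sh Ux; rewrite /laplacian -opprD -big_split; congr (- _).
apply: eq_bigr => i _; rewrite -big_split; apply: eq_bigr => j _ /=.
rewrite -mulrDr (_ : hessian _ _ _ _ _ = hessian g f i j x + hessian g h i j x) /hessian//.
rewrite (eq_pd i oU (fun y Uy => pdD j sf sh Uy) Ux).
rewrite (pdD i (smooth_pd j sf) (smooth_pd j sh) Ux).
under eq_bigr do rewrite (pdD _ sf sh Ux) mulrDr.
by rewrite big_split /= opprD addrACA.
Qed.

Lemma laplacianZ f d x : smooth U f -> U x ->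
  laplacian g (fun y => d * f y) x = d * laplacian g f x.
Proof.
move=> sf Ux; rewrite /laplacian mulrN mulr_sumr; congr (- _).
apply: eq_bigr => i _; rewrite mulr_sumr; apply: eq_bigr => j _ /=.
rewrite mulrCA (_ : hessian _ _ _ _ _ = d * hessian g f i j x) /hessian//.
rewrite (eq_pd i oU (fun y Uy => pdZ j d sf Uy) Ux) (pdZ i d (smooth_pd j sf) Ux).
under eq_bigr do rewrite (pdZ _ d sf Ux) mulrCA.
by rewrite -mulr_sumr -mulrBr.
Qed.

Lemma laplacian_sum (I : finType) (f : I -> V -> R) (d : I -> R) x :
  (forall t, smooth U (f t)) -> U x ->
  laplacian g (fun y => \sum_t d t * f t y) x = \sum_t d t * laplacian g (f t) x.
Proof.
move=> sf Ux; elim: (index_enum I) => [|t r IH].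
  rewrite big_nil (eq_laplacian (h := fun=> 0) _ Ux) ?laplacian_cst// => y _.
  by rewrite big_nil.
rewrite big_cons -IH -laplacianZ// -laplacianD//.
- by apply: eq_laplacian => // y _; rewrite big_cons.
- by apply: smoothM => //; exact: smooth_cst.
- by apply: smooth_sum => // s; apply: smoothM => //; exact: smooth_cst.
Qed.

(* Applying a polynomial in the Laplacian that kills the nonzero eigenvalues. *)
Lemma zero_eigencomponent (I : finType) (f : I -> V -> R) (mu : I -> R) :
  (forall t, smooth U (f t)) ->
  (forall t x, U x -> laplacian g (f t) x = mu t * f t x) ->
  (forall x, U x -> \sum_t f t x = 0) ->
  forall x, U x -> \sum_(t | mu t == 0) f t x = 0.
Proof.
move=> sf ef f0.
(* Iterating the Laplacian on the vanishing sum annihilates all its moments. *)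
have pow s x : U x -> \sum_t mu t ^+ s * f t x = 0.
  elim: s x => [|s IH] x Ux.
    by rewrite -[RHS](f0 x Ux); apply: eq_bigr => t _; rewrite mul1r.
  rewrite -[RHS](laplacian_cst 0 x) -(eq_laplacian IH Ux) laplacian_sum//.
  by apply: eq_bigr => t _; rewrite ef// mulrA -exprSr.
have pol (p : {poly R}) x : U x -> \sum_t p.[mu t] * f t x = 0.
  move=> Ux; under eq_bigr do rewrite horner_coef mulr_suml.
  rewrite exchange_big big1// => s _ /=.
  under eq_bigr do rewrite -mulrA.
  by rewrite -mulr_sumr pow// mulr0.
(* This polynomial vanishes at the nonzero eigenvalues and not at 0. *)
move=> x Ux; pose p : {poly R} := \prod_(t | mu t != 0) ('X - (mu t)%:P).
have p0 : p.[0] != 0.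
  rewrite horner_prod; apply/prodf_neq0 => t mut.
  by rewrite !hornerE oppr_eq0.
apply: (mulfI p0); rewrite mulr0 -[RHS](pol p x Ux) mulr_sumr [RHS](bigID (fun t => mu t == 0)) /=.
rewrite [X in _ = _ + X]big1 ?addr0; last first.
  move=> t mut; rewrite (_ : p.[mu t] = 0) ?mul0r// horner_prod (bigD1 t)//=.
  by rewrite !hornerE subrr mul0r.
by apply: eq_bigr => t /eqP->.
Qed.

End LaplacianLinearity.

(** * The 2-type decomposition and its uniqueness *)

Section FiniteTypeHypersurface.
Variables (R : realType) (m : nat) (c k eps : R) (a : 'cV[R[i]]_m.+1).
Variable A : 'M[R[i]]_m.+1.
Local Notation C := R[i].
Local Notation Re := complex.Re.
Local Notation Im := complex.Im.
Local Notation CV := 'cV[C]_m.+1.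
Local Notation MC := 'M[C]_m.+1.
Local Notation P := (@Psi R m c).
Local Notation cc := (c%:C)%C.
Local Notation kk := (k%:C)%C.
Local Notation CQ := (CQ R m c).
Local Notation V := 'rV[R]_(2 * m - 1).

Hypothesis hm : (2 <= m)%N.
Hypothesis hc : c = 1 \/ c = -1.
Hypothesis k0 : k != 0.
Hypothesis k1 : 1 - k != 0.
Hypothesis AA : A *m A = A.
Hypothesis Aadj : hadj c A = A.
Hypothesis trA : \tr A = 1.
Hypothesis Acorner : forall B, A *m B *m A = \tr (A *m B) *: A.
Hypothesis Aa : forall v, A *m v = ((eps%:C)%C * P a v) *: a.

Variable M : set CQ.
Hypothesis hM : forall p, M p -> \tr (A *m Phi p) = kk.
Hypothesis Mopen : forall z0 : hyperquadric R m c, M (proj z0) ->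
  exists2 r : R, 0 < r & forall w : hyperquadric R m c,
  (forall i, `|val w i 0 - val z0 i 0| < (r%:C)%C) ->
  \tr (A *m Phi (proj w)) = kk -> M (proj w).
Hypothesis Mne : M !=set0.

Let hc2 : c ^+ 2 = 1. Proof. exact: hcsqr. Qed.
Let hm0 : (0 < m)%N. Proof. exact: leq_trans hm. Qed.

(** Gives content to [eigenfunction], which only speaks of points covered by a parametrization. *)
Lemma has_chart p : M p -> exists U phi x,
  [/\ local_parametrization M U phi, U x & p = proj (phi x)].
Proof.
have [z0 ->] := proj_surj p => Mz.
have [e [Ae u0e efree]] := tangent_frame hm0 Aa z0.
have [U [hU [U0 E]]] := chart_exists hc k0 k1 AA Aadj (hM Mz) Ae u0e efree (Mopen Mz).
by exists U, (chart k A z0 e), 0; split=> //; rewrite E.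
Qed.

Lemma eigenfunction_cst la f d : eigenfunction M la f -> (forall p, M p -> f p = d) ->
  la * d = 0.
Proof.
move=> ef fd; have [p Mp] := Mne; have [U [phi [x [hphi Ux pE]]]] := has_chart Mp.
have [_ /(_ x Ux)] := ef U phi hphi.
have [oU _ Mphi _] := hphi.
rewrite (eq_laplacian _ oU (h := fun=> d) _ Ux); last by move=> y Uy; rewrite fd//; exact: Mphi.
by rewrite laplacian_cst (fd _ (Mphi x Ux)) => <-.
Qed.

Lemma eigenmatrix_cst la F B : eigenmatrix M la F -> (forall p, M p -> F p = B) ->
  la != 0 -> B = 0.
Proof.
move=> eF FB la0; apply/matrixP => i j; have [e1 e2] := eF i j.
rewrite [RHS]mxE; apply: complex_eq.
  apply: (mulfI la0); rewrite mulr0.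
  by apply: (eigenfunction_cst e1) => p Mp; rewrite FB.
apply: (mulfI la0); rewrite mulr0.
by apply: (eigenfunction_cst e2) => p Mp; rewrite FB.
Qed.

Lemma kk_neq0 : kk != 0. Proof. by rewrite fmorph_eq0. Qed.

Lemma kk1_neq0 : 1 - kk != 0.
Proof. by rewrite -(rmorph1 (real_complex R)) -rmorphB fmorph_eq0. Qed.

(** The cross eigenvalue may be zero, so constancy is refuted by differentiation. It would give A
    X_i + X_i A = 0, hence X_i A = 0 because the corner of X_i vanishes; evaluating at z forces the
    tangent vector E_i to be zero. *)
Lemma cross_part_nonconstant : ~ exists B, forall p, M p -> cross_part k A p = B.
Proof.
move=> [B FB]; have [p Mp] := Mne; have [U [phi [x [hphi Ux pE]]]] := has_chart Mp.
have [oU _ Mphi _] := hphi.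
pose X y := Phi (proj (phi y)); pose z y := val (phi y).
pose E y i := horizontal c (z y) (mpd i z y).
have sX : msmooth U X := Phi_msmooth hphi (erefl z) (fun y => erefl (X y)).
have sAX := msmoothM oU (msmooth_cst U A) sX.
have sXA := msmoothM oU sX (msmooth_cst U A).
have lt0 : (0 < 2 * m - 1)%N.
  by rewrite subn_gt0 (leq_trans hm)// leq_pmull.
pose i := Ordinal lt0.
have dX : A *m mpd i X x + mpd i X x *m A = 0.
  have := mpdD i sAX sXA Ux; rewrite (mpdM i (msmooth_cst U A) sX Ux).
  rewrite (mpdM i sX (msmooth_cst U A) Ux) !mpd_cst mul0mx mulmx0 add0r addr0 => <-.
  rewrite -[RHS](mpd_cst i (B + (2 * kk) *: A) x); apply: (eq_mpd oU i _ Ux) => y Uy.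
  by rewrite -(FB _ (Mphi y Uy)) /cross_part subrK.
have trX := trA_mpd hM hphi (erefl z) (fun y => erefl (X y)) i Ux.
have XA : mpd i X x *m A = 0.
  have := congr1 (fun N : MC => N *m A) dX.
  by rewrite mul0mx mulmxDl Acorner trX scale0r add0r -mulmxA AA.
have zE : P (z x) (E x i) = 0 by apply: Psi_horizontal => //; exact: val_Psi.
have zAz : P (z x) (A *m z x) = cc * kk.
  exact: (Psi_axis_lift hc2 hM hphi (erefl z) (fun y => erefl (X y)) Ux).
have tE := mpd_tanP hc2 hphi (erefl z) (fun y => erefl (X y)) (fun y j => erefl (E y j)) i Ux.
have e0 : (cc * (cc * kk)) *: E x i + (cc * P (E x i) (A *m z x)) *: z x = 0.
  rewrite -zAz -!outer_mul -mulmxDl -/(tanP c (z x) (E x) i) -tE mulmxA XA mul0mx.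
  by [].
have c0 := cc_neq0 hc2; have kC := kk_neq0.
(* Pairing the relation with z isolates the coefficient of z. *)
have EA : cc * P (E x i) (A *m z x) = 0.
  have := congr1 (P (z x)) e0; rewrite PsiDr !PsiZr zE mulr0 add0r Psi0r val_Psi.
  by move=> /eqP; rewrite mulf_eq0 (negbTE c0) orbF => /eqP.
have E0 : E x i = 0.
  move/eqP: e0; rewrite EA scale0r addr0 scaler_eq0 !mulf_eq0 (negbTE c0) (negbTE kC) /=.
  by move/eqP.
have gu := metric_unit hphi (erefl z) (erefl _) (fun y j => erefl (E y j)) Ux.
move: gu; rewrite -row_free_unit => /row_free_inj inj.
have : delta_mx 0 i *m gram c (E x) = 0 *m gram c (E x) :> 'rV[R]__.
  by rewrite mul0mx -rowE; apply/rowP => j; rewrite !mxE E0 Psi0l.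
by move/inj/rowP/(_ i); rewrite !mxE !eqxx => /eqP; rewrite oner_eq0.
Qed.

Lemma orth_eigenvalue_neq0 : orth_eigenvalue m c k != 0.
Proof.
rewrite /orth_eigenvalue mulf_neq0 ?invr_neq0// !mulf_neq0 ?pnatr_eq0 -?lt0n//.
by apply: contra_eq_neq hc2 => ->; rewrite expr0n eq_sym oner_eq0.
Qed.

(** Its eigenvalue is nonzero, so a constant value would be 0. But on a vector orthogonal to both a
    and z the matrix acts as the nonzero scalar - (1-k)/m, and such a vector exists because m >=
    2. *)
Lemma orth_part_nonconstant : ~ exists B, forall p, M p -> orth_part k A p = B.
Proof.
move=> [B FB]; have [p Mp] := Mne.
have B0 : B = 0.
  exact: (eigenmatrix_cst (orth_eigenmatrix hm0 hc2 k0 k1 AA Aadj trA Acorner hM) FB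
    orth_eigenvalue_neq0).
have [z0 pE] := proj_surj p; pose z := val z0.
have PhiE : Phi p = outer c z z by rewrite pE Phi_proj.
pose l (t : 'I_4) (v : CV) : R := [:: Re (P a v); Im (P a v); Re (P z v); Im (P z v)]`_t.
(* Two complex orthogonality conditions are four real ones and leave dimension 2m - 2. *)
have hq : ((2 * m - 2) + 4 = m.+1 + m.+1)%N.
  rewrite -[4%N]/(2 + 2)%N addnA subnK ?(leq_trans hm) ?leq_pmull//.
  by rewrite mul2n -addnn addn2 addnS addSn.
have lD t v w : l t (v + w) = l t v + l t w.
  case: t => -[|[|[|[|//]]]] /= ?; rewrite /l /= PsiDr.
  - by rewrite (ReD (P a v)).
  - by case: (P a v) (P a w) => ? ? [].
  - by rewrite (ReD (P z v)).
  - by case: (P z v) (P z w) => ? ? [].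
have lZ t r v : l t ((r%:C)%C *: v) = r * l t v.
  by case: t => -[|[|[|[|//]]]] /= ?; rewrite /l /= PsiZr ?ReM_real ?ImM_real.
have [e [le free]] := constrained_frame hq lD lZ.
have lt0 : (0 < 2 * m - 2)%N.
  by rewrite subn_gt0 -[X in (X < _)%N]muln1 ltn_pmul2l.
pose i := Ordinal lt0.
have ae : P a (e i) = 0.
  apply: complex_eq; first by have := le i (inord 0); rewrite /l inordK.
  by have := le i (inord 1); rewrite /l inordK.
have ze : P z (e i) = 0.
  apply: complex_eq; first by have := le i (inord 2); rewrite /l inordK.
  by have := le i (inord 3); rewrite /l inordK.
have Ae : A *m e i = 0 by rewrite Aa ae mulr0 scale0r.
have Xe : Phi p *m e i = 0 by rewrite PhiE outer_mul ze mulr0 scale0r.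
have : orth_part k A p *m e i = - (((1 - kk) / m%:R) *: e i).
  rewrite /orth_part mulmxDl mulNmx -(scalemxAl _ (1%:M - A)) (mulmxBl 1%:M) mul1mx Ae subr0.
  rewrite mulmxDl -scalemxAl Ae scaler0 addr0 mulmxBl Xe mulmxDl -!mulmxA Xe Ae.
  by rewrite !mulmx0 addr0 subr0 add0r.
rewrite FB// B0 mul0mx => /esym/eqP.
rewrite oppr_eq0 scaler_eq0 mulf_eq0 invr_eq0 pnatr_eq0 (negbTE kk1_neq0) /=.
rewrite eqn0Ngt hm0 /= => /eqP e0.
have := free (fun j => (j == i)%:R) _ i; rewrite eqxx => h.
suff : (1 : R) = 0 by move/eqP; rewrite oner_eq0.
apply: h; rewrite (bigD1 i)//= big1 ?addr0; first by rewrite e0 scaler0.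
by move=> j ji; rewrite (negbTE ji) scale0r.
Qed.

Lemma hypersurface_decomposition : cross_eigenvalue m c k != orth_eigenvalue m c k ->
  spectral_decomposition M (center k A)
    (fun i : 'I_2 => [:: cross_eigenvalue m c k; orth_eigenvalue m c k]`_i)
    (fun i : 'I_2 => nth (cross_part k A) [:: cross_part k A; orth_part k A] i).
Proof.
move=> ne; split.
- move=> [[|[|//]] ?] [[|[|//]] ?] /= e; apply: val_inj => //=.
    by rewrite e eqxx in ne.
  by rewrite e eqxx in ne.
- case=> -[|[|//]] ? /=; split.
  + by move=> p _; apply/psi_hermitianE => //; exact: cross_part_hadj.
  + exact: cross_part_nonconstant.
  + exact: cross_eigenmatrix.
  + by move=> p _; apply/psi_hermitianE => //; exact: orth_part_hadj.
  + exact: orth_part_nonconstant.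
  + exact: orth_eigenmatrix.
- by move=> p _; rewrite !big_ord_recl big_ord0 addr0 /= -Phi_decomposition.
Qed.

Lemma hypersurface_finite_type : cross_eigenvalue m c k != orth_eigenvalue m c k ->
  finite_type M 2.
Proof. by move=> /hypersurface_decomposition h; exists (center k A); do 2 eexists; exact: h. Qed.

Section Uniqueness.
Variables (K : nat) (x0 : MC) (lambda : 'I_K -> R) (x_ : 'I_K -> CQ -> MC).
Hypothesis dec : spectral_decomposition M x0 lambda x_.
Hypothesis cross0 : cross_eigenvalue m c k != 0.

(** The given decomposition minus that of [Phi_decomposition] is a vanishing sum of eigenfunctions,
    and [zero_eigencomponent] extracts the eigenvalue 0. The map [part] stands for the real or the
    imaginary part. *)
Lemma zero_part_entry (part : C -> R) b d p :
  (forall u v, part (u + v) = part u + part v) ->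
  (forall la F, eigenmatrix M la F -> eigenfunction M la (fun p => part (F p b d))) ->
  M p -> part ((\sum_(t | lambda t == 0) x_ t p + (x0 - center k A)) b d) = 0.
Proof.
move=> partD eigen Mp; have [lam_inj xs decE] := dec.
have part0 : part 0 = 0 by apply: (addrI (part 0)); rewrite -partD !addr0.
have partN u : part (- u) = - part u.
  by apply/eqP; rewrite -addr_eq0 -partD addNr part0.
have part_sum (I : finType) (Q : pred I) (F : I -> C) :
    part (\sum_(i | Q i) F i) = \sum_(i | Q i) part (F i).
  exact: (big_morph _ partD part0).
have [U [phi [x [hphi Ux ->]]]] := has_chart Mp.
have [oU _ Mphi _] := hphi; pose q y := proj (phi y).
(* The three additional terms are the difference of the constants, of eigenvalue 0, and the two
   known eigenmatrices with opposite sign. *)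
pose f (t : 'I_K + 'I_3) y := match t with
  | inl i => part (x_ i (q y) b d)
  | inr j => [:: part ((x0 - center k A) b d); - part (cross_part k A (q y) b d);
                 - part (orth_part k A (q y) b d)]`_j end.
pose mu (t : 'I_K + 'I_3) := match t with
  | inl i => lambda i
  | inr j => [:: 0; cross_eigenvalue m c k; orth_eigenvalue m c k]`_j end.
have ex i : eigenfunction M (lambda i) (fun p => part (x_ i p b d)).
  by apply: eigen; have [_ _] := xs i.
have ec := eigen _ _ (cross_eigenmatrix hm0 hc2 k0 k1 AA Aadj trA Acorner hM).
have eo := eigen _ _ (orth_eigenmatrix hm0 hc2 k0 k1 AA Aadj trA Acorner hM).
have sf t : smooth U (f t).
  case: t => [i|[[|[|[|//]]] ?]] /=.
  - by have [] := ex i U phi hphi.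
  - exact: smooth_cst.
  - by apply: smoothN => //; have [] := ec U phi hphi.
  - by apply: smoothN => //; have [] := eo U phi hphi.
have lapN h y : smooth U h -> U y -> laplacian (induced_metric phi) (fun y => - h y) y =
    - laplacian (induced_metric phi) h y.
  move=> sh Uy; rewrite -mulN1r -(laplacianZ _ oU _ sh Uy).
  by apply: (eq_laplacian _ oU _ Uy) => w _; rewrite mulN1r.
have ef t y : U y -> laplacian (induced_metric phi) (f t) y = mu t * f t y.
  move=> Uy; case: t => [i|[[|[|[|//]]] ?]] /=.
  - by have [_ ->] := ex i U phi hphi.
  - by rewrite mul0r; exact: laplacian_cst.
  - by have [s1 e1] := ec U phi hphi; rewrite lapN// e1// mulrN.
  - by have [s1 e1] := eo U phi hphi; rewrite lapN// e1// mulrN.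
have f0 y : U y -> \sum_t f t y = 0.
  move=> Uy; rewrite big_sumType /= !big_ord_recl big_ord0 /= addr0 -part_sum.
  rewrite -!partN -!partD -[RHS]part0; congr part.
  have e := etrans (esym (decE _ (Mphi y Uy))) (Phi_decomposition k A (proj (phi y))).
  transitivity ((x0 + \sum_t x_ t (q y) -
      (center k A + (cross_part k A (q y) + orth_part k A (q y)))) b d).
    by rewrite !mxE summxE; ring.
  by rewrite e subrr mxE.
have := zero_eigencomponent oU sf ef f0 Ux.
rewrite big_sumType /= [X in _ + X](_ : _ = part ((x0 - center k A) b d)); last first.
  rewrite big_mkcond !big_ord_recl big_ord0 /= eqxx (negbTE cross0).
  by rewrite (negbTE orth_eigenvalue_neq0) !addr0.
rewrite -part_sum -partD => h; rewrite -[RHS]h; congr part.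
by rewrite mxE summxE.
Qed.

Lemma zero_part p : M p -> \sum_(t | lambda t == 0) x_ t p + (x0 - center k A) = 0.
Proof.
move=> Mp; apply/matrixP => b d; rewrite [RHS]mxE; apply: complex_eq.
  by apply: zero_part_entry => // [u v|la F /(_ b d)[]//]; exact: ReD.
by apply: zero_part_entry => // [[? ?] [? ?]//|la F /(_ b d)[]//].
Qed.

(** Eigenvalues being distinct, at most one is 0, and its component would equal a constant, which a
    spectral decomposition forbids. So no eigenvalue is 0 and the constant terms agree. *)
Lemma decomposition_center : (forall t, lambda t != 0) /\ x0 = center k A.
Proof.
have [lam_inj xs _] := dec.
have lam0 t : lambda t != 0.
  apply/eqP => t0; have [_ + _] := xs t; apply; exists (center k A - x0) => p Mp.
  have := zero_part Mp; rewrite (bigD1 t) ?t0//= big1 ?addr0.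
    by move/eqP; rewrite addr_eq0 opprB => /eqP.
  move=> s /andP[/eqP s0] st; case/eqP: st; apply: lam_inj; by rewrite s0 t0.
split=> //; have [p Mp] := Mne; have := zero_part Mp.
rewrite big1 ?add0r; last by move=> t; rewrite (negbTE (lam0 t)).
by move/eqP; rewrite subr_eq0 => /eqP.
Qed.

End Uniqueness.

End FiniteTypeHypersurface.

(** * Complex limits and continuity *)

Section ComplexLimits.
Variables (R : realType) (T : Type) (F : set_system T).
Context {FF : Filter F}.
Local Notation C := R[i].
Local Notation Re := complex.Re.
Local Notation Im := complex.Im.
Implicit Types (f g : T -> C) (l k : C).

Definition clim f l := ((fun t => Re (f t)) @ F --> Re l) /\ ((fun t => Im (f t)) @ F --> Im l).

Lemma clim_cst l : clim (fun=> l) l.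
Proof. by split; exact: cvg_cst. Qed.

Lemma climD f g l k : clim f l -> clim g k -> clim (fun t => f t + g t) (l + k).
Proof.
move=> [f1 f2] [g1 g2]; split.
  rewrite (_ : (fun t => _) = fun t => Re (f t) + Re (g t)).
    by rewrite ReD; exact: cvgD.
  by apply/funext => t; rewrite ReD.
rewrite (_ : (fun t => _) = fun t => Im (f t) + Im (g t)).
  rewrite (_ : Im (l + k) = Im l + Im k); last by case: l k {f1 f2 g1 g2} => ? ? [].
  exact: cvgD.
by apply/funext => t; case: (f t) (g t) => ? ? [].
Qed.

Lemma climM f g l k : clim f l -> clim g k -> clim (fun t => f t * g t) (l * k).
Proof.
move=> [f1 f2] [g1 g2]; split.
  rewrite (_ : (fun t => _) = fun t => Re (f t) * Re (g t) - Im (f t) * Im (g t)).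
    rewrite (_ : Re (l * k) = Re l * Re k - Im l * Im k); last first.
      by case: l k {f1 f2 g1 g2} => ? ? [].
    by apply: cvgB; exact: cvgM.
  by apply/funext => t; case: (f t) (g t) => ? ? [].
rewrite (_ : (fun t => _) = fun t => Re (f t) * Im (g t) + Im (f t) * Re (g t)).
  rewrite (_ : Im (l * k) = Re l * Im k + Im l * Re k); last first.
    by case: l k {f1 f2 g1 g2} => ? ? [].
  by apply: cvgD; exact: cvgM.
by apply/funext => t; case: (f t) (g t) => ? ? [].
Qed.

Lemma clim_conj f l : clim f l -> clim (fun t => (f t)^*) l^*.
Proof.
move=> [f1 f2]; split.
  rewrite (_ : (fun t => _) = fun t => Re (f t)) ?ReJ//.
  by apply/funext => t; rewrite ReJ.
rewrite (_ : (fun t => _) = fun t => - Im (f t)) ?ImJ; first exact: cvgN.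
by apply/funext => t; rewrite ImJ.
Qed.

Lemma clim_sum (I : Type) (r : seq I) (f : I -> T -> C) (l : I -> C) :
  (forall i, clim (f i) (l i)) ->
  clim (fun t => \sum_(i <- r) f i t) (\sum_(i <- r) l i).
Proof.
move=> cf; elim: r => [|i r IH].
  rewrite big_nil (_ : (fun t => _) = fun=> 0); first exact: clim_cst.
  by apply/funext => t; rewrite big_nil.
rewrite big_cons (_ : (fun t => _) = fun t => f i t + \sum_(j <- r) f j t).
  exact: climD.
by apply/funext => t; rewrite big_cons.
Qed.

Lemma clim_Psi m (c : R) (v w : T -> 'cV[C]_m.+1) (v0 w0 : 'cV[C]_m.+1) :
  (forall i, clim (fun t => v t i 0) (v0 i 0)) ->
  (forall i, clim (fun t => w t i 0) (w0 i 0)) ->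
  clim (fun t => Psi c (v t) (w t)) (Psi c v0 w0).
Proof.
move=> cv cw; rewrite PsiE.
rewrite (_ : (fun t => _) = fun t => \sum_j sgnP c j * (v t j 0)^* * w t j 0).
  apply: clim_sum => j; apply: climM => //; apply: climM; first exact: clim_cst.
  by apply: clim_conj.
by apply/funext => t; rewrite PsiE.
Qed.

End ComplexLimits.

Section ContinuousComplex.
Variables (R : realType) (T : topologicalType).
Local Notation C := R[i].
Local Notation Re := complex.Re.
Local Notation Im := complex.Im.
Implicit Types f g : T -> C.

Definition ccont f := forall t, clim (nbhs t) f (f t).

Lemma ccontP f : ccont f <->
  continuous (fun t => Re (f t)) /\ continuous (fun t => Im (f t)).
Proof.
by split=> [h|[h1 h2] t]; [split=> t; have [] := h t|split; [exact: h1|exact: h2]].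
Qed.

Lemma ccont_cst (u : C) : ccont (fun=> u).
Proof. by move=> t; exact: clim_cst. Qed.

Lemma ccont_real (f : T -> R) : continuous f -> ccont (fun t => ((f t)%:C)%C).
Proof. by move=> cf; apply/ccontP; split=> //=; exact: cst_continuous. Qed.

Lemma ccontD f g : ccont f -> ccont g -> ccont (fun t => f t + g t).
Proof. by move=> cf cg t; exact: climD. Qed.

Lemma ccontM f g : ccont f -> ccont g -> ccont (fun t => f t * g t).
Proof. by move=> cf cg t; exact: climM. Qed.

Lemma ccont_conj f : ccont f -> ccont (fun t => (f t)^*).
Proof. by move=> cf t; exact: clim_conj. Qed.

Variables (m : nat) (c : R).
Local Notation CV := 'cV[C]_m.+1.
Local Notation P := (@Psi R m c).

Definition vcont (w : T -> CV) := forall i, ccont (fun t => w t i 0).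

Lemma vcontZ f w : ccont f -> vcont w -> vcont (fun t => f t *: w t).
Proof.
move=> cf cw i; rewrite (_ : (fun t => _) = fun t => f t * w t i 0).
  exact: ccontM.
by apply/funext => t; rewrite mxE.
Qed.

Lemma vcontD v w : vcont v -> vcont w -> vcont (fun t => v t + w t).
Proof.
move=> cv cw i; rewrite (_ : (fun t => _) = fun t => v t i 0 + w t i 0).
  exact: ccontD.
by apply/funext => t; rewrite mxE.
Qed.

Lemma vcont_cst (v : CV) : vcont (fun=> v).
Proof. by move=> i; exact: ccont_cst. Qed.

Lemma vcontB v w : vcont v -> vcont w -> vcont (fun t => v t - w t).
Proof.
move=> cv cw; apply: vcontD => //.
rewrite (_ : (fun t => _) = fun t => (-1 : C) *: w t); last first.
  by apply/funext => t; rewrite scaleN1r.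
by apply: vcontZ => //; exact: ccont_cst.
Qed.

Lemma ccont_Psi v w : vcont v -> vcont w -> ccont (fun t => P (v t) (w t)).
Proof. by move=> cv cw t; apply: clim_Psi => i; [exact: cv|exact: cw]. Qed.

Lemma vcont_horizontal z v : vcont z -> vcont v ->
  vcont (fun t => horizontal c (z t) (v t)).
Proof.
move=> cz cv; apply: vcontB => //; apply: vcontZ => //.
by apply: ccontM; [exact: ccont_cst|exact: ccont_Psi].
Qed.

Lemma submersion_metric_continuous z v : vcont z -> vcont v ->
  continuous (fun t => submersion_metric c (z t) (v t) (v t)).
Proof.
by move=> cz cv; have [] := (ccontP _).1 (ccont_Psi (vcont_horizontal cz cv) (vcont_horizontal cz cv)).
Qed.

End ContinuousComplex.

(** * Curves and their lengths *)

Section Curves.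
Variables (R : realType) (m : nat) (c : R).
Local Notation C := R[i].
Local Notation Re := complex.Re.
Local Notation Im := complex.Im.
Local Notation CV := 'cV[C]_m.+1.
Local Notation P := (@Psi R m c).
Local Notation cc := (c%:C)%C.
Local Notation CQ := (CQ R m c).
Local Notation HQ := (hyperquadric R m c).
Implicit Types (g : R -> HQ).

Definition velocity g t := cderive (fun s => val (g s)) 1 t.

Definition speed_sqr g t := submersion_metric c (val (g t)) (velocity g t) (velocity g t).

Lemma curve_lengthE g : curve_length g =
  (\int[lebesgue_measure]_(t in `[0%R, 1%R]) (Num.sqrt (speed_sqr g t))%:E)%E.
Proof. by []. Qed.

Lemma C1_continuous (f : R -> R) : C1_function f -> continuous f.
Proof. by move=> [df _] t; apply/differentiable_continuous/derivable1_diffP/df. Qed.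

Lemma C1_curve_vcont g : C1_curve g -> vcont (fun t => val (g t)).
Proof. by move=> Cg i; have [/C1_continuous ? /C1_continuous ?] := Cg i; apply/ccontP. Qed.

Lemma velocity_vcont g : C1_curve g -> vcont (velocity g).
Proof.
move=> Cg i; have [[_ c1] [_ c2]] := Cg i; apply/ccontP; split.
  rewrite (_ : (fun t => _) = derive1 (fun t => Re (val (g t) i 0))) //.
  by apply/funext => t; rewrite mxE derive1E.
rewrite (_ : (fun t => _) = derive1 (fun t => Im (val (g t) i 0))) //.
by apply/funext => t; rewrite mxE derive1E.
Qed.

Lemma curve_cderive g i (t : R^o) : C1_curve g ->
  is_cderive t 1 (fun s => val (g s) i 0) (velocity g t i 0).
Proof.
move=> Cg; have [[d1 _] [d2 _]] := Cg i; rewrite /velocity mxE.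
by split; exact: DeriveDef.
Qed.

Lemma speed_continuous g : C1_curve g -> continuous (fun t => Num.sqrt (speed_sqr g t)).
Proof.
move=> Cg t; apply: continuous_comp; last exact: sqrt_continuous.
exact: (submersion_metric_continuous (C1_curve_vcont Cg) (velocity_vcont Cg)).
Qed.

Lemma continuous_measurableR (f : R -> R) (D : set R) : measurable D -> continuous f ->
  measurable_fun D f.
Proof. by move=> mD /measurable_realfun.continuous_measurable_fun; exact: measurable_funTS. Qed.

Lemma curve_length_le g (K : R) : C1_curve g -> 0 <= K ->
  (forall t, 0 <= t <= 1 -> speed_sqr g t <= K ^+ 2) -> (curve_length g <= K%:E)%E.
Proof.
move=> Cg K0 le; rewrite curve_lengthE.
rewrite (@le_trans _ _ (\int[lebesgue_measure]_(t in `[0%R, 1%R]) K%:E)%E)//.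
  apply: ge0_le_integral => //=.
  - apply/measurable_realfun.measurable_EFinP; apply: continuous_measurableR => //.
    exact: speed_continuous.
  - move=> t; rewrite in_itv /= => t01; rewrite lee_fin -(ger0_norm K0) -sqrtr_sqr.
    by apply: ler_wsqrtr; exact: le.
rewrite integral_cst//= lebesgue_measure_itv /= lte_fin ltr01 oppr0 adde0 mule1.
by [].
Qed.

Section AffineCurve.
Variables (f h df dh : R -> R) (x0 x1 x2 : CV).
Hypothesis fD : forall t : R^o, is_derive t 1 f (df t).
Hypothesis hD : forall t : R^o, is_derive t 1 h (dh t).
Hypothesis cdf : continuous df.
Hypothesis cdh : continuous dh.
Let w t : CV := x0 + (((f t)%:C)%C *: x1 + ((h t)%:C)%C *: x2).
Hypothesis ww : forall t, P (w t) (w t) = cc.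

(** Every explicit curve needed has a lift of this shape: geodesics, arcs in spheres, constant
    curves and stereographic paths. *)
Lemma affine_curve : exists g, [/\ C1_curve g, forall t, val (g t) = w t &
  forall t, velocity g t = ((df t)%:C)%C *: x1 + ((dh t)%:C)%C *: x2].
Proof.
have wP t : P (w t) (w t) == cc by rewrite ww.
exists (fun t => exist _ (w t) (wP t) : HQ).
pose dw t : CV := ((df t)%:C)%C *: x1 + ((dh t)%:C)%C *: x2.
have realD (k : R -> R) (t : R^o) d : is_derive t 1 k d -> is_cderive t 1 (fun s => ((k s)%:C)%C) ((d%:C)%C : C).
  by move=> kd; split => //=; exact: is_derive_cst.
have D i (t : R^o) : is_cderive t 1 (fun s => w s i 0) (dw t i 0).
  rewrite (_ : (fun s => _) = fun s => x0 i 0 + ((((f s)%:C)%C * x1 i 0 + ((h s)%:C)%C * x2 i 0))).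
    have := is_cderiveD (is_cderive_cst t 1 (x0 i 0))
      (is_cderiveD (is_cderiveM (realD _ _ _ (fD t)) (is_cderive_cst t 1 (x1 i 0)))
                   (is_cderiveM (realD _ _ _ (hD t)) (is_cderive_cst t 1 (x2 i 0)))).
    rewrite !mulr0 !addr0 add0r; congr (is_cderive _ _ _ _).
    by rewrite !mxE.
  by apply/funext => s; rewrite !mxE.
have cdw : vcont dw.
  by apply: vcontD; apply: vcontZ; rewrite //; first [exact: ccont_real|exact: vcont_cst].
split=> //.
- move=> i; have [c1 c2] := (ccontP _).1 (cdw i).
  have E1 : derive1 (fun t => Re (w t i 0)) = fun t => Re (dw t i 0).
    by apply/funext => t; rewrite derive1E; have [d1 _] := D i t; exact: derive_val.
  have E2 : derive1 (fun t => Im (w t i 0)) = fun t => Im (dw t i 0).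
    by apply/funext => t; rewrite derive1E; have [_ d2] := D i t; exact: derive_val.
  split; split.
  + by move=> t; have [d1 _] := D i t; exact: ex_derive.
  + by change (continuous (derive1 (fun t => Re (w t i 0)))); rewrite E1.
  + by move=> t; have [_ d2] := D i t; exact: ex_derive.
  + by change (continuous (derive1 (fun t => Im (w t i 0)))); rewrite E2.
- move=> t; apply/matrixP => i j; rewrite (ord1 j) mxE.
  have [d1 d2] := D i t; change (dw t i 0) with (dw t i 0).
  have e1 : 'D_1 (fun s => Re (w s i 0)) t = Re (dw t i 0) by exact: derive_val.
  have e2 : 'D_1 (fun s => Im (w s i 0)) t = Im (dw t i 0) by exact: derive_val.
  by apply: complex_eq.
Qed.

End AffineCurve.

Lemma joins_dist (M : set CQ) p q g K : joins_in M p q g -> (curve_length g <= K)%E ->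
  (riemannian_dist M p q <= K)%E.
Proof.
by move=> gj; apply: le_trans; apply: ereal_inf_lbound; exists g.
Qed.

Lemma riemannian_dist_setT (M : set CQ) p q :
  (riemannian_dist setT p q <= riemannian_dist M p q)%E.
Proof.
apply: ereal_inf_le_tmp => x [g [g1 g2 g3 _] <-].
by exists g.
Qed.

End Curves.

(** * Circular and hyperbolic functions treated together *)

Section GeneralizedTrigonometry.
Variables (R : realType) (c : R).
Implicit Types t x y : R.

(* The radial functions of constant curvature [c = 1] or [c = -1]. *)
Definition csn t : R := if c == 1 then cos t else (expR t + expR (- t)) / 2.
Definition ssn t : R := if c == 1 then sin t else (expR t - expR (- t)) / 2.

Hypothesis hc : c = 1 \/ c = -1.

Lemma N1_neq1 : (-1 == 1 :> R) = false.
Proof. by apply/eqP => h; lra. Qed.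

Lemma csn0 : csn 0 = 1.
Proof.
rewrite /csn; case: ifP => _; first exact: cos0.
by rewrite oppr0 expR0; field.
Qed.

Lemma ssn0 : ssn 0 = 0.
Proof.
rewrite /ssn; case: ifP => _; first exact: sin0.
by rewrite oppr0 expR0 subrr mul0r.
Qed.

Lemma csn2_ssn2 t : csn t ^+ 2 + c * ssn t ^+ 2 = 1.
Proof.
rewrite /csn /ssn; case: hc => ->; rewrite ?eqxx ?N1_neq1 ?mul1r ?cos2Dsin2//.
have := expRxMexpNx_1 t; move: (expR t) (expR (- t)) => x y xy.
transitivity (x * y); last by []; by field.
Qed.

Lemma is_derive_csn (t : R^o) : is_derive t 1 csn (- (c * ssn t)).
Proof.
rewrite /csn /ssn; case: hc => ->; rewrite ?eqxx ?N1_neq1.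
  rewrite mul1r; exact: is_derive_cos.
have h1 : is_derive t 1 expR (expR t) by exact: is_derive_expR.
have h2 : is_derive t 1 (expR \o -%R) (expR (- t) * - 1).
  exact: is_derive1_comp.
have := is_deriveM (is_deriveD h1 h2) (is_derive_cst (2^-1 : R^o) t 1).
rewrite (_ : (expR + (expR \o -%R)) * cst 2^-1 = fun t => (expR t + expR (- t)) / 2) //.
move=> h; apply: is_derive_eq h _.
by rewrite /GRing.scale /= mulr0 add0r; field.
Qed.

Lemma is_derive_ssn (t : R^o) : is_derive t 1 ssn (csn t).
Proof.
rewrite /csn /ssn; case: hc => ->; rewrite ?eqxx ?N1_neq1.
  exact: is_derive_sin.
have h1 : is_derive t 1 expR (expR t) by exact: is_derive_expR.
have h2 : is_derive t 1 (expR \o -%R) (expR (- t) * - 1).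
  exact: is_derive1_comp.
have := is_deriveM (is_deriveB h1 h2) (is_derive_cst (2^-1 : R^o) t 1).
rewrite (_ : (expR - (expR \o -%R)) * cst 2^-1 = fun t => (expR t - expR (- t)) / 2) //.
move=> h; apply: is_derive_eq h _.
by rewrite /GRing.scale /= mulr0 add0r; field.
Qed.

Lemma is_derive_continuous (f df : R -> R) : (forall t : R^o, is_derive t 1 f (df t)) ->
  continuous f.
Proof.
by move=> D t; apply/differentiable_continuous/derivable1_diffP; have := D t => -[].
Qed.

Lemma continuous_csn : continuous csn.
Proof. exact: is_derive_continuous is_derive_csn. Qed.

Lemma continuous_ssn : continuous ssn.
Proof. exact: is_derive_continuous is_derive_ssn. Qed.

End GeneralizedTrigonometry.

(** * Circles in the hyperquadric *)

Section Circles.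
Variables (R : realType) (m : nat) (c : R).
Local Notation C := R[i].
Local Notation Re := complex.Re.
Local Notation Im := complex.Im.
Local Notation CV := 'cV[C]_m.+1.
Local Notation P := (@Psi R m c).
Local Notation cc := (c%:C)%C.
Local Notation CQ := (CQ R m c).
Local Notation HQ := (hyperquadric R m c).
Hypothesis hc : c = 1 \/ c = -1.
Let hc2 : c ^+ 2 = 1. Proof. exact: hcsqr. Qed.

Lemma submersion_metricE (z v : CV) : P z z = cc ->
  submersion_metric c z v v = Re (P v v) - c * sqnorm (P z v).
Proof.
move=> zz; rewrite /submersion_metric /horizontal PsiBl !PsiBr !PsiZl !PsiZr zz.
rewrite (Psi_conj c z v) rmorphM /= conj_real; move: (P z v) (P v v) => [a b] [d e].
rewrite /sqnorm /=; set X := (RHS).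
transitivity (X + (c ^+ 2 - 1) * c * (a ^+ 2 + b ^+ 2)); last by rewrite hc2 subrr !mul0r addr0.
by rewrite /X; ring.
Qed.

Section Circle.
Variables (x0 x1 x2 : CV) (n rho : R).
Hypothesis x01 : P x0 x1 = 0.
Hypothesis x02 : P x0 x2 = 0.
Hypothesis x00 : Re (P x0 x0) = c * (1 - n).
Hypothesis x11 : Re (P x1 x1) = c * n.
Hypothesis x22 : Re (P x2 x2) = n.
Hypothesis x12 : Re (P x1 x2) = 0.
Hypothesis x12' : c = 1 \/ P x1 x2 = 0.
Hypothesis rho0 : 0 <= rho.

(** The component x0 stays fixed while x1 is turned towards x2. With x0 = 0 and n = 1 this is a
    geodesic of CQ; with x0 on an axis it is an arc inside a level set. *)
Lemma circle_curve : exists g : R -> HQ, [/\ C1_curve g,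
  forall t, val (g t) = x0 + (((csn c (rho * t))%:C)%C *: x1 + ((ssn c (rho * t))%:C)%C *: x2)
  & (curve_length g <= (rho * Num.sqrt n)%:E)%E].
Proof.
pose f t := csn c (rho * t); pose h t := ssn c (rho * t).
have lin (t : R^o) : is_derive t 1 ( *%R rho) rho.
  by have := is_deriveZ rho (is_derive_id t 1); rewrite /GRing.scale /= mulr1.
have fD (t : R^o) : is_derive t 1 f (- (c * h t) * rho).
  by apply: is_derive1_comp; exact: is_derive_csn.
have hD (t : R^o) : is_derive t 1 h (f t * rho).
  by apply: is_derive1_comp; exact: is_derive_ssn.
have cf := is_derive_continuous fD; have ch := is_derive_continuous hD.
have cdf : continuous (fun t => - (c * h t) * rho).
  by move=> t; apply: cvgM; [apply: cvgN; apply: cvgM; [exact: cvg_cst|exact: ch]|exact: cvg_cst].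
have cdh : continuous (fun t => f t * rho).
  by move=> t; apply: cvgM; [exact: cf|exact: cvg_cst].
have fh t : f t ^+ 2 + c * h t ^+ 2 = 1 by exact: csn2_ssn2.
have comb (a b : R) : Re (P ((a%:C)%C *: x1 + (b%:C)%C *: x2) ((a%:C)%C *: x1 + (b%:C)%C *: x2))
    = c * n * a ^+ 2 + n * b ^+ 2.
  rewrite PsiDl !PsiDr !PsiZl !PsiZr !conj_real (Psi_self c x1) (Psi_self c x2) x11 x22.
  rewrite (Psi_conj c x1 x2); move: (P x1 x2) x12 => [u v] /= ->.
  by rewrite /=; ring.
have ww t : P (x0 + (((f t)%:C)%C *: x1 + ((h t)%:C)%C *: x2))
    (x0 + (((f t)%:C)%C *: x1 + ((h t)%:C)%C *: x2)) = cc.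
  rewrite [LHS]Psi_self; congr (_%:C)%C.
  rewrite Re_PsiD_orth ?comb ?x00; last by rewrite PsiDr !PsiZr x01 x02 !mulr0 addr0.
  transitivity (c * (1 - n) + n * c * (f t ^+ 2 + c * h t ^+ 2) - n * (c ^+ 2 - 1) * h t ^+ 2);
    by [ring|rewrite fh hc2; ring].
have [g [Cg gE vE]] := affine_curve fD hD cdf cdh ww.
exists g; split=> //.
apply: curve_length_le => //; first by rewrite mulr_ge0 ?sqrtr_ge0.
move=> t _; rewrite /speed_sqr gE vE submersion_metricE//.
have b : Re (P (((- (c * h t) * rho)%:C)%C *: x1 + ((f t * rho)%:C)%C *: x2)
   (((- (c * h t) * rho)%:C)%C *: x1 + ((f t * rho)%:C)%C *: x2)) = rho ^+ 2 * n.
  rewrite comb.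
  transitivity (rho ^+ 2 * n * (f t ^+ 2 + c * h t ^+ 2) + rho ^+ 2 * n * c * (c ^+ 2 - 1) * h t ^+ 2);
    by [ring|rewrite fh hc2; ring].
have nn : rho ^+ 2 * n <= (rho * Num.sqrt n) ^+ 2.
  rewrite exprMn ler_wpM2l ?sqr_ge0//; have [n_ge0|/ltW nle0] := leP 0 n.
    by rewrite sqr_sqrtr.
  by rewrite (le_trans nle0)// sqr_ge0.
rewrite b; apply: le_trans nn; rewrite gerBl.
(* The vertical part of the velocity only lowers the speed when c = 1, and is zero when Psi(x1,x2) =
   0. *)
case: x12' => [->|P12]; first by rewrite mul1r sqnorm_ge0.
rewrite PsiDl !PsiDr !PsiZr x01 x02 !mulr0 !addr0 !PsiDl !PsiZl P12.
rewrite (Psi_conj c x1 x2) P12 rmorph0 !mulr0 addr0 add0r !conj_real.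
rewrite (Psi_self c x1) (Psi_self c x2) x11 x22 (_ : _ + _ = 0) ?sqnorm0 ?mulr0//.
apply: complex_eq => /=.
  transitivity (- rho * f t * h t * n * (c ^+ 2 - 1)); first by ring.
  by rewrite hc2 subrr mulr0.
by ring.
Qed.

End Circle.

End Circles.

(** * Lower bounds for integrals of speeds *)

Section IntegralComparison.
Variable R : realType.
Implicit Types (a da s : R -> R).

Lemma integral_lower_bound a da s : (forall t : R^o, is_derive t 1 a (da t)) ->
  continuous da -> continuous s -> (forall t, 0 <= t <= 1 -> da t <= s t) ->
  ((a 1 - a 0)%:E <= \int[lebesgue_measure]_(t in `[0%R, 1%R]) (s t)%:E)%E.
Proof.
move=> aD cda cs le; have ca := is_derive_continuous aD.
have within (f : R -> R) : continuous f -> {within `[0%R, 1%R], continuous f}.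
  by move=> cf; exact: continuous_subspaceT.
have integ (f : R -> R) : continuous f ->
    lebesgue_measure.-integrable (`[0%R, 1%R] : set R) (EFin \o f).
  by move=> cf; apply: continuous_compact_integrable; [exact: segment_compact|exact: within].
have FTC : (\int[lebesgue_measure]_(t in `[0%R, 1%R]) (da t)%:E)%E = ((a 1)%:E - (a 0)%:E)%E.
  apply: continuous_FTC2 => //; first exact: within.
  - split.
    + by move=> t _; have := aD t => -[].
    + exact: cvg_at_right_filter (ca 0).
    + exact: cvg_at_left_filter (ca 1).
  - by move=> t _; rewrite derive1E; have := aD t => -[].
rewrite EFinB -FTC; apply: le_integral => //; [exact: integ|exact: integ|].
by move=> t; rewrite inE /= in_itv /= => t01; rewrite lee_fin le.
Qed.

Lemma continuous_inv_sqrt (f : R -> R) : continuous f -> (forall t, 0 < f t) ->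
  continuous (fun t => (Num.sqrt (f t))^-1).
Proof.
move=> cf f0 t; apply: cvgV; first by rewrite gt_eqF// sqrtr_gt0.
by apply: continuous_comp; [exact: cf|exact: sqrt_continuous].
Qed.

(** With d = F', u = |1 - F^2| and v = |1 - lam^2 F^2|, the left side is, up to sign, the derivative
    of the arc function at lam F, and S is the bound coming from the speed. *)
Lemma sqrt_quotient_le (d S u v lam : R) : d ^+ 2 <= S ^+ 2 * u -> 0 <= S -> 0 <= u ->
  0 < v -> lam ^+ 2 * u <= v -> lam * d / Num.sqrt v <= S.
Proof.
move=> dS S0 u0 v0 luv; rewrite ler_pdivrMr ?sqrtr_gt0//.
apply: le_trans (ler_norm _) _; rewrite -sqrtr_sqr.
rewrite -[X in _ <= X * _](ger0_norm S0) -sqrtr_sqr -sqrtrM ?sqr_ge0//.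
apply: ler_wsqrtr; rewrite exprMn (le_trans (ler_wpM2l (sqr_ge0 lam) dS))//.
by rewrite mulrCA ler_wpM2l ?sqr_ge0.
Qed.

(* Comparison with the arc-cosine; the factor [cos eta] keeps the argument inside
   the open interval where it is differentiable. *)
Lemma acos_comparison (F dF s : R -> R) (alpha eta : R) :
  (forall t : R^o, is_derive t 1 F (dF t)) -> continuous dF -> continuous s ->
  (forall t, 0 <= s t) -> (forall t, F t ^+ 2 <= 1) ->
  (forall t, dF t ^+ 2 <= s t ^+ 2 * (1 - F t ^+ 2)) ->
  F 0 = 1 -> F 1 = cos alpha -> 0 <= alpha <= pi -> 0 < eta < pi / 2 ->
  ((alpha - 2 * eta)%:E <= \int[lebesgue_measure]_(t in `[0%R, 1%R]) (s t)%:E)%E.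
Proof.
move=> FD cdF cs s0 F1 dFs F0 Fa /andP[alpha0 alphapi] /andP[eta0 etapi].
pose lam := cos eta; pose a t := acos (lam * F t).
pose da t := - (Num.sqrt (1 - (lam * F t) ^+ 2))^-1 * (lam * dF t).
have pi0 : 0 < pi :> R := pi_gt0 R.
have lam0 : 0 < lam by apply: cos_gt0_pihalf; lra.
have lam1 : lam < 1.
  by rewrite -(cos0 R) /lam ltr_cos// in_itv /=; lra.
have lam2 : lam ^+ 2 < 1 by rewrite expr_lt1// ltW.
have pos t : 0 < 1 - (lam * F t) ^+ 2.
  rewrite exprMn subr_gt0; apply: le_lt_trans lam2.
  by rewrite ler_piMr ?sqr_ge0.
have inn t : -1 < lam * F t < 1.
  by rewrite -ltr_norml -(@ltr_pXn2r _ 2) ?nnegrE// expr1n real_normK ?num_real// -subr_gt0.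
have lin (t : R^o) : is_derive t 1 (fun t => lam * F t) (lam * dF t).
  exact: is_deriveZ.
have aD (t : R^o) : is_derive t 1 a (da t).
  have h := @is_derive1_comp R acos (fun t => lam * F t) t _ _ (is_derive1_acos (inn t)) (lin t). exact: h.
have cF := is_derive_continuous FD.
have cda : continuous da.
  move=> t; apply: cvgM; last by apply: cvgM; [exact: cvg_cst|exact: cdF].
  apply: cvgN; apply: (@continuous_inv_sqrt (fun t => 1 - (lam * F t) ^+ 2)) => // {}t.
  apply: cvgB; first exact: cvg_cst.
  by apply: cvgM; (apply: cvgM; [exact: cvg_cst|exact: cF]).
apply: (le_trans _ (integral_lower_bound aD cda cs _)); last first.
  move=> t _; rewrite /da mulrC mulrN -mulNr -mulrN.
  apply: (@sqrt_quotient_le (- dF t) (s t) (1 - F t ^+ 2)) => //.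
  - by rewrite sqrrN.
  - by rewrite subr_ge0.
  - by rewrite exprMn mulrBr mulr1 lerB// ltW.
rewrite lee_fin /a F0 Fa mulr1 /lam cosK; last by rewrite in_itv /=; lra.
(* The arc-cosine starts at eta and ends at least at alpha - eta, because cos(alpha - eta) >= cos
   eta cos alpha. *)
suff : alpha - eta <= acos (cos eta * cos alpha) by lra.
have [ae|ea] := ltP alpha eta.
  apply: le_trans (acos_ge0 _); first lra.
  by have := inn 1; rewrite Fa /lam => /andP[/ltW -> /ltW ->].
have h : acos (cos (alpha - eta)) <= acos (cos eta * cos alpha).
  have bnd := inn 1; rewrite Fa -/lam in bnd.
  have [/ltW b1 /ltW b2] := andP bnd.
  rewrite leNgt -ltr_cos ?in_itv /= ?acos_ge0 ?acos_lepi ?cos_geN1 ?cos_le1 ?b1//.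
  rewrite -leNgt !acosK ?in_itv /= ?cos_geN1 ?cos_le1 ?b1// cosB [lam * _]mulrC lerDl.
  by rewrite mulr_ge0// sin_ge0_pi//; lra.
by apply: le_trans h; rewrite cosK// in_itv /=; lra.
Qed.

(** The hyperbolic counterpart, with arcosh y = ln(y + sqrt(y^2 - 1)). The factor cosh eta > 1 keeps
    the argument above 1, and costs eta at the starting point only. *)
Lemma arcosh_comparison (F dF s : R -> R) (alpha eta : R) :
  (forall t : R^o, is_derive t 1 F (dF t)) -> continuous dF -> continuous s ->
  (forall t, 0 <= s t) -> (forall t, 1 <= F t) ->
  (forall t, dF t ^+ 2 <= s t ^+ 2 * (F t ^+ 2 - 1)) ->
  F 0 = 1 -> F 1 = csn (-1) alpha -> 0 <= alpha -> 0 < eta ->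
  ((alpha - eta)%:E <= \int[lebesgue_measure]_(t in `[0%R, 1%R]) (s t)%:E)%E.
Proof.
move=> FD cdF cs s0 F1 dFs F0 Fa alpha0 eta0.
have hN : (-1 : R) = 1 \/ (-1 : R) = -1 by right.
have csnE (t : R) : csn (-1) t = (expR t + expR (- t)) / 2 by rewrite /csn N1_neq1.
have ssnE (t : R) : ssn (-1) t = (expR t - expR (- t)) / 2 by rewrite /ssn N1_neq1.
have ch2 (t : R) : csn (-1) t ^+ 2 - 1 = ssn (-1) t ^+ 2.
  by have := csn2_ssn2 hN t; rewrite mulN1r; lra.
have ssn_gt0 (t : R) : 0 < t -> 0 < ssn (-1) t.
  by move=> t0; rewrite ssnE divr_gt0// subr_gt0 ltr_expR; lra.
have ssn_ge0 (t : R) : 0 <= t -> 0 <= ssn (-1) t.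
  by move=> t0; rewrite ssnE divr_ge0// subr_ge0 ler_expR; lra.
have expE (t : R) : csn (-1) t + ssn (-1) t = expR t by rewrite csnE ssnE; field.
pose lam := csn (-1) eta.
have lam0 : 0 < lam by rewrite /lam csnE divr_gt0// addr_gt0// expR_gt0.
have lam2 : 1 < lam ^+ 2 by rewrite -subr_gt0 ch2 exprn_gt0// ssn_gt0.
have lam1 : 1 < lam by rewrite -(@ltr_pXn2r _ 2) ?nnegrE ?expr1n// ltW.
pose G t := lam * F t.
pose W t := Num.sqrt (G t ^+ 2 - 1); pose a t := ln (G t + W t).
pose da t := (lam * dF t) * (W t)^-1.
have G1 t : 1 < G t by rewrite (lt_le_trans lam1)// /G ler_peMr// ltW.
have pos t : 0 < G t ^+ 2 - 1 by rewrite subr_gt0 expr_gt1// (le_trans ler01)// ltW.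
have W0 t : 0 < W t by rewrite sqrtr_gt0.
have lin (t : R^o) : is_derive t 1 G (lam * dF t) by exact: is_deriveZ.
have aD (t : R^o) : is_derive t 1 a (da t).
  have h1 : is_derive t 1 (fun t => G t ^+ 2 - 1) (2 * G t * (lam * dF t)).
    have h := is_deriveB (is_deriveX 2 (lin t)) (is_derive_cst (1 : R) t 1).
    by apply: (is_derive_eq h); rewrite subr0 expr1.
  have h2 : is_derive t 1 W ((2 * W t)^-1 * (2 * G t * (lam * dF t))).
    have h := @is_derive1_comp R Num.sqrt (fun t => G t ^+ 2 - 1) t _ _
      (is_derive1_sqrt (pos t)) h1.
    exact: h.
  have h3 := is_deriveD (lin t) h2.
  have GW : 0 < (G + W) t by rewrite addr_gt0// (lt_trans ltr01).
  have h := @is_derive1_comp R _ (G + W) t _ _ (is_derive1_ln GW) h3.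
  apply: (is_derive_eq h).
  have GW' : G t + W t != 0 := lt0r_neq0 GW.
  by rewrite /da -[(G + W) t]/(G t + W t); field; rewrite GW' gt_eqF.
have cF := is_derive_continuous FD; have cG := is_derive_continuous lin.
have cda : continuous da.
  move=> t; apply: cvgM; first by apply: cvgM; [exact: cvg_cst|exact: cdF].
  apply: (@continuous_inv_sqrt (fun t => G t ^+ 2 - 1)) => // {}t.
  by apply: cvgB; [apply: cvgM; exact: cG|exact: cvg_cst].
apply: (le_trans _ (integral_lower_bound aD cda cs _)); last first.
  move=> t _; apply: (@sqrt_quotient_le (dF t) (s t) (F t ^+ 2 - 1)) => //.
  - by rewrite subr_ge0 expr_ge1// (le_trans ler01).
  - by rewrite /G exprMn mulrBr mulr1 lerB// ltW.
rewrite lee_fin /a.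
have -> : G 0 + W 0 = expR eta.
  by rewrite /W /G F0 mulr1 ch2 sqrtr_sqr ger0_norm ?ssn_ge0 ?expE// ltW.
rewrite expRK lerB//.
have le : expR alpha <= G 1 + W 1.
  rewrite -expE; apply: lerD.
    by rewrite /G Fa ler_peMl ?ltW// -?Fa ?(lt_le_trans ltr01).
  rewrite -[leLHS]ger0_norm ?ssn_ge0// -sqrtr_sqr -ch2; apply: ler_wsqrtr.
  by rewrite lerB// /G Fa exprMn ler_peMl ?sqr_ge0 ?ltW.
by rewrite -[leLHS]expRK ler_ln// ?posrE ?expR_gt0 ?(lt_le_trans (expR_gt0 _) le).
Qed.

End IntegralComparison.

(** * The Riemannian distance of the ambient space *)

Section Distance.
Variables (R : realType) (m : nat) (c : R).
Local Notation C := R[i].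
Local Notation Re := complex.Re.
Local Notation Im := complex.Im.
Local Notation CV := 'cV[C]_m.+1.
Local Notation P := (@Psi R m c).
Local Notation cc := (c%:C)%C.
Local Notation CQ := (CQ R m c).
Local Notation HQ := (hyperquadric R m c).
Implicit Types (z w : HQ) (g : R -> HQ).

Hypothesis hc : c = 1 \/ c = -1.
Let hc2 : c ^+ 2 = 1. Proof. exact: hcsqr. Qed.

Lemma is_cderive_Psi (v w : R -> CV) (t : R^o) (dv dw : CV) :
  (forall i, is_cderive t 1 (fun s => v s i 0) (dv i 0)) ->
  (forall i, is_cderive t 1 (fun s => w s i 0) (dw i 0)) ->
  is_cderive t 1 (fun s => P (v s) (w s)) (P dv (w t) + P (v t) dw).
Proof.
move=> vD wD; rewrite !PsiE -big_split.
rewrite (_ : (fun s => _) = fun s => \sum_j (sgnP c j * (v s j 0)^* * w s j 0)); last first.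
  by apply/funext => s; rewrite PsiE.
apply: is_cderive_sum => j /=.
have := is_cderiveM (is_cderiveM (is_cderive_cst t 1 (sgnP c j)) (is_cderive_conj (vD j))) (wD j).
by rewrite mul0r add0r.
Qed.

Lemma is_derive_sqnorm (f : R -> C) (t : R^o) (df : C) : is_cderive t 1 f df ->
  is_derive t 1 (fun s => sqnorm (f s)) (2 * Re ((f t)^* * df)).
Proof.
move=> [f1 f2]; have h := is_deriveD (is_deriveX 2 f1) (is_deriveX 2 f2).
apply: (is_derive_eq h); rewrite /GRing.scale /= !expr1.
by case: (f t) df {f1 f2 h} => a b [d e] /=; ring.
Qed.

Lemma speed_sqr_ge0 g t : 0 <= speed_sqr g t.
Proof.
apply: (Psi_horizontal_ge0 hc (val_Psi (g t))).
by apply: Psi_horizontal => //; exact: val_Psi.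
Qed.

Lemma velocity_tangent g t : C1_curve g ->
  P (val (g t)) (velocity g t) + (P (val (g t)) (velocity g t))^* = 0.
Proof.
move=> Cg; have D i := @curve_cderive R m c g i t Cg.
have [d1 d2] := is_cderive_Psi D D.
have E : (fun s => P (val (g s)) (val (g s))) = fun=> cc by apply/funext => s; exact: val_Psi.
rewrite -Psi_conj addrC; apply: complex_eq.
  have : is_derive (t : R^o) 1 (fun s => Re (P (val (g s)) (val (g s)))) (0 : R).
    rewrite (_ : (fun s => _) = fun=> c); first exact: is_derive_cst.
    by apply/funext => s; rewrite val_Psi.
  by move=> d0; rewrite -(@derive_val _ _ _ _ _ _ _ d1) (@derive_val _ _ _ _ _ _ _ d0).
have : is_derive (t : R^o) 1 (fun s => Im (P (val (g s)) (val (g s)))) (0 : R).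
  rewrite (_ : (fun s => _) = fun=> 0); first exact: is_derive_cst.
  by apply/funext => s; rewrite val_Psi.
by move=> d0; rewrite -(@derive_val _ _ _ _ _ _ _ d2) (@derive_val _ _ _ _ _ _ _ d0).
Qed.

(** The function [csn] of twice the distance to z, by [csn_double]. The squared modulus makes it
    differentiable also where Psi vanishes. *)
Definition profile z g t : R := 2 * sqnorm (P (val z) (val (g t))) - 1.

Definition dprofile z g t : R :=
  4 * Re ((P (val z) (val (g t)))^* * P (val z) (velocity g t)).

Lemma is_derive_profile z g (t : R^o) : C1_curve g ->
  is_derive t 1 (profile z g) (dprofile z g t).
Proof.
move=> Cg; have D i := @curve_cderive R m c g i t Cg.
have Z i : is_cderive t 1 (fun=> val z i 0) ((0 : CV) i 0).
  by rewrite mxE; exact: is_cderive_cst.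
have := is_derive_sqnorm (is_cderive_Psi Z D); rewrite Psi0l add0r => h1.
have h := is_deriveB (is_deriveZ 2 h1) (is_derive_cst (1 : R) t 1).
apply: (is_derive_eq h); rewrite subr0 /GRing.scale /= /dprofile.
by rewrite mulrA; congr (_ * _); ring.
Qed.

Lemma dprofile_continuous z g : C1_curve g -> continuous (dprofile z g).
Proof.
move=> Cg t; apply: cvgM; first exact: cvg_cst.
have c1 := ccont_Psi c (@vcont_cst R R m (val z)) (C1_curve_vcont Cg).
have c2 := ccont_Psi c (@vcont_cst R R m (val z)) (velocity_vcont Cg).
by have [h _] := ccontM (ccont_conj c1) c2 t; exact: h.
Qed.

Lemma Psi_complement (x y : CV) : P x x = cc -> P y y = cc ->
  Re (P (horizontal c y x) (horizontal c y x)) = c * (1 - sqnorm (P x y)).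
Proof.
move=> xx yy; rewrite -[LHS]/(submersion_metric c y x x) submersion_metricE// xx.
by rewrite (Psi_conj c x y) sqnorm_conj mulrBr mulr1.
Qed.

Lemma sqnorm_Psi_le z w : 0 <= c * (1 - sqnorm (P (val z) (val w))).
Proof.
rewrite -Psi_complement ?val_Psi//; apply: (Psi_horizontal_ge0 hc (val_Psi w)).
by apply: Psi_horizontal => //; exact: val_Psi.
Qed.

(** A vertical velocity only changes the phase, so the derivative sees the horizontal part h alone.
    Cauchy-Schwarz on the horizontal space at the moving point bounds |Psi(z,h)|^2 by c(1 -
    |Psi(z,y)|^2) times the squared speed. *)
Lemma dprofile_le z g t : C1_curve g ->
  dprofile z g t ^+ 2 <= (2 * Num.sqrt (speed_sqr g t)) ^+ 2 * (c * (1 - profile z g t ^+ 2)).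
Proof.
move=> Cg; rewrite [(2 * _) ^+ 2]exprMn sqr_sqrtr ?speed_sqr_ge0//.
have tan := velocity_tangent t Cg; have zz := val_Psi z; have yy := val_Psi (g t).
have le := sqnorm_Psi_le z (g t).
pose y := val (g t); pose v := velocity g t; pose h := horizontal c y v.
have yh : P y h = 0 by exact: Psi_horizontal.
have yz : P y (horizontal c y (val z)) = 0 by exact: Psi_horizontal.
have cs := Psi_horizontal_cs hc yy yz yh.
rewrite (Psi_complement zz yy) -[Re (P h h)]/(speed_sqr g t) in cs.
have zh : P (horizontal c y (val z)) h = P (val z) h.
  by rewrite {1}/horizontal PsiBl PsiZl yh mulr0 subr0.
rewrite zh in cs.
have vE : P (val z) v = P (val z) h + cc * P y v * P (val z) y.
  by rewrite /h /horizontal PsiBr PsiZr subrK.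
have dE : dprofile z g t = 4 * Re ((P (val z) y)^* * P (val z) h).
  rewrite /dprofile -/y -/v vE; congr (_ * _).
  have := tan; rewrite -/y -/v; move: (P y v) (P (val z) y) (P (val z) h) => [a b] [d e] [f k].
  move=> /(congr1 (@complex.Re R)) /= a0; have {a0}-> : a = 0 by lra.
  by ring.
have cs2 : (Re ((P (val z) y)^* * P (val z) h)) ^+ 2 <= sqnorm (P (val z) y) * sqnorm (P (val z) h).
  rewrite -(sqnorm_conj (P (val z) y)) -sqnormM /sqnorm lerDl; exact: sqr_ge0.
rewrite dE [(4 * _) ^+ 2]exprMn /profile -/y in cs le *.
have f0 := sqnorm_ge0 (P (val z) y); have s0 := speed_sqr_ge0 g t.
move: (sqnorm (P (val z) y)) (sqnorm (P (val z) h)) (speed_sqr g t) (Re _) cs cs2 le f0 s0.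
move=> f q s r cs cs2 le f0 s0.
have -> : 2 ^+ 2 * s * (c * (1 - (2 * f - 1) ^+ 2)) = 4 ^+ 2 * (f * (c * (1 - f) * s)) by ring.
apply: ler_wpM2l; first exact: sqr_ge0.
by apply: le_trans cs2 _; exact: ler_wpM2l.
Qed.


Lemma csn_double (t : R) : csn c (2 * t) = 2 * csn c t ^+ 2 - 1.
Proof.
rewrite /csn; case: ifP => _; first by rewrite mulr_natl cos_mulr2n mulr_natl.
have e (x : R) : expR (2 * x) = expR x * expR x by rewrite -expRD; congr expR; ring.
rewrite -mulrN !e; have := expRxMexpNx_1 t.
move: (expR t) (expR (- t)) => x y xy.
transitivity ((x * x + y * y) / 2 + (x * y - 1)); first by rewrite xy subrr addr0.
by field.
Qed.

(** The range of the distance function: for c = 1 the diameter is pi/2. *)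
Definition admissible_distance (rho : R) := 0 <= rho /\ (c = 1 -> rho <= pi / 2).

Lemma curve_length_double g : C1_curve g ->
  (\int[lebesgue_measure]_(t in `[0%R, 1%R]) (2 * Num.sqrt (speed_sqr g t))%:E =
   2%:E * curve_length g)%E.
Proof.
move=> Cg; rewrite curve_lengthE -ge0_integralZl_EFin//=.
apply/measurable_realfun.measurable_EFinP; apply: continuous_measurableR => //.
exact: speed_continuous.
Qed.

(** The profile runs from 1 to csn(2 rho) and is controlled by twice the speed, so the comparison
    lemmas give 2 rho <= 2 length up to an arbitrary e. *)
Lemma curve_length_ge g z w rho : C1_curve g -> proj (g 0) = proj z ->
  proj (g 1) = proj w -> admissible_distance rho ->
  sqnorm (P (val z) (val w)) = csn c rho ^+ 2 -> (rho%:E <= curve_length g)%E.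
Proof.
move=> Cg /projP[u u1 g0] /projP[u' u'1 g1] [rho0 rhopi] zw.
have phase (v : C) (x y : CV) : v * v^* = 1 -> y = v *: x ->
    sqnorm (P (val z) x) = sqnorm (P (val z) y).
  rewrite sqnormE => /(congr1 (@complex.Re R)) /= v1 ->.
  by rewrite PsiZr sqnormM v1 mul1r.
have F0 : profile z g 0 = 1.
  by rewrite /profile (phase u _ _ u1 g0) val_Psi sqnorm_real hc2 mulr1 [2]mulr2n addrK.
have F1 : profile z g 1 = csn c (2 * rho).
  by rewrite csn_double -zw /profile (phase u' _ _ u'1 g1).
pose s t := 2 * Num.sqrt (speed_sqr g t).
have cs : continuous s.
  by move=> t; apply: cvgM; [exact: cvg_cst|exact: speed_continuous].
have s0 t : 0 <= s t by rewrite mulr_ge0// sqrtr_ge0.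
have FD t := is_derive_profile z t Cg.
have cdF := dprofile_continuous (z := z) Cg.
have dF t := dprofile_le z t Cg.
have bnd t : 0 <= c * (1 - sqnorm (P (val z) (val (g t)))) by exact: sqnorm_Psi_le.
have small e : 0 < e -> (((2 * rho - e)%:E) <= 2%:E * curve_length g)%E.
  rewrite -curve_length_double// => e0; case: hc => cE.
  (* The comparison loses 2 eta <= e, and requires eta < pi/2. *)
  - pose eta := Num.min (e / 2) (pi / 4).
    have pi0 : 0 < pi :> R := pi_gt0 R.
    have [ee ep] : eta <= e / 2 /\ eta <= pi / 4 by rewrite /eta !ge_min !lexx orbT.
    have eta0 : 0 < eta by rewrite /eta lt_min !divr_gt0.
    apply: le_trans (acos_comparison (F := profile z g) (alpha := 2 * rho) (eta := eta) FD cdF cs s0 _ _ F0 _ _ _).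
    + by rewrite lee_fin; lra.
    + move=> t; have := bnd t; rewrite /profile; have := sqnorm_ge0 (P (val z) (val (g t))).
      move: (sqnorm _) => f f0; rewrite cE mul1r => f1; rewrite -subr_ge0.
      by rewrite (_ : _ - _ = 4 * (f * (1 - f))) ?mulr_ge0//; ring.
    + by move=> t; have := dF t; rewrite -/(s t); move: (s t) (dprofile _ _ _) (1 - _) => f1 f2 f3; rewrite cE mul1r.
    + by rewrite F1 /csn cE eqxx.
    + by have := rhopi cE; lra.
    + lra.
  - apply: (arcosh_comparison (F := profile z g) FD cdF cs s0 _ _ F0 _ _ e0).
    + by move=> t; have := bnd t; rewrite /profile; move: (sqnorm _) => f; rewrite cE; lra.
    + by move=> t; have := dF t; rewrite -/(s t) -[_ - 1]opprB; move: (s t) (dprofile _ _ _) (1 - _) => f1 f2 f3; rewrite cE mulN1r.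
    + by rewrite F1 cE.
    + by rewrite mulr_ge0.
have L0 : (0%:E <= curve_length g)%E.
  by apply: integral_ge0 => t _; rewrite lee_fin sqrtr_ge0.
apply/lee_subgt0Pr => e e0; have := small (2 * e); rewrite mulr_gt0// => /(_ isT).
by case: (curve_length g) L0 => [l| |]// _; rewrite -?EFinM -?EFinB ?lee_fin ?leey//; lra.
Qed.

(** Lifts of one point differ by a phase, so Psi(b, .) takes on them every value of the given
    modulus. *)
Lemma rephase (b : CV) z (t : C) : sqnorm t = sqnorm (P b (val z)) ->
  exists2 w : HQ, proj w = proj z & P b (val w) = t.
Proof.
move=> tz; have [b0|bn0] := eqVneq (sqnorm (P b (val z))) 0.
  exists z => //; rewrite b0 in tz; move/eqP: b0; rewrite sqnorm_eq0 => /eqP ->.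
  by apply/esym/eqP; rewrite -sqnorm_eq0 tz.
pose v := (((sqnorm (P b (val z)))^-1)%:C)%C * (t * (P b (val z))^*).
have sv : sqnorm v = 1 by rewrite !sqnormM sqnorm_real sqnorm_conj tz; field.
have ww : P (v *: val z) (v *: val z) == cc by rewrite PsiZZ sv mul1r val_Psi.
pose w : HQ := exist _ (v *: val z) ww; have wE : val w = v *: val z by [].
exists w; first by apply/esym/projP; exists v => //; rewrite sqnormE sv.
rewrite wE PsiZr /v -mulrA -[_ * _ * P b (val z)]mulrA [_^* * _]mulrC sqnormE mulrCA.
by rewrite -rmorphM mulVf// mulr1.
Qed.

Lemma dist_self (M : set CQ) z : M (proj z) -> (riemannian_dist M (proj z) (proj z) <= 0%:E)%E.
Proof.
move=> Mz; have D0 (t : R^o) : is_derive t 1 (fun=> 0 : R) ((fun=> 0) t : R) by exact: is_derive_cst.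
have cz : continuous (fun _ : R => 0 : R) by exact: cst_continuous.
have ww (t : R) : P (val z + (((0 : R)%:C)%C *: 0 + ((0 : R)%:C)%C *: 0))
    (val z + (((0 : R)%:C)%C *: 0 + ((0 : R)%:C)%C *: 0)) = cc.
  by rewrite !scaler0 !addr0 val_Psi.
have [g [Cg gE vE]] := affine_curve D0 D0 cz cz ww.
have gz t : g t = z by apply: val_inj; rewrite gE !scaler0 !addr0.
apply: (joins_dist (g := g)); first by split=> // [||t _]; rewrite gz.
apply: curve_length_le => // t _; rewrite /speed_sqr vE !scaler0 addr0.
by rewrite /submersion_metric /horizontal Psi0r mulr0 scale0r subrr Psi0l expr0n.
Qed.

(** After rephasing, Psi(z,w') = c csn rho, so that w' = csn(rho) z + ssn(rho) y with y a unit
    vector orthogonal to z. The circle through z and w' has length at most rho. *)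
Lemma dist_le z w rho : 0 <= rho -> 0 <= csn c rho ->
  sqnorm (P (val z) (val w)) = csn c rho ^+ 2 ->
  (riemannian_dist setT (proj z) (proj w) <= rho%:E)%E.
Proof.
move=> rho0 C0 zw; have [w' <- zw'] : exists2 w', proj w' = proj w & P (val z) (val w') = ((c * csn c rho)%:C)%C.
  by apply: rephase; rewrite sqnorm_real exprMn hc2 mul1r.
pose d : CV := val w' - ((csn c rho)%:C)%C *: val z.
have zd : P (val z) d = 0.
  by rewrite PsiBr PsiZr zw' val_Psi -rmorphM mulrC subrr.
have cs := csn2_ssn2 hc rho.
have dd : Re (P d d) = ssn c rho ^+ 2.
  have dE : val w' = ((csn c rho)%:C)%C *: val z + d by rewrite addrC subrK.
  have := congr1 (@complex.Re R) (val_Psi w'); rewrite {1 2}dE Re_PsiD_orth; last by rewrite PsiZl zd mulr0.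
  rewrite PsiZZ sqnorm_real val_Psi -rmorphM /= => e.
  have -> : Re (P d d) = c - csn c rho ^+ 2 * c by move: e; move: (Re (P d d)) => x e; lra.
  transitivity (c * (csn c rho ^+ 2 + c * ssn c rho ^+ 2) - csn c rho ^+ 2 * c); first by rewrite cs mulr1.
  transitivity (c ^+ 2 * ssn c rho ^+ 2); first by ring.
  by rewrite hc2 mul1r.
(* When ssn rho = 0 the vector d cannot be normalized, but then the two points coincide. *)
have [S0|S0] := eqVneq (ssn c rho) 0.
  have d0 : d = 0.
    by apply: (Psi_horizontal_le0 hc (val_Psi z) zd); rewrite dd S0 expr0n.
  have C1 : csn c rho = 1.
    move: cs; rewrite S0 expr0n mulr0 addr0 => /eqP; rewrite sqrf_eq1 => /orP[/eqP//|/eqP CN].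
    by move: C0; rewrite CN; lra.
  have -> : proj w' = proj z.
    by congr proj; apply: val_inj; apply/eqP; rewrite -subr_eq0 -[X in _ - X]scale1r -(rmorph1 (real_complex R)) -C1 -/d d0.
  by apply: le_trans (@dist_self setT z I) _; rewrite lee_fin.
have yy : Re (P (((ssn c rho)^-1%:C)%C *: d) (((ssn c rho)^-1%:C)%C *: d)) = 1.
  by rewrite PsiZZ sqnorm_real ReM_real dd exprVn mulVf// expf_neq0.
have zy : P (val z) (((ssn c rho)^-1%:C)%C *: d) = 0 by rewrite PsiZr zd mulr0.
have [g [Cg gE gl]] : exists g : R -> HQ, [/\ C1_curve g,
  forall t, val (g t) = 0 + (((csn c (rho * t))%:C)%C *: val z +
    ((ssn c (rho * t))%:C)%C *: (((ssn c rho)^-1%:C)%C *: d))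
  & (curve_length g <= (rho * Num.sqrt 1)%:E)%E].
  apply: circle_curve => //.
  - exact: Psi0l.
  - exact: Psi0l.
  - by rewrite Psi0l subrr mulr0.
  - by rewrite val_Psi mulr1.
  - by rewrite zy.
  - by right.
rewrite sqrtr1 mulr1 in gl.
apply: (joins_dist (g := g)) gl; split=> //.
  congr proj; apply: val_inj; rewrite gE mulr0 csn0 ssn0 rmorph1 rmorph0.
  by rewrite scale1r scale0r add0r addr0.
congr proj; apply: val_inj; rewrite gE mulr1 add0r scalerA -rmorphM divff// rmorph1.
by rewrite scale1r addrC subrK.
Qed.

Lemma riemannian_distE z w rho : admissible_distance rho -> 
  sqnorm (P (val z) (val w)) = csn c rho ^+ 2 ->
  riemannian_dist setT (proj z) (proj w) = rho%:E.
Proof.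
move=> adm zw; have [rho0 rhopi] := adm; apply/eqP; rewrite eq_le; apply/andP; split.
  apply: dist_le => //; rewrite /csn; case: ifP => [/eqP/rhopi h|_]; last first.
    by rewrite divr_ge0// addr_ge0// expR_ge0.
  by apply: cos_ge0_pihalf; have := pi_gt0 R; lra.
apply: le_ereal_inf_tmp => _ [g [Cg g0 g1 _] <-].
exact: curve_length_ge g0 g1 adm zw.
Qed.

Lemma admissible_distance_exists z w : exists2 rho, admissible_distance rho &
  sqnorm (P (val z) (val w)) = csn c rho ^+ 2.
Proof.
have := sqnorm_Psi_le z w; have := sqnorm_ge0 (P (val z) (val w)).
move: (sqnorm _) => f f0; case: hc => cE; rewrite cE.
  rewrite mul1r subr_ge0 => f1.
  have b : -1 <= Num.sqrt f <= 1.
    have sf1 : Num.sqrt f <= 1 by rewrite -(sqrtr1 R) ler_wsqrtr.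
    by have := sqrtr_ge0 f; lra.
  exists (acos (Num.sqrt f)); last first.
    by rewrite /csn eqxx acosK ?in_itv//= sqr_sqrtr.
  split; first exact: acos_ge0.
  move=> _; rewrite leNgt -ltr_cos ?in_itv /= ?acos_ge0 ?acos_lepi//; last first.
    by have := pi_gt0 R; lra.
  by rewrite acosK ?in_itv//= cos_pihalf -leNgt sqrtr_ge0.
rewrite mulN1r opprB subr_ge0 => f1; pose x := Num.sqrt f; pose y := Num.sqrt (f - 1).
have x2 : x ^+ 2 = f by rewrite sqr_sqrtr.
have y2 : y ^+ 2 = f - 1 by rewrite sqr_sqrtr// subr_ge0.
have x1 : 1 <= x by rewrite -(sqrtr1 R) ler_wsqrtr.
have y0 : 0 <= y by exact: sqrtr_ge0.
have xy0 : 0 < x + y by lra.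
exists (ln (x + y)).
  split; first by rewrite ln_ge0//; lra.
  by move=> h; lra.
rewrite /csn N1_neq1 expRN lnK ?posrE// (_ : (x + y)^-1 = x - y); last first.
  apply: (mulfI (lt0r_neq0 xy0)); rewrite mulfV ?lt0r_neq0//.
  by transitivity (x ^+ 2 - y ^+ 2); [rewrite x2 y2; ring|ring].
by rewrite -x2; field.
Qed.

Lemma riemannian_distP z w rho : admissible_distance rho ->
  riemannian_dist setT (proj z) (proj w) = rho%:E <->
  sqnorm (P (val z) (val w)) = csn c rho ^+ 2.
Proof.
move=> adm; split=> [d|]; last exact: riemannian_distE.
have [rho' adm' zw] := admissible_distance_exists z w.
by have := riemannian_distE adm' zw; rewrite d => -[->].
Qed.

End Distance.

(** * Spheres as level sets, and the 2-type criterion *)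

Section Quadrics.
Variables (R : realType) (m : nat) (c : R).
Local Notation C := R[i].
Local Notation Re := complex.Re.
Local Notation Im := complex.Im.
Local Notation CV := 'cV[C]_m.+1.
Local Notation P := (@Psi R m c).
Local Notation cc := (c%:C)%C.
Local Notation CQ := (CQ R m c).
Local Notation HQ := (hyperquadric R m c).
Implicit Types (z w : HQ).

Hypothesis hc : c = 1 \/ c = -1.
Let hc2 : c ^+ 2 = 1. Proof. exact: hcsqr. Qed.

(** Spheres arise with a lifting the centre and eps = c, tubes with a normal to the hyperplane and
    eps = 1. *)
Definition quadric (eps : R) (a : CV) (k : R) : set CQ :=
  [set q | \tr (axis c eps a *m Phi q) = (k%:C)%C].

Lemma mxtrace_axis_proj eps a z : eps ^+ 2 = 1 -> P a a = (eps%:C)%C ->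
  \tr (axis c eps a *m Phi (proj z)) = ((eps * c * sqnorm (P a (val z)))%:C)%C.
Proof.
move=> heps Paa; rewrite mxtrace_axis_Phi axis_mul// PsiZr (Psi_conj c a (val z)).
by rewrite -mulrA sqnormE mulrA -!rmorphM [c * _]mulrC.
Qed.

Lemma quadricE eps a k z : eps ^+ 2 = 1 -> P a a = (eps%:C)%C ->
  quadric eps a k (proj z) <-> eps * c * sqnorm (P a (val z)) = k.
Proof.
move=> heps Paa; rewrite /quadric /= mxtrace_axis_proj//; split=> [|->//].
by move/(congr1 (@complex.Re R)).
Qed.

Lemma geodesic_hypersphereE z r : admissible_distance c r ->
  geodesic_hypersphere (proj z) r = quadric c (val z) (csn c r ^+ 2).
Proof.
move=> adm; apply/seteqP; split=> q; have [w ->] := proj_surj q.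
  move=> /(riemannian_distP hc _ _ adm) zw; apply/quadricE => //; first exact: val_Psi.
  by rewrite -expr2 hc2 mul1r.
move/quadricE => /(_ hc2 (val_Psi z)); rewrite -expr2 hc2 mul1r => zw.
exact/(riemannian_distP hc _ _ adm).
Qed.

Lemma quadric_finite_type eps a k M : (2 <= m)%N -> eps ^+ 2 = 1 -> P a a = (eps%:C)%C ->
  k != 0 -> 1 - k != 0 -> open_portion M (quadric eps a k) ->
  cross_eigenvalue m c k != orth_eigenvalue m c k ->
  finite_type M 2.
Proof.
move=> hm heps Paa k0 k1 [Mne MQ Mo].
exact: (hypersurface_finite_type hm hc k0 k1 (axisK hc2 heps Paa) (axis_hadj hc2 eps a)
  (axis_tr hc2 heps Paa) (axis_corner hc2 eps a) (axis_mul hc2 eps a)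
  (fun p => MQ p) Mo Mne).
Qed.

(** Clearing denominators leaves (2m - 2)k + 1 = 4mk. *)
Lemma eigenvalue_eq k : (2 <= m)%N -> k != 0 -> 1 - k != 0 ->
  cross_eigenvalue m c k = orth_eigenvalue m c k -> k = (2 * m%:R + 2)^-1.
Proof.
move=> hm k0 k1; have c0 : c != 0 by case: hc => ->; rewrite ?oppr_eq0 oner_eq0.
have m0 : 0 < m%:R :> R by rewrite ltr0n (leq_trans _ hm).
have cc1 : c * c = 1 by rewrite -expr2.
rewrite /cross_eigenvalue /orth_eigenvalue => e.
have {}e : (2 * m%:R - 2) * k + 1 = 4 * m%:R * k.
  apply: (mulfI c0); apply: (mulIf (invr_neq0 (mulf_neq0 k0 k1))).
  by rewrite e; field; rewrite k0 k1.
have n0 : 2 * m%:R + 2 != 0 :> R by rewrite lt0r_neq0//; lra.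
apply: (mulIf n0); rewrite mulVf//; lra.
Qed.

End Quadrics.

(** * Tubes about a complex hyperbolic hyperplane *)

Section HyperbolicTubes.
Variables (R : realType) (m : nat).
Local Notation C := R[i].
Local Notation Re := complex.Re.
Local Notation CV := 'cV[C]_m.+1.
Local Notation P := (@Psi R m (-1)).
Local Notation CQ := (CQ R m (-1)).
Local Notation HQ := (hyperquadric R m (-1)).
Implicit Types (z w : HQ).

Let hc : (-1 : R) = 1 \/ (-1 : R) = -1. Proof. by right. Qed.
Let hc2 : (-1 : R) ^+ 2 = 1. Proof. exact: hcsqr. Qed.

Lemma ssnN1E (t : R) : ssn (-1) t = (expR t - expR (- t)) / 2.
Proof. by rewrite /ssn N1_neq1. Qed.

Lemma csnN1E (t : R) : csn (-1) t = (expR t + expR (- t)) / 2.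
Proof. by rewrite /csn N1_neq1. Qed.

Lemma ltr_ssnN1 (s t : R) : s < t -> ssn (-1) s < ssn (-1) t.
Proof.
move=> st; rewrite !ssnN1E ltr_pM2r ?invr_gt0//.
have h1 : expR s < expR t by rewrite ltr_expR.
have h2 : expR (- t) < expR (- s) by rewrite ltr_expR ltrN2.
lra.
Qed.

Lemma ssnN1_gt0 (t : R) : 0 < t -> 0 < ssn (-1) t.
Proof. by move=> /ltr_ssnN1; rewrite ssn0. Qed.

Lemma csnN1_sqr (t : R) : csn (-1) t ^+ 2 = 1 + ssn (-1) t ^+ 2.
Proof. by have := csn2_ssn2 hc t; rewrite mulN1r; lra. Qed.

Lemma csnN1_gt1 (t : R) : 0 < t -> 1 < csn (-1) t ^+ 2.
Proof. by move=> /ssnN1_gt0 h; rewrite csnN1_sqr ltrDl exprn_gt0. Qed.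

Lemma le_csnN1_sqr (s t : R) : 0 <= t -> csn (-1) s ^+ 2 <= csn (-1) t ^+ 2 -> 0 <= s -> s <= t.
Proof.
move=> t0 st s0; rewrite leNgt; apply/negP => ts.
have ssn_t : 0 <= ssn (-1) t.
  by move: t0; rewrite le_eqVlt => /orP[/eqP<-|/ssnN1_gt0/ltW//]; rewrite ssn0.
move: st; rewrite !csnN1_sqr lerD2l leNgt => /negP; apply.
by rewrite ltr_pXn2r ?nnegrE ?ltr_ssnN1// ltW// (le_lt_trans ssn_t)// ltr_ssnN1.
Qed.

Lemma admissibleN1 (r : R) : 0 <= r -> admissible_distance (-1) r.
Proof. by move=> r0; split=> // h; lra. Qed.

Section Tube.
Variable a : CV.
Hypothesis Paa : P a a = 1.
Local Notation S := (complex_hyperplane a : set CQ).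

Section FootPoint.
Variable z : HQ.
Let u : CV := val z - P a (val z) *: a.
Let b := sqnorm (P a (val z)).

Let au : P a u = 0.
Proof. by rewrite PsiBr PsiZr Paa mulr1 subrr. Qed.

Let uu : Re (P u u) = - (1 + b).
Proof.
have e : val z = P a (val z) *: a + u by rewrite addrC subrK.
have : Re (P (val z) (val z)) = -1 by rewrite val_Psi.
rewrite {1 2}e Re_PsiD_orth; last by rewrite PsiZl au mulr0.
rewrite PsiZZ ReM_real Paa -/b [Re 1]/(1 : R) mulr1; lra.
Qed.

Lemma hyperplane_Psi (s : HQ) : P a (val s) = 0 -> P (val s) (val z) = P (val s) u.
Proof.
by move=> sa; rewrite PsiBr PsiZr (Psi_conj _ a (val s)) sa rmorph0 mulr0 subr0.
Qed.

(** Since s is orthogonal to a, z may be replaced by u, of norm - (1 + b); the horizontal part of u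
    at s has nonnegative norm. *)
Lemma hyperplane_Psi_ge (s : HQ) : P a (val s) = 0 ->
  1 + b <= sqnorm (P (val s) (val z)).
Proof.
move=> sa; rewrite hyperplane_Psi//.
have := Psi_horizontal_ge0 hc (val_Psi s) (Psi_horizontal u hc2 (val_Psi s)).
rewrite -[Re _]/(submersion_metric _ (val s) u u) (submersion_metricE hc u (val_Psi s)).
by rewrite uu; lra.
Qed.

(** Equality holds at the normalized orthogonal projection of z to the hyperplane. *)
Lemma foot_point : exists2 s : HQ, P a (val s) = 0 & sqnorm (P (val s) (val z)) = 1 + b.
Proof.
have b0 : 0 <= b := sqnorm_ge0 _.
have b1 : 0 < 1 + b by lra.
pose d := Num.sqrt (1 + b); have d2 : d ^+ 2 = 1 + b by rewrite sqr_sqrtr ?ltW.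
have d0 : d != 0 by rewrite gt_eqF// sqrtr_gt0.
have su : P (((d^-1)%:C)%C *: u) (((d^-1)%:C)%C *: u) == ((-1)%:C)%C.
  rewrite PsiZZ sqnorm_real (Psi_self _ u) uu -rmorphM exprVn d2.
  by rewrite mulrN mulVf// gt_eqF.
pose s : HQ := exist _ (((d^-1)%:C)%C *: u) su.
have sE : val s = ((d^-1)%:C)%C *: u by [].
have sa : P a (val s) = 0 by rewrite sE PsiZr au mulr0.
exists s => //; rewrite hyperplane_Psi// sE PsiZl (Psi_self _ u) uu conj_real -rmorphM.
by rewrite sqnorm_real -d2; field.
Qed.

End FootPoint.

(** The distance rho from [z] to the hyperplane is attained at the foot point, where cosh^2 rho = 1
    + |Psi(a,z)|^2; hence |Psi(a,z)|^2 = sinh^2 r on the tube. *)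
Lemma tubeE r : 0 < r -> tube S r = quadric 1 a (- ssn (-1) r ^+ 2).
Proof.
move=> r0; have adm := admissibleN1 (ltW r0).
have key z : tube S r (proj z) <-> sqnorm (P a (val z)) = ssn (-1) r ^+ 2.
  have [s0 s0a s0z] := foot_point z.
  have [rho [rho0 _] s0rho] := admissible_distance_exists hc s0 z.
  have inf : ereal_inf [set riemannian_dist setT p (proj z) | p in S] = rho%:E.
    apply/eqP; rewrite eq_le; apply/andP; split.
      apply: ereal_inf_lbound; exists (proj s0); first by exists s0.
      exact/(riemannian_distP hc _ _ (admissibleN1 rho0)).
    apply: le_ereal_inf_tmp => _ [_ [s sa <-] <-].
    have [rho' [rho'0 _] srho] := admissible_distance_exists hc s z.
    have -> : riemannian_dist setT (proj s) (proj z) = rho'%:E.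
      exact/(riemannian_distP hc _ _ (admissibleN1 rho'0)).
    rewrite lee_fin; apply: le_csnN1_sqr => //.
    by rewrite -s0rho -srho s0z; exact: hyperplane_Psi_ge.
  rewrite /tube /= inf; split.
    by move=> [rE]; move: s0rho; rewrite s0z rE csnN1_sqr => /addrI.
  move=> e; congr EFin; apply/eqP; rewrite eq_le.
  have e2 : csn (-1) rho ^+ 2 = csn (-1) r ^+ 2 by rewrite -s0rho s0z e csnN1_sqr.
  have eqW (x y : R) : x = y -> x <= y by move->.
  have r0' := ltW r0; apply/andP; split.
    exact: (le_csnN1_sqr r0' (eqW _ _ e2) rho0).
  exact: (le_csnN1_sqr rho0 (eqW _ _ (esym e2)) r0').
apply/seteqP; split=> q; have [z ->] := proj_surj q.
  by move=> /key e; apply/(quadricE hc _ _ (expr1n _ 2) Paa); rewrite e; ring.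
by move=> /(quadricE hc _ _ (expr1n _ 2) Paa) e; apply/key; lra.
Qed.

End Tube.

Lemma CH_hyperplane_normalize (S : set CQ) : is_CH_hyperplane S ->
  exists2 a : CV, P a a = 1 & S = complex_hyperplane a.
Proof.
move=> [w w0 ->]; pose d := Num.sqrt (Re (P w w)).
have d0 : 0 < d by rewrite sqrtr_gt0.
have d2 : d ^+ 2 = Re (P w w) by rewrite sqr_sqrtr// ltW.
exists (((d^-1)%:C)%C *: w).
  rewrite PsiZZ sqnorm_real (Psi_self _ w) -rmorphM -d2 exprVn mulVf ?rmorph1//.
  by rewrite expf_neq0// gt_eqF.
apply/seteqP; split=> _ [z zw <-]; exists z => //=; move: zw => /=; rewrite PsiZl.
  by move=> ->; rewrite mulr0.
move/eqP; rewrite mulf_eq0 => /orP[|/eqP//].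
by rewrite conj_real fmorph_eq0 invr_eq0 gt_eqF.
Qed.

End HyperbolicTubes.

(** * Radii expressed by the inverse cotangent *)

Section Cotangent.
Variable R : realType.
Implicit Types (r x : R).

Lemma cos_acot_sqr x : cos (acot x) ^+ 2 = x ^+ 2 / (1 + x ^+ 2).
Proof.
have e : cos (acot x) = sin (atan x).
  by rewrite /acot cosB cos_pihalf sin_pihalf mul0r add0r mul1r.
have := cos2Dsin2 (atan x); rewrite e cos_atan exprVn.
have x1 : 0 < 1 + x ^+ 2 by rewrite ltr_pwDl// sqr_ge0.
rewrite sqr_sqrtr ?ltW// => h.
have -> : sin (atan x) ^+ 2 = 1 - (1 + x ^+ 2)^-1 by lra.
by field; rewrite gt_eqF.
Qed.

Lemma acot_gt0_ltpihalf x : 0 < x -> 0 < acot x < pi / 2.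
Proof.
move=> x0; rewrite /acot; have := atan_ltpi2 x.
have : 0 < atan x by rewrite -(atan0 R) lt_atan.
by lra.
Qed.

Lemma cos_sqr_acot r x : 0 < r < pi / 2 -> 0 < x ->
  cos r ^+ 2 = x ^+ 2 / (1 + x ^+ 2) -> r = acot x.
Proof.
move=> r0 x0; rewrite -cos_acot_sqr => e; have a0 := acot_gt0_ltpihalf x0.
have pi0 := pi_gt0 R.
have cosgt0 s : 0 < s < pi / 2 -> 0 <= cos s.
  by move=> s0; apply: cos_ge0_pihalf; lra.
have {}e : cos r = cos (acot x).
  by apply/eqP; rewrite -(@eqrXn2 _ 2) ?cosgt0//; apply/eqP.
by apply: cos_inj e; rewrite in_itv /=; lra.
Qed.

End Cotangent.

(** * Continuation of a complete open portion along curves *)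

Section Continuation.
Variables (R : realType) (m : nat) (c : R).
Local Notation C := R[i].
Local Notation Re := complex.Re.
Local Notation Im := complex.Im.
Local Notation CV := 'cV[C]_m.+1.
Local Notation P := (@Psi R m c).
Local Notation cc := (c%:C)%C.
Local Notation CQ := (CQ R m c).
Local Notation HQ := (hyperquadric R m c).
Implicit Types (z w : HQ) (g : R -> HQ) (M Q : set CQ).

Hypothesis hc : c = 1 \/ c = -1.
Let hc2 : c ^+ 2 = 1. Proof. exact: hcsqr. Qed.

Lemma is_derive_affine (f : R -> R) (s d : R) (x : R^o) (df : R) :
  is_derive (s + x * d : R^o) 1 f df -> is_derive x 1 (fun x => f (s + x * d)) (df * d).
Proof.
move=> fD; have lin : is_derive x 1 (fun x => s + x * d) d.
  have h := is_deriveD (is_derive_cst (s : R^o) x 1)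
    (is_deriveM (is_derive_id x 1) (is_derive_cst (d : R^o) x 1)).
  by apply: (is_derive_eq h); rewrite scaler0 !add0r /GRing.scale /= mulr1.
exact: (@is_derive1_comp R f (fun x => s + x * d) x _ _ fD lin).
Qed.

Lemma is_derive_C1 (f : R -> R) (t : R^o) : C1_function f -> is_derive t 1 f (derive1 f t).
Proof. by move=> [df _]; rewrite derive1E; exact: DeriveDef. Qed.

Lemma derive1_affine (f : R -> R) (s d : R) : C1_function f ->
  derive1 (fun x => f (s + x * d)) = fun x => derive1 f (s + x * d) * d.
Proof.
move=> Cf; apply/funext => x; rewrite [LHS]derive1E.
by have h := is_derive_affine (is_derive_C1 (s + x * d) Cf); exact: derive_val.
Qed.

Lemma C1_affine (f : R -> R) (s d : R) : C1_function f ->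
  C1_function (fun x => f (s + x * d)).
Proof.
move=> Cf; split=> [x|].
  by have h := is_derive_affine (is_derive_C1 (s + x * d) Cf); exact: ex_derive.
rewrite derive1_affine// => x; apply: cvgM; last exact: cvg_cst.
have cl : {for x, continuous (fun x : R => s + x * d)}; last first.
  by apply: (continuous_comp cl); have [_] := Cf; exact.
by apply: cvgD; [exact: cvg_cst|apply: cvgM; [exact: cvg_id|exact: cvg_cst]].
Qed.

Lemma C1_curve_affine g s d : C1_curve g -> C1_curve (fun x => g (s + x * d)).
Proof.
by move=> Cg i; have [c1 c2] := Cg i; split; [exact: (C1_affine _ _ c1)|exact: (C1_affine _ _ c2)].
Qed.

Lemma speed_sqr_affine g s d x : C1_curve g ->
  speed_sqr (fun x => g (s + x * d)) x = d ^+ 2 * speed_sqr g (s + x * d).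
Proof.
move=> Cg; have vE : velocity (fun x => g (s + x * d)) x = ((d%:C)%C) *: velocity g (s + x * d).
  apply/matrixP => i j; rewrite (ord1 j) [LHS]mxE [RHS]mxE /velocity [X in _ = _ * X]mxE.
  have [c1 c2] := Cg i.
  have := congr1 (fun f => f x) (derive1_affine s d c1).
  have := congr1 (fun f => f x) (derive1_affine s d c2).
  rewrite !derive1E => -> ->; apply: complex_eq => /=; ring.
rewrite /speed_sqr vE !submersion_metricE ?val_Psi// PsiZZ PsiZr sqnormM sqnorm_real ReM_real.
by ring.
Qed.

Lemma dist_along M g K s t : C1_curve g -> 0 <= K ->
  (forall x, 0 <= x <= 1 -> speed_sqr g x <= K ^+ 2) ->
  (forall x, 0 <= x <= 1 -> 0 <= s + x * (t - s) <= 1 /\ M (proj (g (s + x * (t - s))))) ->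
  (riemannian_dist M (proj (g s)) (proj (g t)) <= (`|t - s| * K)%:E)%E.
Proof.
move=> Cg K0 gK st; apply: (joins_dist (g := fun x => g (s + x * (t - s)))).
  split; first exact: C1_curve_affine.
  - by rewrite mul0r addr0.
  - by rewrite mul1r addrC subrK.
  - by move=> x /st[].
apply: curve_length_le; [exact: C1_curve_affine|by rewrite mulr_ge0|].
move=> x /st[x01 _]; rewrite speed_sqr_affine// exprMn real_normK ?num_real//.
by rewrite ler_wpM2l ?sqr_ge0// gK.
Qed.

Lemma continuous_sqrt_bound (f : R -> R) : (forall t, 0 <= f t) ->
  continuous (fun t => Num.sqrt (f t)) ->
  exists2 K, 0 <= K & forall x, 0 <= x <= 1 -> f x <= K ^+ 2.
Proof.
move=> f0 cf; have [x _ mx] := EVT_max ler01 (continuous_subspaceT cf).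
exists (Num.sqrt (f x)); first exact: sqrtr_ge0.
move=> y y01; rewrite -[leLHS]sqr_sqrtr//.
by rewrite ler_pXn2r ?nnegrE ?sqrtr_ge0// mx// in_itv.
Qed.

Lemma speed_bound g : C1_curve g ->
  exists2 K, 0 <= K & forall x, 0 <= x <= 1 -> speed_sqr g x <= K ^+ 2.
Proof. by move=> Cg; apply: continuous_sqrt_bound => [t|]; [exact: speed_sqr_ge0|exact: speed_continuous]. Qed.

Lemma dist_small e : 0 < e -> exists2 d, 0 < d & forall z w,
  (riemannian_dist setT (proj z) (proj w) < d%:E)%E -> `|1 - sqnorm (P (val z) (val w))| < e.
Proof.
move=> e0; have : (fun t => csn c t ^+ 2) @ (0 : R) --> csn c 0 ^+ 2.
  by apply: cvgM; exact: continuous_csn.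
rewrite csn0 expr1n => /cvgrPdist_lt/(_ e e0)/nbhs_ballP[d /= d0 bd].
exists d => // z w; have [rho adm zw] := admissible_distance_exists hc z w.
rewrite (riemannian_distE hc adm zw) lte_fin zw => rd; apply: bd.
by rewrite /ball /= sub0r normrN ger0_norm//; case: adm.
Qed.

(** The equality case of Cauchy-Schwarz: the horizontal part of w at z has norm zero, so w is a
    multiple of z. *)
Lemma proj_eq z w : sqnorm (P (val z) (val w)) = 1 -> proj z = proj w.
Proof.
move=> zw; have h0 : horizontal c (val z) (val w) = 0.
  apply: (Psi_horizontal_le0 hc (val_Psi z)); first exact: Psi_horizontal (val_Psi z).
  rewrite (Psi_complement hc (val_Psi w) (val_Psi z)).
  by rewrite (Psi_conj c (val z) (val w)) sqnorm_conj zw subrr mulr0.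
apply/projP; exists (cc * P (val z) (val w)).
  by rewrite sqnormE sqnormM sqnorm_real hc2 zw mulr1 rmorph1.
by apply/eqP; rewrite -subr_eq0; apply/eqP.
Qed.

Lemma curve_nbhs g (t e : R) : C1_curve g -> 0 < e -> exists2 d, 0 < d &
  forall s, `|t - s| < d -> forall i, `|val (g s) i 0 - val (g t) i 0| < (e%:C)%C.
Proof.
move=> Cg e0; have cg := C1_curve_vcont Cg.
have near : \forall s \near t, forall i, `|val (g s) i 0 - val (g t) i 0| < (e%:C)%C.
  apply: (@filter_forall R _ (fun i s => `|val (g s) i 0 - val (g t) i 0| < (e%:C)%C) (nbhs t)) => i.
  have [cRe cIm] := cg i t.
  have e2 : 0 < e / 2 by rewrite divr_gt0.
  have /cvgrPdist_lt/(_ _ e2) n1 := cRe; have /cvgrPdist_lt/(_ _ e2) n2 := cIm.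
  near=> s; apply: normC_lt => //.
  have h1 : `|Re (val (g t) i 0) - Re (val (g s) i 0)| < e / 2 by near: s.
  have h2 : `|Im (val (g t) i 0) - Im (val (g s) i 0)| < e / 2 by near: s.
  move: h1 h2; rewrite /sqnorm; move: (val (g t) i 0) (val (g s) i 0) => [a b] [a' b'] /=.
  have sq (x : R) : `|x| < e / 2 -> x ^+ 2 < (e / 2) ^+ 2.
    by move=> xe; rewrite -[x ^+ 2]real_normK ?num_real// ltr_pXn2r ?nnegrE// ltW.
  move=> /sq h1 /sq h2; have -> : e ^+ 2 = (e / 2) ^+ 2 + (e / 2) ^+ 2 + e ^+ 2 / 2 by field.
  have e22 : 0 < e ^+ 2 / 2 by rewrite divr_gt0// exprn_gt0.
  by move: h1 h2; rewrite -[(a - a') ^+ 2]sqrrN -[(b - b') ^+ 2]sqrrN !opprB; lra.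
have [d /= d0 bd] := (nbhs_ballP _ _).1 near.
by exists d => // s ts; apply: bd.
Unshelve. all: by end_near. Qed.

(* A complete open portion cannot stop along a curve of the hypersurface: the
   points of the curve before the last parameter form a Cauchy sequence. *)
Lemma curve_continuation M Q g : riemannian_complete M -> open_portion M Q ->
  C1_curve g -> (forall t, Q (proj (g t))) -> M (proj (g 0)) -> M (proj (g 1)).
Proof.
move=> Mcomplete [_ _ Mopen] Cg gQ M0; have [K K0 gK] := speed_bound Cg.
(* Parameters up to which the curve stays in M. Completeness puts the point at the supremum t in M,
   and openness then forces t = 1. *)
pose E : set R := [set t | 0 <= t <= 1 /\ forall s, 0 <= s <= t -> M (proj (g s))].
have E0 : E 0.
  split=> [|s s0]; first by rewrite lexx ler01.
  by rewrite (_ : s = 0)//; apply/eqP; rewrite eq_le andbC.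
have supE : has_sup E by split; [exists 0|exists 1 => t [/andP[]]].
set t := sup E; have t0 : 0 <= t by exact: (sup_upper_bound supE).
have t1 : t <= 1 by apply: ge_sup; [exists 0|move=> s [/andP[]]].
have below s : 0 <= s < t -> M (proj (g s)).
  move=> /andP[s0 st]; have ts0 : 0 < t - s by rewrite subr_gt0.
  have [r [_ rM] sr] := sup_adherent ts0 supE; apply: rM; rewrite s0 ltW//.
  by move: sr; rewrite subKr.
have Mt : M (proj (g t)).
  have [tz|tn0] := eqVneq t 0; first by rewrite tz.
  have tpos : 0 < t by rewrite lt_neqAle eq_sym tn0.
  (* Parameters increasing to t; the speed bound makes their images a Cauchy sequence for the
     distance of M. *)
  pose u (n : nat) : R := t - t / n.+1%:R.
  have uin n : 0 <= u n < t.
    rewrite subr_ge0 ltrBlDr ltrDl divr_gt0// andbT ler_pdivrMr//.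
    by rewrite ler_peMr// ler1n.
  have udist (k l N : nat) : (N <= k)%N -> (N <= l)%N -> `|u l - u k| <= N.+1%:R^-1.
    move=> Nk Nl; have b n : (N <= n)%N -> 0 <= t / n.+1%:R <= N.+1%:R^-1.
      move=> Nn; rewrite divr_ge0//=; apply: (@le_trans _ _ n.+1%:R^-1).
        by rewrite ler_piMl ?invr_ge0.
      by rewrite lef_pV2 ?posrE// ler_nat.
    have := b _ Nk; have := b _ Nl; rewrite /u ler_norml.
    by move: (t / l.+1%:R) (t / k.+1%:R) (N.+1%:R^-1) => a b' x; lra.
  have Mu n : M (proj (g (u n))) by exact: below.
  have ucauchy e : 0 < e -> exists N : nat, forall k l : nat, (N <= k)%N -> (N <= l)%N ->
      (riemannian_dist M (proj (g (u k))) (proj (g (u l))) < e%:E)%E.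
    move=> e0; have K1 : 0 < K + 1 by lra.
    have := cvg_harmonic (R := R) => /cvgrPdist_lt/(_ (e / (K + 1)) (divr_gt0 e0 K1)).
    move=> [N _ /(_ N (leqnn _))]; rewrite sub0r normrN ger0_norm ?invr_ge0// => hN.
    exists N => k l Nk Nl; apply: (@le_lt_trans _ _ (`|u l - u k| * K)%:E).
      apply: dist_along => // x x01.
      have inn : 0 <= u k + x * (u l - u k) < t.
        have := uin k; have := uin l; move: (u k) (u l) => a b b0 a0.
        have [ab|ba] := leP a b.
          have h1 : 0 <= x * (b - a) by rewrite mulr_ge0 ?subr_ge0//; lra.
          have h2 : x * (b - a) <= b - a by rewrite ler_piMl ?subr_ge0//; lra.
          lra.
        have h1 : 0 <= x * (a - b) by rewrite mulr_ge0//; lra.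
        have h2 : x * (a - b) <= a - b by rewrite ler_piMl//; lra.
        have h3 : x * (b - a) = - (x * (a - b)) by ring.
        lra.
      by split; [lra|exact: below].
    have hN' : N.+1%:R^-1 * (K + 1) < e by rewrite -ltr_pdivlMr.
    rewrite lte_fin (le_lt_trans _ hN')// ler_pM//; first exact: udist.
    by rewrite lerDl.
  have [p Mp plim] := Mcomplete (fun n => proj (g (u n))) Mu ucauchy.
  have [w pE] := proj_surj p; rewrite pE in Mp plim.
  (* The limit supplied by completeness is g(t) itself: |Psi(g(u n), w)|^2 tends to 1 by the
     distance, and to its value at t by continuity. *)
  suff -> : proj (g t) = proj w by [].
  apply: proj_eq; apply/eqP; rewrite -subr_eq0 -normr_le0.
  apply/ler_addgt0Pr => e e0; rewrite add0r.
  have e2 : 0 < e / 2 by rewrite divr_gt0.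
  have [d d0 dz] := dist_small e2; have [N1 hN1] := plim d d0.
  pose f s := sqnorm (P (val (g s)) (val w)).
  have cf : {for t, continuous f}.
    have [cRe cIm] := clim_Psi c (C1_curve_vcont Cg ^~ t) (fun i => clim_cst (val w i 0)).
    by apply: cvgD; apply: cvgM.
  have /cvgrPdist_lt/(_ _ e2)/nbhs_ballP[r /= r0 br] := cf.
  have := cvg_harmonic (R := R) => /cvgrPdist_lt/(_ r r0)[N2 _ /(_ (N1 + N2)%N (leq_addl _ _))].
  rewrite sub0r normrN ger0_norm ?invr_ge0// => hN2.
  have near1 := dz _ _ (le_lt_trans (riemannian_dist_setT M _ _) (hN1 (N1 + N2)%N (leq_addr _ _))).
  have near2 : `|f t - f (u (N1 + N2)%N)| < e / 2.
    apply: br; rewrite /ball /= /u subKr ger0_norm ?divr_ge0//.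
    by apply: le_lt_trans hN2; rewrite ler_piMl.
  rewrite -/(f t) distrC -(subrKA (f (u (N1 + N2)%N))) (le_trans (ler_normD _ _))//.
  by rewrite (splitr e) lerD// ltW// distrC.
suff -> : 1 = t by [].
apply/eqP; rewrite eq_le t1 andbT leNgt; apply/negP => lt1.
have [e e0 he] := Mopen _ Mt; have [d d0 hd] := curve_nbhs t Cg e0.
pose s := Num.min 1 (t + d / 2).
have d20 : 0 < d / 2 by rewrite divr_gt0.
have ts : t < s by rewrite lt_min lt1 ltrDl.
have [s1 sd] : s <= 1 /\ s <= t + d / 2 by rewrite /s !ge_min !lexx orbT.
suff /(sup_upper_bound supE) : E s by rewrite leNgt ts.
split; first by rewrite s1 (le_trans t0)// ltW.
move=> r /andP[r0 rs]; have [rt|tr] := ltP r t; first by apply: below; rewrite r0.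
apply: he; last exact: gQ.
by apply: hd; rewrite ler0_norm; lra.
Qed.

End Continuation.

(** * Joining the points of a level set *)

Section CompleteQuadric.
Variables (R : realType) (m : nat) (c eps k : R) (a : 'cV[R[i]]_m.+1).
Local Notation C := R[i].
Local Notation Re := complex.Re.
Local Notation Im := complex.Im.
Local Notation CV := 'cV[C]_m.+1.
Local Notation P := (@Psi R m c).
Local Notation cc := (c%:C)%C.
Local Notation CQ := (CQ R m c).
Local Notation HQ := (hyperquadric R m c).
Implicit Types (z w : HQ) (g : R -> HQ) (M Q : set CQ).

Hypothesis hc : c = 1 \/ c = -1.
Hypothesis heps : eps ^+ 2 = 1.
Hypothesis Paa : P a a = (eps%:C)%C.
Hypothesis k0 : k != 0.
Hypothesis k1 : 1 - k != 0.
Let hc2 : c ^+ 2 = 1. Proof. exact: hcsqr. Qed.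
Local Notation N0 := (c * (1 - k)).

Section Step.
Variables (x u u' : CV).
Hypothesis xx : Re (P x x) = c * k.
Hypothesis xa : exists b, x = b *: a.
Hypothesis au : P a u = 0.
Hypothesis au' : P a u' = 0.
Hypothesis uu : P u u = (N0%:C)%C.
Hypothesis uu' : P u' u' = (N0%:C)%C.
Hypothesis kap : 0 <= Re (P u u') / N0.

(** The path is the stereographic image, from -u, of a segment from 0 to the coordinate v of u', the
    axis component x being kept. The sign condition keeps u' away from the centre -u. *)
Lemma quadric_step : exists g, [/\ C1_curve g, val (g 0) = x + u, val (g 1) = x + u' &
  forall t, P a (val (g t)) = P a x].
Proof.
have n0 : N0 != 0 := N0_neq0 hc k1.
have [s1 s1E] : exists s1, s1 = 1 + Re (P u u') / N0 by eexists.
have s10 : 0 < s1 by rewrite s1E ltr_pwDl.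
(* Here v is the stereographic coordinate of u' and q = Psi(v,v)/N0, which exceeds -1. *)
pose q := 2 / s1 - 1; pose v : CV := ((s1^-1)%:C)%C *: (u + u') - u.
have q1 : -1 < q by rewrite /q ltrDr divr_gt0.
have kE : Re (P u u') = N0 * (s1 - 1) by rewrite s1E addrAC subrr add0r mulrC divfK.
have puu : Re (P u u) = N0 by rewrite uu.
have puu' : Re (P u' u') = N0 by rewrite uu'.
have uv : Re (P u v) = 0.
  rewrite PsiBr PsiZr PsiDr ReB ReM_real ReD puu kE.
  by field; rewrite gt_eqF.
have vv : Re (P v v) = q * N0.
  rewrite PsiBl !PsiBr !PsiZl !PsiZr conj_real !PsiDl !PsiDr.
  rewrite (Psi_conj c u u') uu uu' /q; move: (P u u') kE => [r i] /= ->.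
  by field; rewrite gt_eqF.
(* A curve is parametrized by the whole real line; the sine runs from 0 to 1 on [0,1] and keeps b^2
   <= 1 elsewhere, so that 1 + q b^2 never vanishes. *)
pose b (t : R) := sin (0 + t * (pi / 2)); pose db (t : R) := cos (0 + t * (pi / 2)) * (pi / 2).
pose D (t : R) := 1 + q * (b t * b t); pose dD (t : R) := q * (b t * db t + b t * db t).
pose f (t : R) := 2 * (D t)^-1; pose df (t : R) := 2 * (- (D t)^-2 * dD t).
pose h (t : R) := f t * b t; pose dh (t : R) := f t * db t + b t * df t.
have bD (t : R^o) : is_derive t 1 b (db t) by apply: is_derive_affine; exact: is_derive_sin.
have DD (t : R^o) : is_derive t 1 D (dD t).
  have e := is_deriveD (is_derive_cst (1 : R) t 1) (is_deriveZ q (is_deriveM (bD t) (bD t))).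
  by apply: (is_derive_eq e); rewrite add0r.
have b2 t : b t * b t <= 1.
  by rewrite -expr2 -(cos2Dsin2 (0 + t * (pi / 2))) lerDr sqr_ge0.
have D0 t : 0 < D t.
  have := b2 t; have : 0 <= b t * b t by rewrite -expr2 sqr_ge0.
  rewrite /D; move: (b t * b t) => y y0 y1; have [q0|q0] := leP 0 q.
    by rewrite ltr_pwDl// mulr_ge0.
  have : - q * y <= - q * 1 by rewrite ler_wpM2l// oppr_ge0 ltW.
  by rewrite mulr1 mulNr; lra.
have Dn t : D t != 0 by rewrite gt_eqF.
have fD (t : R^o) : is_derive t 1 f (df t).
  exact: (is_deriveZ 2 (is_deriveV (Dn t) (DD t))).
have hD (t : R^o) : is_derive t 1 h (dh t) by exact: (is_deriveM (fD t) (bD t)).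
have cb := is_derive_continuous bD; have cD := is_derive_continuous DD.
have cf := is_derive_continuous fD.
have caff : continuous (fun t : R => 0 + t * (pi / 2)).
  by move=> t; apply: cvgD; [exact: cvg_cst|apply: cvgM; [exact: cvg_id|exact: cvg_cst]].
have cdb : continuous db.
  move=> t; apply: cvgM; last exact: cvg_cst.
  by apply: (continuous_comp (caff t)); exact: continuous_cos.
have cdD : continuous dD.
  move=> t; apply: cvgM; first exact: cvg_cst.
  by apply: cvgD; apply: cvgM; [exact: cb|exact: cdb|exact: cb|exact: cdb].
have cdf : continuous df.
  move=> t; apply: cvgM; first exact: cvg_cst.
  apply: cvgM; last exact: cdD.
  apply: cvgN; apply: cvgV; first by rewrite expf_neq0.
  by apply: cvgM; exact: cD.
have cdh : continuous dh.
  by move=> t; apply: cvgD; apply: cvgM; [exact: cf|exact: cdb|exact: cb|exact: cdf].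
have wE t : (x - u) + (((f t)%:C)%C *: u + ((h t)%:C)%C *: v) =
    x + (((f t)%:C)%C *: (u + ((b t)%:C)%C *: v) - u).
  by rewrite (scalerDr ((f t)%:C)%C) scalerA -rmorphM [X in _ = _ + X]addrC [RHS]addrA.
have av : P a v = 0 by rewrite PsiBr PsiZr PsiDr au au' addr0 mulr0 subrr.
have ax (y : CV) : P a y = 0 -> P x y = 0.
  by case: xa => d ->; rewrite PsiZl => ->; rewrite mulr0.
have awt t : P a (((f t)%:C)%C *: (u + ((b t)%:C)%C *: v) - u) = 0.
  by rewrite PsiBr PsiZr PsiDr PsiZr au av mulr0 addr0 mulr0 subrr.
have ww t : P ((x - u) + (((f t)%:C)%C *: u + ((h t)%:C)%C *: v))
    ((x - u) + (((f t)%:C)%C *: u + ((h t)%:C)%C *: v)) = cc.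
  rewrite wE [LHS]Psi_self; congr (_%:C)%C; rewrite Re_PsiD_orth; last exact: ax (awt t).
  rewrite xx (stereographic_norm (n0 := N0)) //; first by ring.
    by rewrite PsiZr ReM_real uv mulr0.
  rewrite PsiZZ sqnorm_real ReM_real vv /f.
  transitivity (2 * N0 * (D t / D t)); last by rewrite divff// mulr1.
  by rewrite /D; ring.
have [g [Cg gE _]] := affine_curve fD hD cdf cdh ww.
exists g; split=> // [||t]; rewrite gE wE.
- rewrite /f /D /b mul0r addr0 sin0 !mulr0 addr0 invr1 mulr1 rmorph0 scale0r addr0.
  rewrite (_ : (2%:C)%C = 2) ?rmorph_nat// scaler_nat mulr2n addrK.
  by [].
- have b1 : b 1 = 1 by rewrite /b add0r mul1r sin_pihalf.
  have f1 : f 1 = s1.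
    by rewrite /f /D b1 !mulr1 /q addrC subrK; field; rewrite gt_eqF.
  rewrite b1 f1 rmorph1 scale1r /v [u + (_ - u)]addrC subrK scalerA -rmorphM divff ?gt_eqF//.
  by rewrite rmorph1 scale1r [u + u']addrC addrK.
- by rewrite PsiDr awt addr0.
Qed.

End Step.

(** Splits a lift of a point of the level set into its axis component and an orthogonal component of
    fixed norm N0. *)
Lemma quadric_lift z : eps * c * sqnorm (P a (val z)) = k ->
  let x := (((eps%:C)%C * P a (val z)) *: a) in
  [/\ Re (P x x) = c * k, P a (val z - x) = 0 & P (val z - x) (val z - x) = (N0%:C)%C].
Proof.
move=> zk x; have ee : (eps%:C)%C * (eps%:C)%C = 1 :> C by rewrite -rmorphM -expr2 heps.
have az : P a (val z - x) = 0.
  by rewrite PsiBr PsiZr Paa mulrAC ee mul1r subrr.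
have Pxx : Re (P x x) = c * k.
  rewrite PsiZZ sqnormM sqnorm_real heps mul1r Paa -rmorphM /= -zk.
  transitivity (c ^+ 2 * (eps * sqnorm (P a (val z)))); last by ring.
  by rewrite hc2 mul1r mulrC.
split=> //; rewrite [LHS]Psi_self; congr (_%:C)%C.
have zE : val z = x + (val z - x) by rewrite addrC subrK.
have : Re (P (val z) (val z)) = c by rewrite val_Psi.
rewrite {1 2}zE (Re_PsiD_orth (v := x)) ?Pxx; last by rewrite {1}/x PsiZl az mulr0.
by move: (Re _) => y; lra.
Qed.

(** Two points have lifts with the same axis component. They are joined in two steps through i or -i
    times the first orthogonal component, and M contains every endpoint by [curve_continuation]. *)
Lemma complete_quadric M : riemannian_complete M -> open_portion M (quadric eps a k) ->
  M = quadric eps a k.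
Proof.
move=> Mc Mo; have [[p0 Mp0] MQ _] := Mo; apply/seteqP; split=> // p.
have [z0 p0E] := proj_surj p0; have [z1 ->] := proj_surj p; rewrite p0E in Mp0.
have Qz0 := (quadricE hc k z0 heps Paa).1 (MQ _ Mp0) => /(quadricE hc k z1 heps Paa) Qz1.
have [w pw aw] : exists2 w, proj w = proj z1 & P a (val w) = P a (val z0).
  apply: rephase; apply: (@mulfI _ (eps * c)); last by rewrite Qz0.
  by apply: contraNneq k0 => e0; rewrite -Qz0 e0 mul0r.
have Qw : eps * c * sqnorm (P a (val w)) = k by rewrite aw.
have := quadric_lift Qz0; have := quadric_lift Qw; rewrite aw /=.
set x := (_ *: a) => -[_ au1 uu1] [xx au0 uu0].
(* The intermediate vector is real-orthogonal to the first one; the sign makes its real product with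
   the target, divided by N0, nonnegative. *)
pose sg : R := if 0 <= Im (P (val z0 - x) (val w - x)) / N0 then 1 else -1.
have sg2 : sg ^+ 2 = 1 by rewrite /sg; case: ifP; rewrite ?sqrrN expr1n.
pose y : CV := ((0 +i* sg)%C : C) *: (val z0 - x).
have ay : P a y = 0 by rewrite PsiZr au0 mulr0.
have yy : P y y = (N0%:C)%C.
  by rewrite PsiZZ uu0 /sqnorm /= expr0n add0r sg2 mul1r.
have xa : exists b, x = b *: a by eexists.
have move_to (u u' : CV) z z' : P a u = 0 -> P a u' = 0 -> P u u = (N0%:C)%C ->
    P u' u' = (N0%:C)%C -> 0 <= Re (P u u') / N0 -> val z = x + u -> M (proj z) ->
    val z' = x + u' -> M (proj z').
  move=> e1 e2 e3 e4 e5 zE Mz z'E.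
  have [g [Cg g0 g1 ga]] := quadric_step xx xa e1 e2 e3 e4 e5.
  have -> : z' = g 1 by apply: val_inj; rewrite g1.
  apply: (curve_continuation hc Mc Mo Cg).
    move=> t; apply/(quadricE hc k _ heps Paa); rewrite ga -Qz0.
    have [_ az _] := quadric_lift Qz0; rewrite -/x in az.
    by rewrite -[in RHS](subrK x (val z0)) [in RHS]PsiDr az add0r.
  by have -> : g 0 = z by apply: val_inj; rewrite g0.
have xy : P (x + y) (x + y) == cc.
  rewrite Psi_self Re_PsiD_orth ?xx ?yy /=; last by case: xa => b ->; rewrite PsiZl ay mulr0.
  by apply/eqP; congr (_%:C)%C; ring.
have Mxy : M (proj (exist _ (x + y) xy : HQ)).
  apply: (move_to (val z0 - x) y z0) => //; last by rewrite addrC subrK.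
  by rewrite PsiZr uu0 /= mul0r mulr0 subrr mul0r.
rewrite -pw; apply: (move_to y (val w - x) _ w ay au1 yy uu1 _ _ Mxy) => //.
  rewrite PsiZl /sg; move: (P (val z0 - x) (val w - x)) => [r s] /=.
  case: (leP 0 (s / N0)) => h; first by rewrite mul0r mulN1r sub0r opprK.
  rewrite mul0r opprK mul1r sub0r mulNr oppr_ge0; exact: ltW.
by rewrite addrC subrK.
Qed.

End CompleteQuadric.

(** * Completeness of the spheres of complex projective space *)

Section CompleteSphere.
Variables (R : realType) (m : nat) (a : 'cV[R[i]]_m.+1) (k : R).
Local Notation C := R[i].
Local Notation Re := complex.Re.
Local Notation Im := complex.Im.
Local Notation CV := 'cV[C]_m.+1.
Local Notation P := (@Psi R m 1).
Local Notation CQ := (CQ R m 1).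
Local Notation HQ := (hyperquadric R m 1).
Local Notation Q := (quadric 1 a k : set CQ).
Implicit Types (z w : HQ) (v : CV).

Hypothesis Paa : P a a = ((1 : R)%:C)%C.
Hypothesis k01 : 0 < k < 1.

Let hc : (1 : R) = 1 \/ (1 : R) = -1. Proof. by left. Qed.
Let hc2 : (1 : R) ^+ 2 = 1. Proof. exact: expr1n. Qed.
Local Notation n := (1 - k).
Local Notation be := ((Num.sqrt k)%:C)%C.

Let k_gt0 : 0 < k. Proof. by case/andP: k01. Qed.
Let k_lt1 : k < 1. Proof. by case/andP: k01. Qed.
Let k_ge0 : 0 <= k. Proof. exact: ltW. Qed.
Let n0 : 0 < n. Proof. by rewrite subr_gt0. Qed.

Lemma Psi1_ge0 v : 0 <= Re (P v v).
Proof.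
rewrite Re_Psi_self mul1r addr_ge0 ?sqnorm_ge0// sumr_ge0// => i _.
exact: sqnorm_ge0.
Qed.

Lemma entry_le v i : sqnorm (v i 0) <= Re (P v v).
Proof.
rewrite Re_Psi_self mul1r; case: (unliftP ord0 i) => [j ->|->].
  rewrite (bigD1 j)//= addrCA lerDl addr_ge0 ?sqnorm_ge0// sumr_ge0// => l _.
  exact: sqnorm_ge0.
by rewrite lerDl sumr_ge0// => l _; exact: sqnorm_ge0.
Qed.

Lemma Psi1_eq0 v : Re (P v v) = 0 -> v = 0.
Proof.
move=> v0; apply/matrixP => i j; rewrite (ord1 j) mxE; apply/eqP; rewrite -sqnorm_eq0.
by rewrite eq_le sqnorm_ge0 -v0 entry_le.
Qed.

(** Fixing the phase by Psi(a,z) = sqrt k puts all lifts in one round sphere about the point sqrt(k)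
    a. *)
Lemma sphere_lift q : Q q -> exists2 z, q = proj z & P a (val z) = be.
Proof.
have [z ->] := proj_surj q => /(quadricE hc k z hc2 Paa) zk.
have [w wz wa] : exists2 w, proj w = proj z & P a (val w) = be.
  apply: rephase; rewrite sqnorm_real sqr_sqrtr//.
  by rewrite -zk !mul1r.
by exists w.
Qed.

Local Notation perp z := (val z - be *: a).

Lemma sphere_perp z : P a (val z) = be ->
  [/\ P a (perp z) = 0, P (perp z) (perp z) = (n%:C)%C & Re (P (be *: a) (be *: a)) = k].
Proof.
move=> az; have zk : 1 * 1 * sqnorm (P a (val z)) = k.
  by rewrite az sqnorm_real sqr_sqrtr ?mul1r.
have xE : ((1%:C)%C * P a (val z)) *: a = be *: a by rewrite az mul1r.
by have := quadric_lift hc hc2 Paa zk; rewrite /= xE 2!mul1r => -[].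
Qed.

Lemma sphere_Psi z w : P a (val z) = be -> P a (val w) = be ->
  P (val z) (val w) = (k%:C)%C + P (perp z) (perp w).
Proof.
move=> az aw; have [z1 _ _] := sphere_perp az; have [w1 _ kk] := sphere_perp aw.
have zE : val z = be *: a + perp z by rewrite addrC subrK.
have wE : val w = be *: a + perp w by rewrite addrC subrK.
have gen (x y : CV) : P a x = 0 -> P a y = 0 ->
    P (be *: a + x) (be *: a + y) = (k%:C)%C + P x y.
  move=> ax ay; rewrite PsiDl !PsiDr [P (be *: a) y]PsiZl ay mulr0 addr0.
  rewrite [P x (be *: a)]PsiZr (Psi_conj _ a x) ax rmorph0 mulr0 add0r.
  by rewrite (Psi_self _ (be *: a)) kk.
by rewrite {1}zE {1}wE gen.
Qed.

Lemma Re_PsiB_self v (v' : CV) :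
  Re (P (v - v') (v - v')) = Re (P v v) + Re (P v' v') - 2 * Re (P v v').
Proof.
rewrite PsiBl !PsiBr (Psi_conj _ v v').
by case: (P v v) (P v v') (P v' v') => ? ? [? ?] [? ?] /=; ring.
Qed.

Lemma perpB z w : val z - val w = perp z - perp w.
Proof. by rewrite opprB addrCA addrA subrKC addrC. Qed.

Lemma sphere_gap z w (d : R) : P a (val z) = be -> P a (val w) = be ->
  `|1 - sqnorm (P (val z) (val w))| < d ->
  Re (P (val z - val w) (val z - val w)) < d / k.
Proof.
move=> az aw; rewrite (sphere_Psi az aw).
have [_ zz _] := sphere_perp az; have [_ ww _] := sphere_perp aw.
rewrite perpB.
have cs : sqnorm (P (perp z) (perp w)) <= n * n.
  have := @cauchy_schwarz_pos R m 1 (perp z) (perp w); rewrite zz ww /=.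
  by apply => //; exact: Psi1_ge0.
rewrite Re_PsiB_self zz ww.
move: (P (perp z) (perp w)) cs => [x y] /=; rewrite /sqnorm /= add0r => cs h.
have k0 := k_gt0.
rewrite ltr_pdivlMr//.
have : 1 - ((k + x) ^+ 2 + y ^+ 2) < d := le_lt_trans (ler_norm _) h.
by move: cs; rewrite !expr2; nra.
Qed.

(** Conversely, normalized lifts at small angle are joined by an arc of a circle that keeps its
    component along a, hence stays in the sphere. *)
Lemma sphere_arc z w (e : R) : P a (val z) = be -> P a (val w) = be -> 0 < e < pi / 2 ->
  cos e * n < Re (P (perp z) (perp w)) ->
  (riemannian_dist Q (proj z) (proj w) < e%:E)%E.
Proof.
move=> az aw /andP[e0 epi] le; have pi0 := pi_gt0 R.
have [za zz kk] := sphere_perp az; have [wa ww _] := sphere_perp aw.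
pose kap := Re (P (perp z) (perp w)) / n.
have kapE : Re (P (perp z) (perp w)) = kap * n by rewrite divfK// gt_eqF.
have dE : Re (P (perp z - perp w) (perp z - perp w)) = 2 * n - 2 * Re (P (perp z) (perp w)).
  by rewrite Re_PsiB_self zz ww /=; ring.
have kap1 : kap <= 1.
  by rewrite /kap ler_pdivrMr// mul1r; have := Psi1_ge0 (perp z - perp w); rewrite dE; lra.
have kape : cos e < kap by rewrite /kap ltr_pdivlMr.
have cose : 0 < cos e by apply: cos_gt0_pihalf; lra.
pose th := acos kap.
have inn : -1 <= kap <= 1 by lra.
have th0 : 0 <= th by exact: acos_ge0.
have thpi : th <= pi by exact: acos_lepi.
have cth : cos th = kap by rewrite acosK// in_itv.
have the : th < e by rewrite -ltr_cos ?in_itv /= ?th0//; [rewrite cth|lra].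
have Qz : forall y : HQ, P a (val y) = be -> Q (proj y).
  move=> y ay; apply/(quadricE hc k y hc2 Paa).
  by rewrite ay sqnorm_real sqr_sqrtr ?mul1r.
have [s0|s0] := eqVneq (sin th) 0.
  have c1 : kap = 1.
    have := cos2Dsin2 th; rewrite s0 cth expr0n addr0 => /eqP; rewrite sqrf_eq1.
    by case/orP => /eqP// kN; lra.
  have zw : z = w.
    apply: val_inj; apply/eqP; rewrite -subr_eq0 perpB; apply/eqP/Psi1_eq0.
    by rewrite dE kapE c1; ring.
  by rewrite zw (le_lt_trans (dist_self (Qz w aw)))// lte_fin.
pose x2 : CV := (((sin th)^-1)%:C)%C *: (perp w - (kap%:C)%C *: perp z).
have x1 : P (be *: a) (perp z) = 0 by rewrite PsiZl za mulr0.
have ax2 : P a x2 = 0 by rewrite PsiZr [P a (_ - _)]PsiBr [P a (_ *: perp z)]PsiZr wa za mulr0 subrr mulr0.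
have x02 : P (be *: a) x2 = 0 by rewrite PsiZl ax2 mulr0.
have x00 : Re (P (be *: a) (be *: a)) = 1 * (1 - n) by rewrite kk; ring.
have x11 : Re (P (perp z) (perp z)) = 1 * n by rewrite zz mul1r.
have x12 : Re (P (perp z) x2) = 0.
  rewrite PsiZr ReM_real [P _ (_ - _)]PsiBr [P _ (_ *: perp z)]PsiZr zz -rmorphM.
  by rewrite (ReB (P _ _)) kapE subrr mulr0.
have x22 : Re (P x2 x2) = n.
  rewrite PsiZZ sqnorm_real ReM_real Re_PsiB_self PsiZZ sqnorm_real [P _ ((kap%:C)%C *: _)]PsiZr.
  rewrite zz ww !ReM_real Re_PsiC kapE /=.
  have s2 : sin th ^+ 2 = 1 - kap ^+ 2 by have := cos2Dsin2 th; rewrite cth; lra.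
  have s20 : 1 - kap ^+ 2 != 0 by rewrite -s2 expf_neq0.
  by rewrite exprVn s2; field.
have [g [Cg gE gl]] := circle_curve hc x1 x02 x00 x11 x22 x12 (or_introl erefl) th0.
have csnE t : csn 1 t = cos t :> R by rewrite /csn eqxx.
have ssnE t : ssn 1 t = sin t :> R by rewrite /ssn eqxx.
apply: (@le_lt_trans _ _ (th * Num.sqrt n)%:E); last first.
  rewrite lte_fin (le_lt_trans _ the)// ler_piMr//.
  by rewrite -[leRHS](sqrtr1 R) ler_wsqrtr// gerBl.
apply: (joins_dist (g := g)) gl; split=> //.
- have s1 (y : CV) : ((1 : R)%:C)%C *: y = y by rewrite rmorph1 scale1r.
  have s2 (y : CV) : ((0 : R)%:C)%C *: y = 0 by rewrite rmorph0 scale0r.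
  by congr proj; apply: val_inj; rewrite gE mulr0 csn0 ssn0 s1 s2 addr0 addrC subrK.
- have s1 (y : CV) : ((sin th)%:C)%C *: (((sin th)^-1%:C)%C *: y) = y.
    by rewrite scalerA -rmorphM divff// rmorph1 scale1r.
  congr proj; apply: val_inj; rewrite gE mulr1 csnE ssnE cth /x2 s1.
  by rewrite [X in be *: a + X]addrC subrK addrC subrK.
- have comb (r s : C) (y1 y2 : CV) : P a y1 = 0 -> P a y2 = 0 ->
      P a (be *: a + (r *: y1 + s *: y2)) = be.
    by move=> ay1 ay2; rewrite !PsiDr !PsiZr ay1 ay2 Paa !mulr0 !addr0 mulr1.
  by move=> t _; apply: Qz; rewrite gE; exact: comb.
Qed.

Lemma cauchy_sequence_cvg (x : nat -> R) :
  (forall e, 0 < e -> exists N : nat, forall i j : nat, (N <= i)%N -> (N <= j)%N ->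
     `|x i - x j| < e) -> exists l : R, x @ \oo --> l.
Proof.
move=> xC; suff h : cvg (x @ \oo) by exists (lim (x @ \oo)).
apply/cauchy_cvgP/cauchy_exP => e e0.
have [N hN] := xC e e0; exists (x N); exists N => // i Ni.
by apply: hN => //=.
Qed.

(** Normalized lifts of a Cauchy sequence converge entrywise by [sphere_gap]; the limit lies on the
    level set, and [sphere_arc] turns entrywise convergence back into convergence for the distance
    of the sphere. *)
Lemma sphere_complete : riemannian_complete Q.
Proof.
move=> q Qq qC; have k0 := k_gt0.
have [z zq] : {z : nat -> HQ & forall i, q i = proj (z i) /\ P a (val (z i)) = be}.
  apply: (@choice _ _ (fun i z => q i = proj z /\ P a (val z) = be)) => i.
  by have [y] := sphere_lift (Qq i); exists y.
have az i : P a (val (z i)) = be by case: (zq i).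
have close d : 0 < d -> exists N : nat, forall i j : nat, (N <= i)%N -> (N <= j)%N ->
    forall l, sqnorm (val (z i) l 0 - val (z j) l 0) < d.
  move=> d0; have [r r0 hr] := dist_small m hc (mulr_gt0 d0 k0).
  have [N hN] := qC r r0; exists N => i j Ni Nj l.
  have := hN i j Ni Nj; have [-> _] := zq i; have [-> _] := zq j.
  move=> /(le_lt_trans (riemannian_dist_setT _ _ _))/hr/(sphere_gap (az i) (az j)).
  rewrite mulfK ?gt_eqF//; apply: le_lt_trans.
  by have := entry_le (val (z i) - val (z j)) l; rewrite !mxE.
have part (f : C -> R) (l : 'I_m.+1) : (forall u, f u ^+ 2 <= sqnorm u) ->
    (forall x y : C, f (x - y) = f x - f y) ->
    exists y : R, (fun i => f (val (z i) l 0)) @ \oo --> y.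
  move=> fs fB; apply: cauchy_sequence_cvg => e e0.
  have [N hN] := close (e ^+ 2) (exprn_gt0 2 e0); exists N => i j Ni Nj.
  rewrite -fB -(@ltr_pXn2r _ 2) ?nnegrE//; last exact: ltW.
  rewrite real_normK ?num_real//; exact: le_lt_trans (fs _) (hN i j Ni Nj l).
have fRe (u : C) : Re u ^+ 2 <= sqnorm u by rewrite lerDl sqr_ge0.
have fIm (u : C) : Im u ^+ 2 <= sqnorm u by rewrite lerDr sqr_ge0.
have ImB (u v : C) : Im (u - v) = Im u - Im v by case: u v => ? ? [].
have [x xlim] := choice (fun l => part (@complex.Re R) l fRe (@ReB R)).
have [y ylim] := choice (fun l => part (@complex.Im R) l fIm ImB).
pose w0 : CV := \col_l (x l +i* y l)%C.
have lim l : clim \oo (fun i => val (z i) l 0) (w0 l 0).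
  by rewrite mxE; split; [exact: xlim|exact: ylim].
have cst_lim (u u' : C) : clim \oo (fun _ : nat => u) u' -> u = u'.
  move=> [h1 h2]; apply: complex_eq.
    by apply: (cvg_unique _ (cvg_cst _) h1).
  by apply: (cvg_unique _ (cvg_cst _) h2).
have ww : P w0 w0 = ((1 : R)%:C)%C.
  have E : (fun i => P (val (z i)) (val (z i))) = fun _ : nat => ((1 : R)%:C)%C.
    by apply/funext => i; exact: val_Psi.
  have h : clim \oo (fun i => P (val (z i)) (val (z i))) (P w0 w0) by exact: clim_Psi.
  by rewrite E in h; rewrite -(cst_lim _ _ h).
have aw : P a w0 = be.
  have E : (fun i => P a (val (z i))) = fun _ : nat => be by apply/funext.
  have h : clim \oo (fun i => P a (val (z i))) (P a w0).
    by apply: clim_Psi => // l; exact: clim_cst.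
  by rewrite E in h; rewrite -(cst_lim _ _ h).
have ww' : P w0 w0 == ((1 : R)%:C)%C by rewrite ww.
pose w : HQ := exist _ w0 ww'; have {}aw : P a (val w) = be by [].
exists (proj w).
  apply/(quadricE hc k w hc2 Paa).
  by rewrite aw sqnorm_real sqr_sqrtr ?mul1r.
move=> e e0; have pi0 := pi_gt0 R; pose e1 := Num.min e (pi / 4).
have [e1e e1p] : e1 <= e /\ e1 <= pi / 4 by rewrite /e1 !ge_min !lexx orbT.
have e10 : 0 < e1 by rewrite /e1 lt_min e0 divr_gt0.
(* Since cos e1 < 1, the angle condition of [sphere_arc] holds with strict inequality at the limit,
   hence eventually. *)
have cos1 : cos e1 < 1 by rewrite -(cos0 R) ltr_cos ?in_itv /=; lra.
have [h _] : clim \oo (fun i => P (val (z i)) w0) (P w0 w0).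
  by apply: clim_Psi => // l; exact: clim_cst.
have lt1 : k + cos e1 * n < Re (P w0 w0) by rewrite ww /= -ltrBrDl -[ltRHS]mul1r ltr_pM2r.
have [N _ hN] := cvgr_gt _ h _ lt1; exists N => i Ni.
have [-> _] := zq i; apply: (@lt_le_trans _ _ e1%:E); last by rewrite lee_fin.
apply: sphere_arc => //; first by lra.
by have := hN i Ni; rewrite /= -[w0]/(val w) (sphere_Psi (az i) aw) ReD /= ltrD2l.
Qed.

End CompleteSphere.

(** * Mass-symmetry and the corresponding levels *)

Section MassSymmetry.
Variables (R : realType) (m : nat) (c eps k : R) (a : 'cV[R[i]]_m.+1).
Variable M : set (CQ R m c).
Local Notation C := R[i].
Local Notation P := (@Psi R m c).
Hypothesis hm : (2 <= m)%N.
Hypothesis hc : c = 1 \/ c = -1.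
Hypothesis heps : eps ^+ 2 = 1.
Hypothesis Paa : P a a = (eps%:C)%C.
Hypothesis k0 : k != 0.
Hypothesis k1 : 1 - k != 0.
Hypothesis oM : open_portion M (quadric eps a k).
Local Notation A := (axis c eps a).
Let hc2 : c ^+ 2 = 1. Proof. exact: hcsqr. Qed.

Lemma quadric_decomposition : cross_eigenvalue m c k != orth_eigenvalue m c k ->
  spectral_decomposition M (center k A)
    (fun i : 'I_2 => [:: cross_eigenvalue m c k; orth_eigenvalue m c k]`_i)
    (fun i : 'I_2 => nth (cross_part k A) [:: cross_part k A; orth_part k A] i).
Proof.
have [Mne MQ Mo] := oM.
exact: (hypersurface_decomposition hm hc k0 k1 (axisK hc2 heps Paa) (axis_hadj hc2 eps a)
  (axis_tr hc2 heps Paa) (axis_corner hc2 eps a) (axis_mul hc2 eps a)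
  (fun p => MQ p) Mo Mne).
Qed.

(** The null alternative is excluded, and the constant term is [center], which has a as an
    eigenvector with eigenvalue k; a scalar matrix I/(m+1) then forces the value of k. *)
Lemma mass_symmetric_level : mass_symmetric M -> cross_eigenvalue m c k != 0 ->
  k = m.+1%:R^-1.
Proof.
move=> [K [x0 [lambda [x_ [dec ms]]]]] cross0; have [Mne MQ Mo] := oM.
have [lam0 x0E] := decomposition_center hm hc k0 k1 (axisK hc2 heps Paa) (axis_hadj hc2 eps a)
  (axis_tr hc2 heps Paa) (axis_corner hc2 eps a) (axis_mul hc2 eps a)
  (fun p => MQ p) Mo Mne dec cross0.
case: ms => [x0M|[i li0]]; last by have := lam0 i; rewrite li0 eqxx.
have Aa : A *m a = a.
  by rewrite axis_mul// Paa -rmorphM -expr2 heps rmorph1 scale1r.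
have ca : center k A *m a = (k%:C)%C *: a.
  rewrite /center mulmxDl -scalemxAl Aa -scalemxAl mulmxBl mul1mx Aa subrr scaler0.
  exact: addr0.
have a0 : a != 0.
  apply: contra_eq_neq heps => a0; move: Paa; rewrite a0 Psi0l => /(congr1 (@complex.Re R)) /= <-.
  by rewrite expr0n eq_sym oner_neq0.
have : ((k%:C)%C - m.+1%:R^-1) *: a = 0.
  by rewrite scalerBl -ca -x0E x0M mul_scalar_mx subrr.
move/eqP; rewrite scaler_eq0 (negbTE a0) orbF subr_eq0 => /eqP.
by rewrite -(rmorph_nat (real_complex R)) -fmorphV => /(congr1 (@complex.Re R)).
Qed.

End MassSymmetry.

Section Levels.
Variables (R : realType) (m : nat).
Hypothesis hm : (2 <= m)%N.

Lemma natrm_ge2 : 2 <= m%:R :> R.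
Proof. by rewrite ler_nat. Qed.

Lemma cross_eigenvalue_eq0 (c k : R) : c != 0 -> k != 0 -> 1 - k != 0 ->
  cross_eigenvalue m c k = 0 -> (2 * m%:R - 2) * k + 1 = 0.
Proof.
move=> c0 k0 k1 /eqP; rewrite /cross_eigenvalue mulf_eq0 invr_eq0 !mulf_eq0.
by rewrite (negbTE c0) (negbTE k0) (negbTE k1) /= orbF => /eqP.
Qed.

(** cos^2 r = 1/(m+1) is equivalent to cot^2 r = 1/m. *)
Lemma mass_symmetric_radius (r : R) : 0 < r < pi / 2 -> cos r ^+ 2 = m.+1%:R^-1 ->
  r = acot (Num.sqrt (1 / m%:R)).
Proof.
have m2 := natrm_ge2; have m0 : 0 < m%:R :> R by lra.
move=> r0 cr; apply: cos_sqr_acot => //; first by rewrite sqrtr_gt0 divr_gt0.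
rewrite cr sqr_sqrtr ?divr_ge0// ?ltW// -addn1 natrD.
by field; rewrite !gt_eqF//; lra.
Qed.

Lemma cos_mass_symmetric_radius : cos (acot (Num.sqrt (1 / m%:R))) ^+ 2 = m.+1%:R^-1 :> R.
Proof.
have m2 := natrm_ge2; have m0 : 0 < m%:R :> R by lra.
rewrite cos_acot_sqr sqr_sqrtr ?divr_ge0// ?ltW// -addn1 natrD.
by field; rewrite !gt_eqF//; lra.
Qed.

(** Here sinh^2 r = 1/(2m-2), and coth^2 r = 1 + 1/sinh^2 r. *)
Lemma null_tube_radius (r : R) : 0 < r -> (2 * m%:R - 2) * (- ssn (-1) r ^+ 2) + 1 = 0 ->
  coth r = Num.sqrt (2 * m - 1)%:R.
Proof.
have m2 := natrm_ge2; move=> r0 e; have s0 := ssnN1_gt0 r0; have c2 := csnN1_sqr r.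
have c0 : 0 < csn (-1) r by rewrite csnN1E divr_gt0// addr_gt0// expR_gt0.
have cothE : coth r = csn (-1) r / ssn (-1) r.
  rewrite /coth csnN1E ssnN1E; field.
  by move: s0; rewrite ssnN1E => s0; rewrite gt_eqF//; lra.
rewrite -[LHS]ger0_norm ?cothE ?divr_ge0 ?ltW// -sqrtr_sqr; congr Num.sqrt.
rewrite natrB ?muln_gt0 ?(leq_trans _ hm)// natrM exprMn exprVn c2.
apply: (mulIf (x := ssn (-1) r ^+ 2)); first by rewrite expf_neq0// gt_eqF.
rewrite divfK; last by rewrite expf_neq0// gt_eqF.
by move: e; move: (ssn _ _ ^+ 2) => s; lra.
Qed.

End Levels.

(** * Nonemptiness of spheres, and their levels *)

Section Nonempty.
Variables (R : realType) (m : nat).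
Hypothesis hm : (2 <= m)%N.
Local Notation C := R[i].
Local Notation Re := complex.Re.
Local Notation Im := complex.Im.
Local Notation CV := 'cV[C]_m.+1.
Local Notation P := (@Psi R m 1).
Local Notation HQ := (hyperquadric R m 1).

(** For a unit vector y orthogonal to z, the point of cos(r) z + sin(r) y is at distance r from
    [z]. *)
Lemma hypersphere_nonempty (z : HQ) (r : R) : admissible_distance 1 r ->
  (geodesic_hypersphere (proj z) r : set (CQ R m 1)) !=set0.
Proof.
move=> adm; have hc : (1 : R) = 1 \/ (1 : R) = -1 by left.
pose l (t : 'I_2) (v : CV) : R := [:: Re (P (val z) v); Im (P (val z) v)]`_t.
have hq : (m.*2 + 2 = m.+1 + m.+1)%N by rewrite -addnn addn2 addnS addSn.
have lD t v w : l t (v + w) = l t v + l t w.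
  case: t => -[|[|//]] /= ?; rewrite /l /= PsiDr; first by rewrite (ReD (P (val z) v)).
  by case: (P (val z) v) (P (val z) w) => ? ? [].
have lZ t s v : l t ((s%:C)%C *: v) = s * l t v.
  by case: t => -[|[|//]] /= ?; rewrite /l /= PsiZr ?ReM_real ?ImM_real.
have [e [le free]] := constrained_frame hq lD lZ.
have m0 : (0 < m.*2)%N by rewrite double_gt0 (leq_trans _ hm).
pose i := Ordinal m0.
have ze : P (val z) (e i) = 0.
  by apply: complex_eq; [exact: le i ord0|exact: le i (lift ord0 ord0)].
have e0 : e i != 0.
  apply/eqP => ei; have := free (fun j => (j == i)%:R) _ i; rewrite eqxx => h.
  suff : (1 : R) = 0 by move/eqP; rewrite oner_eq0.
  apply: h; rewrite (bigD1 i)//= ei scaler0 add0r big1// => j ji.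
  by rewrite (negbTE ji) rmorph0 scale0r.
have ee : 0 < Re (P (e i) (e i)).
  by rewrite ltNge; apply: contraNN e0 => h; apply/eqP/(Psi_horizontal_le0 hc (val_Psi z) ze).
pose s := Re (P (e i) (e i)).
pose y : CV := (((Num.sqrt s)^-1)%:C)%C *: e i.
have yy : Re (P y y) = 1.
  by rewrite PsiZZ ReM_real sqnorm_real exprVn sqr_sqrtr ?mulVf ?gt_eqF// ltW.
have zy : P (val z) y = 0 by rewrite PsiZr ze mulr0.
pose w0 : CV := ((cos r)%:C)%C *: val z + ((sin r)%:C)%C *: y.
have ww : P w0 w0 == ((1 : R)%:C)%C.
  rewrite Psi_self Re_PsiD_orth; last by rewrite PsiZl PsiZr zy !mulr0.
  rewrite [P (_ *: val z) _]PsiZZ [P (_ *: y) _]PsiZZ !sqnorm_real !ReM_real val_Psi yy.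
  by rewrite /= !mulr1 cos2Dsin2.
pose w : HQ := exist _ w0 ww; exists (proj w); apply/(riemannian_distP hc z w adm).
have -> : P (val z) (val w) = ((cos r)%:C)%C.
  rewrite -[val w]/w0 PsiDr [P _ (_ *: val z)]PsiZr [P _ (_ *: y)]PsiZr val_Psi zy.
  by rewrite mulr0 addr0 mulr1.
by rewrite sqnorm_real /csn eqxx.
Qed.

End Nonempty.

Lemma open_portion_refl (R : realType) m (c : R) (Q : set (CQ R m c)) :
  Q !=set0 -> open_portion Q Q.
Proof. by move=> Q0; split=> // z _; exists 1. Qed.

Section Levels2.
Variables (R : realType) (m : nat).
Hypothesis hm : (2 <= m)%N.

Lemma cos_sqr_level (r : R) : 0 < r < pi / 2 -> 0 < cos r ^+ 2 < 1.
Proof.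
move=> r0; have pi0 := pi_gt0 R; have [r1 r2] := andP r0.
have cp : 0 < cos r by apply: cos_gt0_pihalf; lra.
rewrite exprn_gt0//= expr_lt1// ?ltW//.
by rewrite -(cos0 R) ltr_cos ?in_itv /=; lra.
Qed.

Lemma admissible1 (r : R) : 0 < r < pi / 2 -> admissible_distance 1 r.
Proof. by case/andP => r0 /ltW r1; split=> [|_]; [exact: ltW|]. Qed.

Lemma hypersphere1E (z : hyperquadric R m 1) (r : R) : 0 < r < pi / 2 ->
  geodesic_hypersphere (proj z) r = quadric 1 (val z) (cos r ^+ 2).
Proof.
move=> r0; rewrite (geodesic_hypersphereE (or_introl erefl) z (admissible1 r0)).
by rewrite /csn eqxx.
Qed.

Lemma hypersphereN1E (z : hyperquadric R m (-1)) (r : R) : 0 < r ->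
  geodesic_hypersphere (proj z) r = quadric (-1) (val z) (csn (-1) r ^+ 2).
Proof.
by move=> r0; rewrite (geodesic_hypersphereE (or_intror erefl) z (admissibleN1 (ltW r0))).
Qed.

End Levels2.

Theorem lemma2 (R : realType) (m : nat) (hm : (2 <= m)%N) :
  (* (i) *)
  [/\ forall (p : CQ R m 1) (r : R) (M : set (CQ R m 1)),
        0 < r < pi / 2 -> r <> acot (Num.sqrt (1 / (2 * m + 1)%:R)) ->
        open_portion M (geodesic_hypersphere p r) -> finite_type M 2,
      forall (p : CQ R m (-1)) (r : R) (M : set (CQ R m (-1))),
        0 < r ->
        open_portion M (geodesic_hypersphere p r) -> finite_type M 2
    & forall (S : set (CQ R m (-1))) (r : R) (M : set (CQ R m (-1))),
        is_CH_hyperplane S -> 0 < r ->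
        open_portion M (tube S r) -> finite_type M 2] /\
  (* (ii) *)
  (forall (c : R) (M : set (CQ R m c)),
     (* the null 2-type tubes of CH^m, mass-symmetric only by convention *)
     ~ (c = -1 /\ exists (S : set (CQ R m c)) (r : R),
          [/\ is_CH_hyperplane S, 0 < r,
              coth r = Num.sqrt (2 * m - 1)%:R & M = tube S r]) ->
     (class_A1 M /\ riemannian_complete M /\ mass_symmetric M <->
      c = 1 /\ exists p : CQ R m c,
        M = geodesic_hypersphere p (acot (Num.sqrt (1 / m%:R))))).
Proof.
have m2 : 2 <= m%:R :> R := natrm_ge2 R hm.
have hc1 : (1 : R) = 1 \/ (1 : R) = -1 by left.
have hcN : (-1 : R) = 1 \/ (-1 : R) = -1 by right.
have sq1 : (1 : R) ^+ 2 = 1 := expr1n _ 2.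
have sqN : (-1 : R) ^+ 2 = 1 by rewrite sqrrN expr1n.
have k1N (k : R) : k < 1 -> 1 - k != 0 by move=> k1; rewrite gt_eqF// subr_gt0.
have k1P (k : R) : 1 < k -> 1 - k != 0 by move=> k1; rewrite lt_eqF// subr_lt0.
have [l0 l1] : 0 < (2 * m%:R + 2 : R)^-1 /\ (2 * m%:R + 2 : R)^-1 < 1.
  by split; [rewrite invr_gt0|rewrite invf_lt1]; lra.
split.
- split.
  + move=> p r M r0 rne; have [z ->] := proj_surj p; rewrite hypersphere1E// => Mo.
    have /andP[k0 k1] := cos_sqr_level r0.
    have kn0 : cos r ^+ 2 != 0 by rewrite gt_eqF.
    apply: (quadric_finite_type hc1 hm sq1 (val_Psi z) kn0 (k1N _ k1) Mo).
    (* Equal eigenvalues force cos^2 r = 1/(2m+2), that is cot^2 r = 1/(2m+1): the excluded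
       radius. *)
    apply/eqP => /(eigenvalue_eq hc1 hm kn0 (k1N _ k1)) e; apply: rne.
    have x0 : 0 < (2 * m + 1)%:R :> R by rewrite ltr0n addn1.
    have sx : 0 < Num.sqrt (1 / (2 * m + 1)%:R : R) by rewrite sqrtr_gt0 divr_gt0.
    apply: (cos_sqr_acot r0 sx); rewrite e sqr_sqrtr ?divr_ge0// ?ltW// natrD natrM.
    by field; rewrite !gt_eqF//; lra.
  + move=> p r M r0; have [z ->] := proj_surj p; rewrite hypersphereN1E// => Mo.
    have k1 := csnN1_gt1 r0.
    have kn0 : csn (-1) r ^+ 2 != 0 by rewrite gt_eqF// (lt_trans ltr01).
    apply: (quadric_finite_type hcN hm sqN (val_Psi z) kn0 (k1P _ k1) Mo).
    (* Here k = cosh^2 r > 1, whereas equal eigenvalues need k < 1. *)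
    apply/eqP => /(eigenvalue_eq hcN hm kn0 (k1P _ k1)) e.
    by move: k1; rewrite e; lra.
  + move=> S r M /CH_hyperplane_normalize[a Paa ->] r0; rewrite tubeE// => Mo.
    have s2 : 0 < ssn (-1) r ^+ 2 by rewrite exprn_gt0// ssnN1_gt0.
    have kn0 : - ssn (-1) r ^+ 2 != 0 by rewrite oppr_eq0 gt_eqF.
    have kn1 : 1 - - ssn (-1) r ^+ 2 != 0 by apply: k1N; lra.
    apply: (quadric_finite_type hcN hm sq1 Paa kn0 kn1 Mo).
    (* Here k = - sinh^2 r < 0, whereas equal eigenvalues need k > 0. *)
    by apply/eqP => /(eigenvalue_eq hcN hm kn0 kn1) e; lra.
have [l0' l1'] : 0 < (m.+1%:R : R)^-1 /\ (m.+1%:R : R)^-1 < 1.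
  by rewrite -addn1 natrD; split; [rewrite invr_gt0|rewrite invf_lt1]; lra.
move=> c M notnull; split.
- move=> [A1 [Mc Mms]]; case: A1 => [[cE [p [r [r0 Mo]]]]|[cE [p [r [r0 Mo]]]]|[cE [S [r [hS r0 Mo]]]]]; subst c.
  + split=> //; exists p; have [z pE] := proj_surj p.
    rewrite pE hypersphere1E// in Mo.
    have /andP[k0 k1] := cos_sqr_level r0.
    have kn0 : cos r ^+ 2 != 0 by rewrite gt_eqF.
    have cross0 : cross_eigenvalue m 1 (cos r ^+ 2) != 0.
      apply/eqP => /(cross_eigenvalue_eq0 (oner_neq0 R) kn0 (k1N _ k1)).
      have : 0 <= (2 * m%:R - 2) * cos r ^+ 2 by rewrite mulr_ge0 ?ltW//; lra.
      by lra.
    have e := mass_symmetric_level hm hc1 sq1 (val_Psi z) kn0 (k1N _ k1) Mo Mms cross0.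
    rewrite -(mass_symmetric_radius hm r0 e) pE hypersphere1E//.
    exact: (complete_quadric hc1 sq1 (val_Psi z) kn0 (k1N _ k1) Mc Mo).
  + have [z pE] := proj_surj p; rewrite pE hypersphereN1E// in Mo.
    have k1 := csnN1_gt1 r0.
    have kn0 : csn (-1) r ^+ 2 != 0 by rewrite gt_eqF// (lt_trans ltr01).
    have cN : -1 != 0 :> R by rewrite oppr_eq0 oner_neq0.
    have cross0 : cross_eigenvalue m (-1) (csn (-1) r ^+ 2) != 0.
      apply/eqP => /(cross_eigenvalue_eq0 cN kn0 (k1P _ k1)).
      have : 0 <= (2 * m%:R - 2) * csn (-1) r ^+ 2 by rewrite mulr_ge0 ?sqr_ge0//; lra.
      by lra.
    have e := mass_symmetric_level hm hcN sqN (val_Psi z) kn0 (k1P _ k1) Mo Mms cross0.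
    by move: k1; rewrite e ltNge (ltW l1').
  + have [a Paa SE] := CH_hyperplane_normalize hS; rewrite SE tubeE// in Mo.
    have s2 : 0 < ssn (-1) r ^+ 2 by rewrite exprn_gt0// ssnN1_gt0.
    have kn0 : - ssn (-1) r ^+ 2 != 0 by rewrite oppr_eq0 gt_eqF.
    have kn1 : 1 - - ssn (-1) r ^+ 2 != 0 by apply: k1N; lra.
    have cN : -1 != 0 :> R by rewrite oppr_eq0 oner_neq0.
    have cross0 : cross_eigenvalue m (-1) (- ssn (-1) r ^+ 2) != 0.
      (* A zero cross eigenvalue gives the null radius, and a complete M is then the whole tube,
         which the hypothesis sets apart. *)
      apply/eqP => /(cross_eigenvalue_eq0 cN kn0 kn1) e; apply: notnull; split=> //.
      exists S, r; split=> //; first exact: null_tube_radius.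
      rewrite SE tubeE//.
      exact: (complete_quadric hcN sq1 Paa kn0 kn1 Mc Mo).
    have e := mass_symmetric_level hm hcN sq1 Paa kn0 kn1 Mo Mms cross0.
    by move: s2; rewrite -oppr_lt0 e ltNge (ltW l0').
move=> [cE [p ME]]; subst c; have [z pE] := proj_surj p; subst p.
set rho := acot _ in ME *.
have r0 : 0 < rho < pi / 2.
  by apply: acot_gt0_ltpihalf; rewrite sqrtr_gt0 divr_gt0//; lra.
have kE : cos rho ^+ 2 = m.+1%:R^-1 := cos_mass_symmetric_radius R hm.
have /andP[k0 k1] := cos_sqr_level r0; clearbody rho.
have kn0 : cos rho ^+ 2 != 0 by rewrite gt_eqF.
have Mo : open_portion M (geodesic_hypersphere (proj z) rho).
  rewrite ME; apply: open_portion_refl; apply: hypersphere_nonempty => //.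
  exact: admissible1.
split; first by apply: Or31; split=> //; exists (proj z), rho.
rewrite hypersphere1E// in ME Mo.
split; first by rewrite ME; apply: sphere_complete; [exact: val_Psi|rewrite k0 k1].
(* The level 1/(m+1) differs from 1/(2m+2), so the two eigenvalues are distinct. *)
have ne : cross_eigenvalue m 1 (cos rho ^+ 2) != orth_eigenvalue m 1 (cos rho ^+ 2).
  apply/negP => /eqP/(eigenvalue_eq hc1 hm kn0 (k1N _ k1)); rewrite kE => /invr_inj.
  by rewrite -addn1 natrD; lra.
exists 2, (center (cos rho ^+ 2) (axis 1 1 (val z))).
do 2 eexists; split; first exact: (quadric_decomposition hm hc1 sq1 (val_Psi z) kn0 (k1N _ k1) Mo ne).
left; rewrite kE /center.
(* For k = 1/(m+1) the weights k and (1-k)/m of the two blocks agree, so [center] is scalar. *)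
have -> : (1 - ((m.+1%:R^-1)%:C)%C) / m%:R = ((m.+1%:R^-1)%:C)%C :> R[i].
  rewrite -(rmorph1 (real_complex R)) -rmorphB -(rmorph_nat (real_complex R) m) -fmorphV -rmorphM.
  by congr (_%:C)%C; rewrite -addn1 natrD; field; rewrite !gt_eqF//; lra.
rewrite -scalerDr addrC subrK fmorphV rmorph_nat.
by rewrite scalemx1.
Qed.
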